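(* The following decision problem D-MAX-0-1-TMT-2 is NP-complete: given a rooted temporal tree $\mathcal{G}=(\mathcal{V},\mathcal{E})$ with lifetime $\mathcal{T}$ in which every edge is associated with at most $2$ time intervals, and a positive integer $g$, does there exist a 0-1 timed matching $M$ for $\mathcal{G}$ with $|M|=g$?
   Context: A temporal graph $\mathcal{G}=(\mathcal{V},\mathcal{E})$ with lifetime $\mathcal{T}\in\mathbb{N}$ consists of a finite node set $\mathcal{V}$ (fixed over time) and a finite set $\mathcal{E}$ of edges; each edge joins two distinct nodes $u,v$ (at most one edge per pair of nodes) and is associated with a nonempty list of time intervals $[s_1,f_1),\dots,[s_k,f_k)$ with integers $0\le s_1<f_1<s_2<f_2<\dots<s_k<f_k\le\mathcal{T}$; the edge exists at each integer timestep $t$ lying in one of its intervals. The underlying graph is the static graph on $\mathcal{V}$ with an edge $\{u,v\}$ for each edge of $\mathcal{E}$ between $u$ and $v$. A temporal tree is a temporal graph whose underlying graph is a tree; a rooted temporal tree is a temporal tree with a designated root node. Two distinct edges overlap if they share an endpoint and there is a timestep at which both exist. A 0-1 timed matching for $\mathcal{G}$ is a subset of $\mathcal{E}$ no two of whose edges overlap. *)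

(* Defs.v *)
From HB Require Import structures.
From mathcomp Require Import all_boot all_order all_algebra.
Set Implicit Arguments.
Unset Strict Implicit.
Unset Printing Implicit Defensive.

(** * Deterministic multi-tape Turing machines and NP-completeness *)

Inductive move := MoveLeft | Stay | MoveRight.

(** A two-way infinite tape over [option A], where [None] is the blank.  The
    pair [(l, r)] has the scanned cell at the head of [r] and the cells to its
    left in [l], nearest first; all cells beyond [l] and [r] are blank. *)
Definition tape (A : Type) := (seq (option A) * seq (option A))%type.

Section Tape.
Variable A : Type.
Implicit Types (a : option A) (t : tape A).

Definition read t : option A := head None t.2.
Definition write a t : tape A := (t.1, a :: behead t.2).
Definition shift (m : move) t : tape A :=
  match m with
  | MoveLeft => (behead t.1, head None t.1 :: t.2)
  | Stay => t
  | MoveRight => (head None t.2 :: t.1, behead t.2)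
  end.

Definition word_tape (w : seq A) : tape A := ([::], map Some w).

(** The scanned cell and the cells to its right contain [w] and then only
    blanks. *)
Definition tape_holds t (w : seq A) : Prop :=
  forall j : nat, nth None t.2 j = nth None (map Some w) j.
End Tape.

(** There are [extra_tapes.+1] tapes: the input is on tape [ord0], and a machine
    computing a function leaves its output on tape [ord_max]. *)
Record tm (A : finType) := TM {
  extra_tapes : nat;
  tm_state : finType;
  start : tm_state;
  halting : pred tm_state;
  accepting : pred tm_state;
  delta : tm_state -> {ffun 'I_extra_tapes.+1 -> option A} ->
          tm_state * {ffun 'I_extra_tapes.+1 -> option A * move}
}.

Section Run.
Variables (A : finType) (M : tm A).

Record config := Config {
  cstate : tm_state M;
  ctapes : {ffun 'I_(extra_tapes M).+1 -> tape A}
}.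

Definition init (w : seq A) : config :=
  Config (start M) [ffun i => if i == ord0 then word_tape w else ([::], [::])].

(** Halting configurations are fixed points, so that [iter n step] is the
    configuration reached within [n] steps. *)
Definition step (c : config) : config :=
  if halting (cstate c) then c else
  let d := delta (cstate c) [ffun i => read (ctapes c i)] in
  Config d.1 [ffun i => shift (d.2 i).2 (write (d.2 i).1 (ctapes c i))].

Definition run (n : nat) (w : seq A) : config := iter n step (init w).
End Run.

Definition language (S : finType) := seq S -> Prop.

(** Membership in P.  The tape alphabet [A] contains the input alphabet through
    [inj]. *)
Definition polytime_decidable (S : finType) (L : language S) : Prop :=
  exists (A : finType) (inj : S -> A) (M : tm A) (p : {poly nat}),
    injective inj /\
    forall x : seq S,
      let c := run M p.[size x]%R (map inj x) in
      halting (cstate c) /\ (accepting (cstate c) <-> L x).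

Definition polytime_computable (S O : finType) (f : seq S -> seq O) : Prop :=
  exists (A : finType) (inS : S -> A) (inO : O -> A)
         (M : tm A) (p : {poly nat}),
    [/\ injective inS, injective inO &
    forall x : seq S,
      let c := run M p.[size x]%R (map inS x) in
      halting (cstate c) /\ tape_holds (ctapes c ord_max) (map inO (f x))].

(** The disjoint sum of the alphabets makes the concatenation uniquely
    decodable. *)
Definition word_pair (S W : finType) (x : seq S) (y : seq W) : seq (S + W) :=
  map inl x ++ map inr y.

Definition in_NP (S : finType) (L : language S) : Prop :=
  exists (W : finType) (V : language (S + W)%type) (q : {poly nat}),
    polytime_decidable V /\
    forall x : seq S,
      L x <-> exists y : seq W,
                (size y <= q.[size x]%R)%N /\ V (word_pair x y).

Definition polytime_reducible (S S' : finType)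
    (L : language S) (L' : language S') : Prop :=
  exists f : seq S -> seq S',
    polytime_computable f /\ forall x : seq S, L x <-> L' (f x).

Definition NP_hard (S' : finType) (L' : language S') : Prop :=
  forall (S : finType) (L : language S), in_NP L -> polytime_reducible L L'.

Definition NP_complete (S : finType) (L : language S) : Prop :=
  in_NP L /\ NP_hard L.

(** * Temporal graphs and 0-1 timed matchings *)

(** The pair [(s, f)] is the half-open interval [[s, f)]. *)
Definition interval_list (T : nat) (l : seq (nat * nat)) : bool :=
  let endpoints := flatten [seq [:: i.1; i.2] | i <- l] in
  [&& l != [::], sorted ltn endpoints & all (fun t => t <= T) endpoints].

(** As there is at most one edge per pair of nodes, an edge is the set of its
    two endpoints.  The value of [intervals] outside [edges] is irrelevant. *)
Record temporal_graph (V : finType) := TemporalGraph {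
  lifetime : nat;
  edges : {set {set V}};
  intervals : {set V} -> seq (nat * nat);
  edges_card : forall e, e \in edges -> #|e| = 2;
  intervals_ok : forall e, e \in edges -> interval_list lifetime (intervals e)
}.

Section TemporalGraph.
Variables (V : finType) (G : temporal_graph V).

Definition exists_at (e : {set V}) (t : nat) : bool :=
  has (fun i => i.1 <= t < i.2) (intervals G e).

Definition underlying : rel V := fun u v => [set u; v] \in edges G.

Definition overlap (e f : {set V}) : Prop :=
  [/\ e != f, exists v, (v \in e) && (v \in f) &
      exists t, exists_at e t && exists_at f t].

Definition timed_matching (M : {set {set V}}) : Prop :=
  M \subset edges G /\
  forall e f, e \in M -> f \in M -> ~ overlap e f.
End TemporalGraph.

(** A tree is a nonempty connected graph without cycles; [e] is meant to be
    symmetric and irreflexive. *)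
Definition is_tree (V : finType) (e : rel V) : Prop :=
  [/\ 0 < #|V|,
      forall u v, connect e u v &
      forall c : seq V, 2 < size c -> ~ ucycle e c].

Definition temporal_tree (V : finType) (G : temporal_graph V) : Prop :=
  is_tree (underlying G).

(** * The decision problem *)

(** The nodes are [0, ..., num_nodes - 1].  The edges of an instance are presented
    as a list, in which each edge occurs once, with its endpoints in either
    order. *)
Record tmt_instance (k : nat) := TmtInstance {
  num_nodes : nat;
  graph : temporal_graph 'I_num_nodes;
  tree_root : 'I_num_nodes;
  goal : nat;
  edge_list : seq ('I_num_nodes * 'I_num_nodes);
  graph_tree : temporal_tree graph;
  few_intervals : forall e, e \in edges graph -> size (intervals graph e) <= k;
  goal_gt0 : 0 < goal;
  edge_list_uniq : uniq [seq [set uv.1; uv.2] | uv <- edge_list];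
  edge_listE : [set e in [seq [set uv.1; uv.2] | uv <- edge_list]] = edges graph
}.

Definition has_timed_matching (k : nat) (I : tmt_instance k) : Prop :=
  exists M : {set {set 'I_(num_nodes I)}},
    timed_matching (graph I) M /\ #|M| = goal I.

(** Binary digits, least significant first, without leading zeros; [up_log 2
    n.+1] is the number of digits. *)
Definition bits (n : nat) : seq bool :=
  mkseq (fun i => odd (n %/ 2 ^ i)) (up_log 2 n.+1).

(** Each number is written in binary and terminated by the separator [None]. *)
Definition encode_nats (s : seq nat) : seq (option bool) :=
  flatten [seq rcons (map Some (bits n)) None | n <- s].

(** An edge is presented by its endpoints, its number of intervals, and the
    endpoints of these intervals. *)
Definition edge_data (n : nat) (G : temporal_graph 'I_n) (uv : 'I_n * 'I_n) :
    seq nat :=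
  let l := intervals G [set uv.1; uv.2] in
  [:: val uv.1, val uv.2, size l & flatten [seq [:: i.1; i.2] | i <- l]].

Definition encode (k : nat) (I : tmt_instance k) : seq (option bool) :=
  encode_nats [:: num_nodes I, lifetime (graph I), val (tree_root I), goal I
    & flatten [seq edge_data (graph I) uv | uv <- edge_list I]].

Definition D_MAX_01_TMT (k : nat) : language (option bool) :=
  fun w => exists I : tmt_instance k, w = encode I /\ has_timed_matching I.

(* Main.v *)
(** Hardness.  In a star all edges share the centre, so a matching is a set of rays
    whose interval lists are pairwise disjoint, and two intervals per ray encode
    satisfiability.  Each clause and each variable owns a time point, and the goal
    forces one ray through each of these points.  The ray for a literal of a clause
    has an interval at the point of the clause and one at a slot of its own; the two
    rays for a variable each block the slots of one of its two literals.
    Satisfiability is hard by the tableau of a Turing machine.  A cell of the tableau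
    stores the state and the symbols of all tapes at a position relative to the
    heads, so that a cell depends on three neighbouring old cells and on the cell at
    the heads.

    Membership.  A certificate consists of the matching, of a depth of every node,
    which certifies that the graph is a tree, and of the places where the edges are
    described in the instance.

    Both the reduction and the verifier are written in a small language of bounded
    sums and arithmetic over positions of the input word.  Its values are bounded by
    polynomials, hence can be kept in unary counters, and a program over stacks and
    counters is a multi-tape Turing machine. *)
Require Import Defs.
From mathcomp Require Import all_boot all_order all_algebra.
From mathcomp Require Import zify.
From Stdlib Require Import FunctionalExtensionality.
Set Implicit Arguments.
Unset Strict Implicit.
Unset Printing Implicit Defensive.

(** * Stack programs compiled to Turing machines *)

(** Numbers are written in binary, so the lifetime and the interval endpoints may be exponential in
    the length of the instance, whereas every value of the term language is polynomially bounded.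
    The verifier therefore never evaluates them: such a number is referred to by its position in the
    encoded list, its bits are read off the word, and comparisons go bit by bit. Only node names,
    the goal and interval counts become values. In a valid instance they are at most the word
    length, because every node but the root lies on an edge. In the reduction a variable may occur
    in any number of clauses, while a ray has only two intervals. The slots of the literals on a
    variable are therefore laid out in order: positive ones, the point owned by the variable,
    negative ones. One interval then covers all slots of one sign together with that point. The
    tableau has no variables for head positions: the tapes are shifted under heads that stay in one
    column. The clauses fix the initial row except in the certificate field, where the choice of
    symbols is the choice of the certificate. *)

Definition upd (T : Type) (f : nat -> T) (i : nat) (v : T) : nat -> T :=
  fun j => if j == i then v else f j.

Section Stack.
Variable A : finType.

Inductive cmd :=
| Skip
| Push of nat & A
| Pop of nat
| Move of nat & nat
| Seq of cmd & cmd
| If of nat & pred (option A) & cmd & cmd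
| While of nat & pred (option A) & cmd.

Implicit Types (s : nat -> seq A) (c : cmd).

(** [exec c s t s'] : [c] leads from [s] to [s'] in at most [t] steps. *)
Inductive exec : cmd -> (nat -> seq A) -> nat -> (nat -> seq A) -> Prop :=
| ex_skip s : exec Skip s 1 s
| ex_push s i a : exec (Push i a) s 2 (upd s i (a :: s i))
| ex_pop s i : exec (Pop i) s 1 (upd s i (behead (s i)))
| ex_move s i j a w : i != j -> s i = a :: w ->
    exec (Move i j) s 2 (upd (upd s i w) j (a :: s j))
| ex_seq s1 s2 s3 c1 c2 t1 t2 : exec c1 s1 t1 s2 -> exec c2 s2 t2 s3 ->
    exec (Seq c1 c2) s1 (t1 + t2) s3
| ex_if s s' i (P : pred (option A)) c1 c2 t :
    exec (if P (ohead (s i)) then c1 else c2) s t s' ->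
    exec (If i P c1 c2) s t.+1 s'
| ex_while0 s i (P : pred (option A)) c : ~~ P (ohead (s i)) -> exec (While i P c) s 1 s
| ex_while s1 s2 s3 i (P : pred (option A)) c t1 t2 : P (ohead (s1 i)) ->
    exec c s1 t1 s2 -> exec (While i P c) s2 t2 s3 ->
    exec (While i P c) s1 (t1 + t2).+1 s3
| ex_weak s s' c t t' : exec c s t s' -> t <= t' -> exec c s t' s'.

Fixpoint maxreg c : nat :=
  match c with
  | Skip => 0
  | Push i _ | Pop i => i
  | Move i j => maxn i j
  | Seq c1 c2 => maxn (maxreg c1) (maxreg c2)
  | If i _ c1 c2 => maxn i (maxn (maxreg c1) (maxreg c2))
  | While i _ c1 => maxn i (maxreg c1)
  end.

(** Program points of a command. [Push] and [Move] take two machine steps, because a step writes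
    before it moves: the first uncovers a cell on the left, the second fills it. *)
Fixpoint ctrl c : finType :=
  match c with
  | Skip | Pop _ => unit
  | Push _ _ | Move _ _ => bool
  | Seq c1 c2 => (ctrl c1 + ctrl c2)%type
  | If _ _ c1 c2 => option (ctrl c1 + ctrl c2)%type
  | While _ _ c1 => option (ctrl c1)
  end.

Fixpoint entry c : ctrl c :=
  match c return ctrl c with
  | Skip | Pop _ => tt
  | Push _ _ | Move _ _ => false
  | Seq c1 c2 => inl (entry c1)
  | If _ _ c1 c2 => None
  | While _ _ c1 => None
  end.

Section Machine.
Variable K : nat.
Notation tapes := {ffun 'I_K.+1 -> tape A}.
Notation tops := {ffun 'I_K.+1 -> option A}.
Notation action := ('I_K.+1 -> option A * Defs.move).
Implicit Type tp : tapes.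

Definition idle (rd : tops) : action := fun i => (rd i, Stay).
Definition act1 (rd : tops) (i : nat) (x : option A * Defs.move) : action :=
  fun j => if val j == i then x else (rd j, Stay).
Definition act2 (rd : tops) (i : nat) (x : option A * Defs.move)
    (i' : nat) (x' : option A * Defs.move) : action :=
  fun j => if val j == i then x else if val j == i' then x' else (rd j, Stay).

(** Control [None] means that the command has been completed. *)
Fixpoint next c : ctrl c -> tops -> option (ctrl c) * action :=
  match c return ctrl c -> tops -> option (ctrl c) * action with
  | Skip => fun _ rd => (None, idle rd)
  | Push i a => fun q rd =>
      if q then (None, act1 rd i (Some a, Stay))
      else (Some true, act1 rd i (rd (inord i), MoveLeft))
  | Pop i => fun _ rd => (None, act1 rd i (None, MoveRight))
  | Move i j => fun q rd =>
      if q then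
        (None, act2 rd j (rd (inord i), Stay) i (None, MoveRight))
      else (Some true, act1 rd j (rd (inord j), MoveLeft))
  | Seq c1 c2 => fun q rd =>
      match q with
      | inl q1 => let r := next q1 rd in
          (Some (if r.1 is Some q' then inl q' else inr (entry c2)), r.2)
      | inr q2 => let r := next q2 rd in (omap inr r.1, r.2)
      end
  | If i P c1 c2 => fun q rd =>
      match q with
      | None => (Some (Some (if P (rd (inord i)) then inl (entry c1)
                             else inr (entry c2))), idle rd)
      | Some (inl q1) => let r := next q1 rd in (omap (Some \o inl) r.1, r.2)
      | Some (inr q2) => let r := next q2 rd in (omap (Some \o inr) r.1, r.2)
      end
  | While i P c1 => fun q rd =>
      match q with
      | None => (if P (rd (inord i)) then Some (Some (entry c1)) else None,
                 idle rd)
      | Some q1 => let r := next q1 rd in (Some r.1, r.2)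
      end
  end.

Definition scan tp : tops := [ffun i => read (tp i)].
Definition perform (a : action) tp : tapes :=
  [ffun i => shift (a i).2 (write (a i).1 (tp i))].

Inductive exits c : ctrl c -> tapes -> nat -> tapes -> Prop :=
| exits_now q tp : (next q (scan tp)).1 = None ->
    exits q tp 1 (perform (next q (scan tp)).2 tp)
| exits_later q q' tp n tp' : (next q (scan tp)).1 = Some q' ->
    exits q' (perform (next q (scan tp)).2 tp) n tp' -> exits q tp n.+1 tp'.

(** Covers the subcommands whose completion completes the whole command: the branches of [If] and
    the second half of [Seq]. The first half of [Seq] and the body of [While] pass control on
    instead and need lemmas of their own. *)
Lemma exits_embed c c' (emb : ctrl c -> ctrl c') :
  (forall q rd, next (emb q) rd = (omap emb (next q rd).1, (next q rd).2)) ->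
  forall q tp n tp', exits q tp n tp' -> exits (emb q) tp n tp'.
Proof.
move=> hemb q tp n tp'; elim=> [{}q {}tp hq|{}q q' {}tp {}n {}tp' hq _ IH].
  have -> : (next q (scan tp)).2 = (next (emb q) (scan tp)).2 by rewrite hemb.
  by apply: exits_now; rewrite hemb /= hq.
apply: (@exits_later _ _ (emb q')); first by rewrite hemb /= hq.
by rewrite hemb.
Qed.

Lemma exits_seq c1 c2 (q : ctrl c1) tp n tp' m tp'' :
  exits q tp n tp' -> exits (entry c2) tp' m tp'' ->
  @exits (Seq c1 c2) (inl q) tp (n + m) tp''.
Proof.
elim=> [{}q {}tp hq|{}q q' {}tp {}n {}tp' hq _ IH] h2.
  rewrite add1n; apply: (@exits_later (Seq c1 c2) _ (inr (entry c2))).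
    by rewrite /= hq.
  exact: (@exits_embed c2 (Seq c1 c2) inr) h2.
rewrite addSn; apply: (@exits_later (Seq c1 c2) _ (inl q')); last exact: IH.
by rewrite /= hq.
Qed.

Lemma exits_while i P c (q : ctrl c) tp n tp' m tp'' :
  exits q tp n tp' -> @exits (While i P c) None tp' m tp'' ->
  @exits (While i P c) (Some q) tp (n + m) tp''.
Proof.
elim=> [{}q {}tp hq|{}q q' {}tp {}n {}tp' hq _ IH] h2.
  by rewrite add1n; apply: (@exits_later (While i P c) _ None); [rewrite /= hq|exact: h2].
rewrite addSn; apply: (@exits_later (While i P c) _ (Some q')); last exact: IH.
by rewrite /= hq.
Qed.

(** A stack has its top under the head and extends to the right; cells on the left of the head are
    overwritten before their content matters. *)
Definition reps tp s : Prop := forall i : 'I_K.+1, tape_holds (tp i) (s i).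

Lemma holds_read (t : tape A) w : tape_holds t w -> read t = ohead w.
Proof. by move=> /(_ 0); rewrite /read -nth0 => ->; case: w. Qed.

Lemma reps_scan tp s i : reps tp s -> scan tp i = ohead (s i).
Proof. by move=> /(_ i)/holds_read; rewrite ffunE. Qed.

Lemma reps_scan_inord tp s i :
  reps tp s -> i <= K -> scan tp (inord i) = ohead (s i).
Proof. by move=> /reps_scan -> hi; rewrite inordK. Qed.


Lemma holds_write (t : tape A) w a w' : a = ohead w' -> behead w' = behead w ->
  tape_holds t w -> tape_holds (write a t) w'.
Proof.
move=> -> hb h [|j]; first by case: w' {hb}.
have := h j.+1; rewrite /= nth_behead => ->.
by rewrite -!nth_behead !behead_map hb.
Qed.


Lemma reps_idle tp s : reps tp s -> reps (perform (idle (scan tp)) tp) s.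
Proof.
move=> h i; rewrite ffunE /idle /= (reps_scan _ h).
exact: holds_write (h i).
Qed.

Lemma holds_right (t : tape A) w :
  tape_holds t w -> tape_holds (shift MoveRight (write None t)) (behead w).
Proof.
move=> h j; have := h j.+1; rewrite /= nth_behead => ->.
by case: w {h}; rewrite /= ?nth_nil.
Qed.

(** The cell uncovered by a left move is arbitrary. *)
Definition holds1 (t : tape A) (w : seq A) : Prop :=
  forall j : nat, nth None t.2 j.+1 = nth None (map Some w) j.

Lemma holds1_left (t : tape A) w :
  tape_holds t w -> holds1 (shift MoveLeft (write (ohead w) t)) w.
Proof. by move=> h j; rewrite [in LHS]/=; apply: holds_write h _. Qed.

Lemma holds1_write (t : tape A) w a :
  holds1 t w -> tape_holds (write (Some a) t) (a :: w).
Proof. by move=> h [|j] //=; rewrite nth_behead h. Qed.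

(** By induction on [exec] rather than on the command, so that a loop is unrolled by its own
    derivation. *)
Lemma exec_exits c s t s' : exec c s t s' -> maxreg c <= K ->
  forall tp, reps tp s ->
  exists n tp', [/\ n <= t, reps tp' s' & exits (entry c) tp n tp'].
Proof.
elim=> {c s t s'}
  [s|s i a|s i|s i j a w ij si|s1 s2 s3 c1 c2 t1 t2 _ IH1 _ IH2
  |s s' i P c1 c2 t _ IH|s i P c hP|s1 s2 s3 i P c t1 t2 hP _ IH1 _ IH2
  |s s' c t t' _ IH tt'] /= hK tp htp.
- exists 1, (perform (idle (scan tp)) tp); split=> //; first exact: reps_idle.
  exact: (@exits_now Skip tt).
- pose tp1 := perform (act1 (scan tp) i (scan tp (inord i), MoveLeft)) tp.
  exists 2, (perform (act1 (scan tp1) i (Some a, Stay)) tp1); split=> //.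
    move=> j; rewrite ffunE /act1 /upd; case: eqP => [ji|nji] /=.
      apply: holds1_write; rewrite ffunE /act1 ji eqxx (reps_scan_inord htp) //.
      by apply: holds1_left; rewrite -ji; apply: htp.
    rewrite [X in write X]ffunE.
    suff h : tape_holds (tp1 j) (s j).
      by apply: (holds_write _ _ h) => //=; rewrite (holds_read h).
    rewrite ffunE /act1; case: eqP => //= _; rewrite (reps_scan _ htp).
    exact: holds_write (htp j).
  apply: (@exits_later (Push i a) false true) => //=.
  exact: (@exits_now (Push i a) true).
- exists 1, (perform (act1 (scan tp) i (None, MoveRight)) tp); split=> //.
    move=> j; rewrite ffunE /act1 /upd; case: eqP => [<-|_].
      exact: holds_right.
    by rewrite (reps_scan _ htp); apply: holds_write (htp j).
  exact: (@exits_now (Pop i) tt).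
- move: hK; rewrite geq_max => /andP[hi hj].
  pose tp1 := perform (act1 (scan tp) j (scan tp (inord j), MoveLeft)) tp.
  pose a2 := act2 (scan tp1) j (scan tp1 (inord i), Stay) i (None, MoveRight).
  have h1 (k : 'I_K.+1) : val k != j -> tape_holds (tp1 k) (s k).
    move=> /negbTE kj; rewrite ffunE /act1 kj (reps_scan _ htp).
    exact: holds_write (htp k).
  have rd1 (k : 'I_K.+1) : val k != j -> scan tp1 k = ohead (s k).
    by move/h1/holds_read => <-; rewrite ffunE.
  exists 2, (perform a2 tp1); split=> //.
    move=> k; rewrite ffunE /a2 /act2 /upd; case: eqP => [kj|/eqP nkj] /=.
      rewrite rd1 /= ?inordK ?ltnS // si; apply: holds1_write.
      rewrite ffunE /act1 kj eqxx (reps_scan_inord htp) //.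
      by apply: holds1_left; rewrite -kj; apply: htp.
    case: eqP => [ki|nki].
      by have := holds_right (h1 _ nkj); rewrite ki si.
    by rewrite rd1 //; apply: holds_write (h1 _ nkj).
  apply: (@exits_later (Move i j) false true) => //=.
  exact: (@exits_now (Move i j) true).
- move: hK; rewrite geq_max => /andP[hi hj].
  have [n1 [tp1 [nt1 /(IH2 hj)[n2 [tp2 [nt2 r2 e2]]] e1]]] := IH1 hi _ htp.
  exists (n1 + n2), tp2; split; [exact: leq_add|done|exact: exits_seq e2].
- move: hK; rewrite !geq_max => /and3P[hi h1 h2].
  have hm : maxreg (if P (ohead (s i)) then c1 else c2) <= K by case: ifP.
  have [n [tp' [nt r e]]] := IH hm _ (reps_idle htp).
  exists n.+1, tp'; split=> //; case: ifP e => hP e.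
    apply: (@exits_later (If i P c1 c2) None (Some (inl (entry c1)))).
      by rewrite /= (reps_scan_inord htp) // hP.
    exact: (@exits_embed _ (If i P c1 c2) (Some \o inl)) e.
  apply: (@exits_later (If i P c1 c2) None (Some (inr (entry c2)))).
    by rewrite /= (reps_scan_inord htp) // hP.
  exact: (@exits_embed _ (If i P c1 c2) (Some \o inr)) e.
- move: hK; rewrite !geq_max => /andP[hi h1].
  exists 1, (perform (idle (scan tp)) tp); split=> //; first exact: reps_idle.
  apply: (@exits_now (While i P c) None).
  by rewrite /= (reps_scan_inord htp) // (negbTE hP).
- move: (hK); rewrite !geq_max => /andP[hi h1].
  have [n1 [tp1 [nt1 /(IH2 hK)[n2 [tp2 [nt2 r2 e2]]] e1]]] :=
    IH1 h1 _ (reps_idle htp).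
  exists (n1 + n2).+1, tp2; split; [by rewrite ltnS leq_add|done|].
  apply: (@exits_later (While i P c) None (Some (entry c))).
    by rewrite /= (reps_scan_inord htp) // hP.
  exact: exits_while e1 e2.
- have [n [tp' [nt r e]]] := IH hK _ htp.
  by exists n, tp'; split=> //; apply: leq_trans tt'.
Qed.

(** After [c], the machine accepts if stack [res] is nonempty. *)
Definition machine c (res : nat) : tm A :=
  @TM A K (ctrl c + option bool)%type (inl (entry c))
    (fun q => if q is inr (Some _) then true else false)
    (fun q => if q is inr (Some true) then true else false)
    (fun q rd => match q with
     | inl q1 => let r := next q1 rd in
         (if r.1 is Some q' then inl q' else inr None, [ffun i => r.2 i])
     | inr _ => (inr (Some (isSome (rd (inord res)))),
                 [ffun i => idle rd i])
     end).

Lemma machine_exits c res (q : ctrl c) tp n tp' : exits q tp n tp' ->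
  iter n (@step _ (machine c res)) (@Config _ (machine c res) (inl q) tp) =
  @Config _ (machine c res) (inr None) tp'.
Proof.
have hp (a : action) (tq : tapes) :
    [ffun i => shift ([ffun i => a i] i).2 (write ([ffun i => a i] i).1 (tq i))]
    = perform a tq.
  by apply/ffunP => i; rewrite !ffunE.
elim=> [{}q {}tp hq|{}q q' {}tp {}n {}tp' hq _ IH].
  by rewrite /step /= -/(scan tp) hq hp.
by rewrite iterSr -IH {2}/step /= -/(scan tp) hq hp.
Qed.

Lemma machine_run c res x s t s' : maxreg c <= K -> res <= K ->
  s 0 = x -> (forall i, 0 < i -> s i = [::]) -> exec c s t s' ->
  forall n, t < n ->
  let cf := run (machine c res) n x in
  [/\ halting (cstate cf),
      accepting (cstate cf) = (s' res != [::]) &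
      forall i : 'I_K.+1, tape_holds (ctapes cf i) (s' i)].
Proof.
move=> hK hres s0 si hex n tn.
have hinit : reps (ctapes (init (machine c res) x)) s.
  move=> i; rewrite ffunE; case: eqP => [->|/eqP i0] /=; first by rewrite s0.
  by rewrite si ?lt0n // => j /=.
have [m [tp [mt r e]]] := exec_exits hex hK hinit.
have e1 := machine_exits res e.
have stepE : step (@Config _ (machine c res) (inr None) tp) =
    @Config _ (machine c res) (inr (Some (s' res != [::])))
      (perform (idle (scan tp)) tp).
  rewrite /step /=; congr Config.
    by rewrite -/(scan tp) (reps_scan_inord r) //; case: (s' res).
  by apply/ffunP => i; rewrite !ffunE /=.
have hfix k b tq : iter k (@step _ (machine c res)) (@Config _ (machine c res) (inr (Some b)) tq)
    = @Config _ (machine c res) (inr (Some b)) tq.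
  by elim: k => //= k ->.
have -> : run (machine c res) n x =
    @Config _ (machine c res) (inr (Some (s' res != [::])))
      (perform (idle (scan tp)) tp).
  (* [m] steps of the program, one step that tests the result stack, then idling in a halting
     state. *)
  have -> : n = (n - m.+1) + (1 + m) by lia.
  rewrite /run !iterD.
  have -> : init (machine c res) x =
     @Config _ (machine c res) (inl (entry c)) (ctapes (init (machine c res) x)) by [].
  by rewrite e1 /= stepE hfix.
split=> //=; first by case: (s' res != [::]).
exact: reps_idle.
Qed.

End Machine.
End Stack.

(** * A language of polynomial-time functions *)

Definition pev (p : {poly nat}) (m : nat) : nat := (p.[m])%R.

Lemma pevD p q m : pev (p + q)%R m = pev p m + pev q m.
Proof. by rewrite /pev hornerD. Qed.
Lemma pevM p q m : pev (p * q)%R m = pev p m * pev q m.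
Proof. by rewrite /pev hornerM. Qed.
Lemma pevC c m : pev (c%:P)%R m = c.
Proof. by rewrite /pev hornerC. Qed.
Lemma pevX m : pev 'X%R m = m.
Proof. by rewrite /pev hornerX. Qed.
Lemma pev_comp p q m : pev (p \Po q)%R m = pev p (pev q m).
Proof. by rewrite /pev horner_comp. Qed.
Definition pevE := (pev_comp, pevD, pevM, pevC, pevX).

(** All coefficients are natural numbers. *)
Lemma pev_mono p m m' : m <= m' -> pev p m <= pev p m'.
Proof.
move=> h; rewrite /pev; elim/poly_ind: p => [|p c IH]; first by rewrite !horner0.
by rewrite !hornerMXaddC leq_add2r leq_mul.
Qed.

Section Terms.
Variables S O : finType.

(** De Bruijn indices: [Sum] binds index 0; the body of a [Call] sees only the
    arguments. *)
Inductive term :=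
| Var of nat
| Const of nat
| Len
| Add of term & term
| Mul of term & term
| Minus of term & term
| Sum of term & term
| Letter of pred S & term
| Shr of term & term
| Call of nat & (nat -> term) & term.

Definition letter (P : pred S) (x : seq S) (i : nat) : bool :=
  if ohead (drop i x) is Some a then P a else false.

Fixpoint eval (x : seq S) (rho : seq nat) (t : term) : nat :=
  match t with
  | Var k => nth 0 rho k
  | Const c => c
  | Len => size x
  | Add a b => eval x rho a + eval x rho b
  | Mul a b => eval x rho a * eval x rho b
  | Minus a b => eval x rho a - eval x rho b
  | Sum b e => \sum_(i < eval x rho b) eval x (val i :: rho) e
  | Letter P e => letter P x (eval x rho e)
  | Shr a b => eval x rho a %/ 2 ^ eval x rho b
  | Call m args e => eval x (mkseq (fun k => eval x rho (args k)) m) e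
  end.

(** [GFor b g] binds index 0. *)
Inductive gen :=
| GLetter of O
| GCat of gen & gen
| GFor of term & gen
| GIf of term & gen & gen.

Fixpoint output (x : seq S) (rho : seq nat) (g : gen) : seq O :=
  match g with
  | GLetter o => [:: o]
  | GCat g1 g2 => output x rho g1 ++ output x rho g2
  | GFor b g => flatten [seq output x (i :: rho) g | i <- iota 0 (eval x rho b)]
  | GIf b g1 g2 => if eval x rho b != 0 then output x rho g1
                   else output x rho g2
  end.

Definition bounded_env (x : seq S) (rho : seq nat) (m : nat) : bool :=
  (size x <= m) && all (fun v => v <= m) rho.

Lemma bounded_nth x rho m k : bounded_env x rho m -> nth 0 rho k <= m.
Proof.
case/andP=> _ h; case: (ltnP k (size rho)) => hk; last by rewrite nth_default.
by move/all_nthP: h => /(_ 0); apply.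
Qed.

Lemma bounded_cons x rho m i k : bounded_env x rho m -> i <= k ->
  bounded_env x (i :: rho) (m + k).
Proof.
case/andP=> h1 /allP h2 ik; rewrite /bounded_env /= (leq_trans h1) ?leq_addr //.
rewrite (leq_trans ik) ?leq_addl //=; apply/allP => v /h2 /leq_trans; apply.
exact: leq_addr.
Qed.

Lemma bounded_mkseq x (F : nat -> nat) n m k : size x <= m ->
  (forall i, i < n -> F i <= k) -> bounded_env x (mkseq F n) (m + k).
Proof.
move=> h1 h2; rewrite /bounded_env (leq_trans h1) ?leq_addr //=.
apply/allP => v /mapP[i]; rewrite mem_iota => /andP[_ hi] ->.
by rewrite (leq_trans (h2 _ hi)) ?leq_addl.
Qed.

(** [Call] carries a function of arguments, of which only the first [n] matter; the sum of their
    bounds serves them all at once. *)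
Lemma poly_bound_upto n (Q : nat -> nat -> nat -> Prop) :
  (forall k m v v', Q k m v -> v <= v' -> Q k m v') ->
  (forall k, exists p, forall m, Q k m (pev p m)) ->
  exists p, forall k m, k < n -> Q k m (pev p m).
Proof.
move=> hm h; elim: n => [|n [p hp]]; first by exists 0%R.
have [q hq] := h n; exists (p + q)%R => k m; rewrite ltnS leq_eqVlt pevD.
case/orP => [/eqP ->|hk]; first by apply: hm (hq m) _; apply: leq_addl.
by apply: hm (hp _ m hk) _; apply: leq_addr.
Qed.

(** This makes unary counters affordable. A binder raises the bound on the environment from [m] to
    [m] plus the bound on its range, hence the composition of polynomials. *)
Lemma eval_bound t : exists p, forall x rho m, bounded_env x rho m ->
  eval x rho t <= pev p m.
Proof.
elim: t => [k|c||a [p hp] b [q hq]|a [p hp] b [q hq]|a [p hp] b [q hq]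
           |b [p hp] e [q hq]|P e _|a [p hp] b _|n args hargs e [q hq]].
- by exists 'X%R => x rho m h; rewrite pevX; apply: bounded_nth h.
- by exists c%:P%R => x rho m h; rewrite pevC.
- by exists 'X%R => x rho m /andP[h _]; rewrite pevX.
- exists (p + q)%R => x rho m h; rewrite pevD leq_add //; [exact: hp|exact: hq].
- exists (p * q)%R => x rho m h; rewrite pevM leq_mul //; [exact: hp|exact: hq].
- exists p => x rho m h /=; apply: leq_trans (leq_subr _ _) _; exact: hp.
- exists (p * (q \Po ('X + p)))%R => x rho m h; rewrite !pevE /=.
  apply: leq_trans (_ : eval x rho b * pev q (m + pev p m) <= _); last first.
    by rewrite leq_mul2r hp ?orbT.
  rewrite -[X in _ <= X * _]card_ord -sum_nat_const; apply: leq_sum => i _.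
  apply/hq/bounded_cons => //; apply: leq_trans (hp _ _ _ h).
  exact/ltnW/ltn_ord.
- by exists 1%:P%R => x rho m h /=; rewrite pevC; case: letter.
- exists p => x rho m h /=; apply: leq_trans (leq_div _ _) _; exact: hp.
have [||p hp] := @poly_bound_upto n
  (fun k m v => forall x rho, bounded_env x rho m -> eval x rho (args k) <= v).
- by move=> k m v v' h vv' x rho /h /leq_trans; apply.
- by move=> k; have [p hp] := hargs k; exists p => m x rho; apply: hp.
exists (q \Po ('X + p))%R => x rho m h; rewrite !pevE /=.
apply/hq/bounded_mkseq => [|i hi]; first by case/andP: h.
exact: hp.
Qed.

(** * Compiling terms to counter programs *)

Notation alpha := (option (S + O))%type.
Implicit Types (f : nat -> nat) (w : seq S * seq S * seq O).

(** Stack 0 holds the rest of the input, stack 1 the symbols already read in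
    reverse order, stack 2 the output in reverse order, and the remaining stacks
    are unary counters. *)
Definition store w f (i : nat) : seq alpha :=
  match i with
  | 0 => map (fun a => Some (inl a)) w.1.1
  | 1 => map (fun a => Some (inl a)) w.1.2
  | 2 => map (fun o => Some (inr o)) w.2
  | j.+3 => nseq (f j) None
  end.

Definition runs c w f t w' f' := exec c (store w f) t (store w' f').

Definition nonempty : pred (option alpha) := fun a => isSome a.
Definition Inc n : cmd alpha := Push n.+3 None.
Definition Dec n : cmd alpha := Pop _ n.+3.
Definition Loop n c : cmd alpha := While n.+3 nonempty (Seq (Dec n) c).
Definition MoveAdd i j := Loop i (Inc j).
Definition Clear i := Loop i (Skip _).
(** A loop over a counter empties it, so counter [k] keeps a second copy from which [i] is
    restored. *)
Definition CopyAdd i j k :=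
  Seq (Loop i (Seq (Inc j) (Inc k))) (MoveAdd k i).
Definition Rewind : cmd alpha := While 1 nonempty (Move _ 1 0).

Lemma updE (T : Type) (f : nat -> T) i v j :
  upd f i v j = if j == i then v else f j.
Proof. by []. Qed.

Lemma ohead_nseq n (z : alpha) : nonempty (ohead (nseq n z)) = (n != 0).
Proof. by case: n. Qed.

Lemma store_upd w f n v :
  upd (store w f) n.+3 (nseq v None) = store w (upd f n v).
Proof.
apply: functional_extensionality => j; rewrite /upd.
by case: j => [|[|[|j]]] //=; rewrite !eqSS; case: eqP.
Qed.

Lemma runs_weak c w f t w' f1 f' t' :
  runs c w f t w' f1 -> t <= t' -> f1 =1 f' -> runs c w f t' w' f'.
Proof.
move=> h tt' /functional_extensionality <-; exact: ex_weak h tt'.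
Qed.

Lemma runs_seq c1 c2 w1 f1 t1 w2 f2 t2 w3 f3 :
  runs c1 w1 f1 t1 w2 f2 -> runs c2 w2 f2 t2 w3 f3 ->
  runs (Seq c1 c2) w1 f1 (t1 + t2) w3 f3.
Proof. exact: ex_seq. Qed.

Lemma runs_skip w f : runs (Skip _) w f 1 w f.
Proof. exact: ex_skip. Qed.

Lemma runs_inc w f n : runs (Inc n) w f 2 w (upd f n (f n).+1).
Proof. rewrite /runs -store_upd; exact: ex_push. Qed.

Lemma runs_dec w f n : runs (Dec n) w f 1 w (upd f n (f n).-1).
Proof.
rewrite /runs -store_upd.
have -> : nseq (f n).-1 None = behead (store w f n.+3) by rewrite /=; case: (f n).
exact: ex_pop.
Qed.

Lemma runs_if n c1 c2 w f t w' f' :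
  (f n != 0 -> runs c1 w f t w' f') -> (f n = 0 -> runs c2 w f t w' f') ->
  runs (If n.+3 nonempty c1 c2) w f t.+1 w' f'.
Proof.
move=> h1 h2; apply: ex_if; rewrite ohead_nseq.
by case: eqP h1 h2 => [e _ /(_ e)|_ /(_ isT)].
Qed.

(** [F k] gives the other counters and [W k] the first three stacks after [k]
    rounds. *)
Lemma runs_loop r c (W : nat -> seq S * seq S * seq O) (F : nat -> nat -> nat)
    N B f f' t :
  (forall k, k < N -> runs c (W k) (upd (F k) r (N - k.+1)) B
                             (W k.+1) (upd (F k.+1) r (N - k.+1))) ->
  f =1 upd (F 0) r N -> upd (F N) r 0 =1 f' -> N * B.+2 + 1 <= t ->
  runs (Loop r c) (W 0) f t (W N) f'.
Proof.
move=> hc /functional_extensionality -> hf' ht.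
apply: (runs_weak (t := N * B.+2 + 1)) ht hf'.
suff h m : m <= N -> runs (Loop r c) (W (N - m)) (upd (F (N - m)) r m)
             (m * B.+2 + 1) (W N) (upd (F N) r 0).
  by have := h N (leqnn N); rewrite subnn.
elim: m => [|m IH] hm.
  rewrite mul0n subn0; apply: ex_while0.
  by rewrite /store /upd eqxx.
have hk : N - m.+1 < N by lia.
have eN : N - (N - m.+1).+1 = m by lia.
have eS : (N - m.+1).+1 = N - m by lia.
have := hc _ hk; rewrite eN eS => h1.
have -> : m.+1 * B.+2 + 1 = ((1 + B) + (m * B.+2 + 1)).+1 by lia.
apply: ex_while (IH (ltnW hm)).
  by rewrite /store /upd eqxx.
apply: runs_seq h1; apply: runs_weak (runs_dec _ _ _) _ _ => // j.
by rewrite /upd eqxx; case: (j == r).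
Qed.

Ltac upd_split :=
  rewrite /upd /=;
  repeat match goal with
  | |- context [?a == ?b] => case: (eqVneq a b) => ?; subst
  end; try done; try lia.

Ltac upd_case := let j := fresh "j" in move=> j; upd_split.

Lemma runs_moveadd i j w f : i != j ->
  runs (MoveAdd i j) w f (4 * f i + 1) w (upd (upd f j (f j + f i)) i 0).
Proof.
move=> ij; apply: (@runs_loop i _ (fun=> w) (fun k => upd f j (f j + k)) (f i) 2).
- move=> k hk; apply: runs_weak (runs_inc _ _ _) _ _ => //.
  by move: ij => /eqP ij; upd_case.
- by move: ij => /eqP ij; upd_case.
- by move: ij => /eqP ij; upd_case.
- lia.
Qed.

Lemma runs_clear i w f : runs (Clear i) w f (4 * f i + 1) w (upd f i 0).
Proof.
apply: (@runs_loop i _ (fun=> w) (fun k => f) (f i) 1) => [k hk|||].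
- exact: runs_skip.
- by upd_case.
- by upd_case.
- lia.
Qed.

Lemma runs_copyadd i j k w f : i != j -> i != k -> j != k -> f k = 0 ->
  runs (CopyAdd i j k) w f (10 * f i + 2) w (upd f j (f j + f i)).
Proof.
move=> ij ik jk fk.
have h1 : runs (Loop i (Seq (Inc j) (Inc k))) w f (6 * f i + 1)
            w (upd (upd (upd f j (f j + f i)) k (f i)) i 0).
  apply: (@runs_loop i _ (fun=> w) (fun n => upd (upd f j (f j + n)) k n) (f i) 4).
  - move=> n hn; apply: runs_weak (runs_seq (runs_inc _ _ _) (runs_inc _ _ _)) _ _ => //.
    by move: ij ik jk => /eqP ij /eqP ik /eqP jk; upd_case.
  - by move: ij ik jk => /eqP ij /eqP ik /eqP jk; upd_case.
  - by move: ij ik jk => /eqP ij /eqP ik /eqP jk; upd_case.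
  - lia.
have ki : k != i by rewrite eq_sym.
apply: runs_weak (runs_seq h1 (runs_moveadd _ _ ki)) _ _.
  by move: ki => /eqP ki; upd_split.
by move: ij ik jk => /eqP ij /eqP ik /eqP jk; upd_case.
Qed.

Lemma runs_move01 a xr xl o f :
  runs (Move _ 0 1) (a :: xr, xl, o) f 2 (xr, a :: xl, o) f.
Proof.
have -> : runs (Move _ 0 1) (a :: xr, xl, o) f 2 (xr, a :: xl, o) f =
  exec (Move _ 0 1) (store (a :: xr, xl, o) f) 2
   (upd (upd (store (a :: xr, xl, o) f) 0 (map (fun a => Some (inl a)) xr)) 1
     (Some (inl a) :: store (a :: xr, xl, o) f 1)).
  by congr exec; apply: functional_extensionality => -[|[|[|j]]].
exact: ex_move.
Qed.

Lemma runs_rewind xr xl o f :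
  runs Rewind (xr, xl, o) f (3 * size xl + 1) (catrev xl xr, [::], o) f.
Proof.
elim: xl xr => [|a xl IH] xr; first exact: ex_while0.
have -> : 3 * size (a :: xl) + 1 = (2 + (3 * size xl + 1)).+1 by rewrite /=; lia.
apply: ex_while (IH (a :: xr)) => //.
have -> : store (a :: xr, xl, o) f =
   upd (upd (store (xr, a :: xl, o) f) 1 (map (fun a => Some (inl a)) xl)) 0
     (Some (inl a) :: store (xr, a :: xl, o) f 0).
  by apply: functional_extensionality => -[|[|[|j]]].
exact: ex_move.
Qed.

(** Does nothing at the end of the input, so that a position beyond it is harmless and reads as no
    letter. *)
Definition Advance : cmd alpha := If 0 nonempty (Move _ 0 1) (Skip _).

Lemma runs_advance xr xl o f :
  runs Advance (xr, xl, o) f 3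
    (drop 1 xr, catrev (take 1 xr) xl, o) f.
Proof.
apply: ex_if; case: xr => [|a xr] /=; first exact: ex_weak (ex_skip _) _.
rewrite drop0 take0; exact: runs_move01.
Qed.

Definition is_letter (P : pred S) : pred (option alpha) :=
  fun a => if a is Some (Some (inl s)) then P s else false.

Definition CLen n : cmd alpha :=
  Seq (While 0 nonempty (Seq (Move _ 0 1) (Inc n))) Rewind.

Lemma runs_len x o n f :
  runs (CLen n) (x, [::], o) f (8 * size x + 2) (x, [::], o)
    (upd f n (f n + size x)).
Proof.
suff h xr xl g : runs (While 0 nonempty (Seq (Move _ 0 1) (Inc n))) (xr, xl, o) g
    (5 * size xr + 1) ([::], catrev xr xl, o) (upd g n (g n + size xr)).
  have := runs_rewind [::] (rev x) o (upd f n (f n + size x)).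
  rewrite catrevE cats0 revK size_rev => h2.
  by apply: runs_weak (runs_seq (h _ _ _) h2) _ _ => //; lia.
elim: xr xl g => [|a xr IH] xl g.
  rewrite (_ : upd g n _ = g); first exact: ex_while0.
  by apply: functional_extensionality; upd_case.
have -> : 5 * size (a :: xr) + 1 = ((2 + 2) + (5 * size xr + 1)).+1.
  by rewrite /=; lia.
apply: ex_while => //.
  exact: runs_seq (runs_move01 _ _ _ _ _) (runs_inc _ _ _).
by apply: runs_weak (IH _ _) _ _ => //=; upd_case.
Qed.

Definition CLetter P n : cmd alpha :=
  Seq (Loop n.+1 Advance) (Seq (If 0 (is_letter P) (Inc n) (Skip _)) Rewind).

Lemma runs_letter P x o n f : 
  runs (CLetter P n) (x, [::], o) f (5 * f n.+1 + 3 * size x + 5) (x, [::], o)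
    (upd (upd f n.+1 0) n (f n + letter P x (f n.+1))).
Proof.
set i := f n.+1.
have h1 : runs (Loop n.+1 Advance) (x, [::], o) f (5 * i + 1)
   (drop i x, rev (take i x), o) (upd f n.+1 0).
  pose W k := (drop k x, rev (take k x), o).
  have -> : (x, [::], o) = W 0 by rewrite /W drop0 take0.
  apply: (@runs_loop n.+1 _ W (fun=> f) i 3).
  - move=> k hk; rewrite /W.
    have -> : drop k.+1 x = drop 1 (drop k x) by rewrite drop_drop add1n.
    have -> : rev (take k.+1 x) = catrev (take 1 (drop k x)) (rev (take k x)).
      by rewrite -addn1 takeD catrevE rev_cat.
    exact: runs_advance.
  - by rewrite /i; upd_case.
  - by upd_case.
  - lia.
set f1 := upd f n.+1 0 in h1 *.
have h2 : runs (If 0 (is_letter P) (Inc n) (Skip _)) (drop i x, rev (take i x), o)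
   f1 3 (drop i x, rev (take i x), o) (upd f1 n (f n + letter P x i)).
  have e : is_letter P (ohead (store (drop i x, rev (take i x), o) f1 0)) =
      letter P x i by rewrite /letter /=; case: (drop i x).
  apply: ex_if; rewrite e; case: letter.
    by apply: runs_weak (runs_inc _ _ _) _ _ => //; rewrite /f1; upd_case.
  by apply: runs_weak (runs_skip _ _) _ _ => //; rewrite /f1; upd_case.
have := runs_rewind (drop i x) (rev (take i x)) o (upd f1 n (f n + letter P x i)).
rewrite catrevE revK cat_take_drop size_rev => h3.
apply: runs_weak (runs_seq h1 (runs_seq h2 h3)) _ _ => //.
have : size (take i x) <= size x by rewrite size_take_min geq_minr.
lia.
Qed.

(** While [n] is counted down, counter [n.+2] holds half the number of rounds and [n.+3] its parity.
    Counter [n.+1] is left alone, as [Shr] counts its halvings there. Counter [i] is stack [i.+3],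
    hence the index in [If]. *)
Definition CHalve n : cmd alpha :=
  Seq (Loop n (If n.+2.+1.+3 nonempty (Seq (Dec n.+3) (Inc n.+2)) (Inc n.+3)))
      (Seq (Clear n.+3) (MoveAdd n.+2 n)).

Lemma runs_halve n w f : f n.+2 = 0 -> f n.+3 = 0 ->
  runs (CHalve n) w f (12 * f n + 12) w (upd f n (f n %/ 2)).
Proof.
move=> f2 f3.
pose F k := upd (upd f n.+2 (k %/ 2)) n.+3 (k %% 2).
have h1 : runs (Loop n (If n.+2.+1.+3 nonempty (Seq (Dec n.+3) (Inc n.+2)) (Inc n.+3)))
    w f (6 * f n + 1) w (upd (F (f n)) n 0).
  apply: (@runs_loop n _ (fun=> w) F (f n) 4).
  - have e3 : (n.+3 == n) = false by lia.
    move=> k hk; apply: runs_if; rewrite /F {1}/upd /= e3 {1}/upd eqxx => hz.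
      apply: runs_weak (runs_seq (runs_dec _ _ _) (runs_inc _ _ _)) _ _ => //.
      by upd_case.
    apply: runs_weak (runs_inc _ _ _) _ _ => //.
    by upd_case.
  - by rewrite /F; upd_case.
  - by [].
  - lia.
have n2 : n.+2 != n by lia.
apply: runs_weak (runs_seq h1 (runs_seq (runs_clear _ _ _) (runs_moveadd _ _ n2))) _ _.
  by rewrite /F; upd_split.
by rewrite /F; upd_case.
Qed.

(** Calling convention: [regs] are the counters of the variables in scope, all below [n]; the
    counters from [n] on are zero at entry, and at exit only counter [n] has changed, to the value
    of the term. *)
Fixpoint ct (regs : seq nat) (n : nat) (t : term) : cmd alpha :=
  match t with
  | Var k => if k < size regs then CopyAdd (nth 0 regs k) n n.+1 else Skip _
  | Const c => iter c (Seq (Inc n)) (Skip _)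
  | Len => CLen n
  | Add a b => Seq (ct regs n a) (Seq (ct regs n.+1 b) (MoveAdd n.+1 n))
  | Mul a b => Seq (ct regs n.+1 a) (Seq (ct regs n.+2 b)
      (Seq (Loop n.+1 (CopyAdd n.+2 n n.+3)) (Clear n.+2)))
  | Minus a b => Seq (ct regs n a) (Seq (ct regs n.+1 b) (Loop n.+1 (Dec n)))
  | Sum b e => Seq (ct regs n.+1 b) (Seq
      (Loop n.+1 (Seq (ct (n.+2 :: regs) n.+3 e) (Seq (MoveAdd n.+3 n) (Inc n.+2))))
      (Clear n.+2))
  | Letter P e => Seq (ct regs n.+1 e) (CLetter P n)
  | Shr a b => Seq (ct regs n a) (Seq (ct regs n.+1 b) (Loop n.+1 (CHalve n)))
  | Call m args e =>
      let fix load k := if k is k'.+1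
        then Seq (load k') (ct regs (n.+1 + k') (args k')) else Skip _ in
      let fix unload k := if k is k'.+1
        then Seq (unload k') (Clear (n.+1 + k')) else Skip _ in
      Seq (load m) (Seq (ct (mkseq (addn n.+1) m) (n.+1 + m) e)
        (Seq (MoveAdd (n.+1 + m) n) (unload m)))
  end.

Lemma map_upd (f : nat -> nat) regs n j v :
  all (fun r => r < n) regs -> n <= j -> map (upd f j v) regs = map f regs.
Proof.
move=> /allP h nj; apply/eq_in_map => r /h rn; rewrite /upd.
by case: eqP => // rj; lia.
Qed.

Lemma all_ltn_weak n n' regs : n <= n' ->
  all (fun r => r < n) regs -> all (fun r => r < n') regs.
Proof. by move=> h; apply: sub_all => r hr; apply: leq_trans h. Qed.

Definition implements (t : term) (p : {poly nat}) : Prop :=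
  forall x regs n f o m, bounded_env x (map f regs) m ->
  all (fun r => r < n) regs -> (forall j, n <= j -> f j = 0) ->
  runs (ct regs n t) (x, [::], o) f (pev p m) (x, [::], o)
    (upd f n (eval x (map f regs) t)).

Lemma zero_upd (f : nat -> nat) n v :
  (forall j, n <= j -> f j = 0) -> forall j, n.+1 <= j -> upd f n v j = 0.
Proof. by move=> h j hj; rewrite /upd; case: eqP => [?|_]; [lia|apply: h; lia]. Qed.

Lemma zero_weak (f : nat -> nat) n n' : n <= n' ->
  (forall j, n <= j -> f j = 0) -> forall j, n' <= j -> f j = 0.
Proof. by move=> h1 h j hj; apply: h; lia. Qed.

Lemma implements_next t p x regs n f o m v : implements t p -> 
  bounded_env x (map f regs) m ->
  all (fun r => r < n) regs -> (forall j, n <= j -> f j = 0) ->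
  runs (ct regs n.+1 t) (x, [::], o) (upd f n v) (pev p m) (x, [::], o)
    (upd (upd f n v) n.+1 (eval x (map f regs) t)).
Proof.
move=> ht hb hr hz.
have := ht x regs n.+1 (upd f n v) o m; rewrite (map_upd _ _ hr) //; apply=> //.
  exact: all_ltn_weak hr.
exact: zero_upd.
Qed.

Lemma implements_succ t p x regs n f o m : implements t p -> 
  bounded_env x (map f regs) m ->
  all (fun r => r < n) regs -> (forall j, n <= j -> f j = 0) ->
  runs (ct regs n.+1 t) (x, [::], o) f (pev p m) (x, [::], o)
    (upd f n.+1 (eval x (map f regs) t)).
Proof.
move=> ht hb hr hz; apply: ht => //; first exact: all_ltn_weak hr.
by apply: zero_weak hz.
Qed.

Lemma implements_add a b pa pb : implements a pa -> implements b pb ->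
  exists p, implements (Add a b) p.
Proof.
move=> ha hb; have [vb hvb] := eval_bound b.
exists (pa + pb + 4%:P * vb + 1%:P)%R => x regs n f o m hm hr hz /=.
have h2 := implements_next o (eval x (map f regs) a) hb hm hr hz.
apply: runs_weak (runs_seq (ha _ _ _ _ o _ hm hr hz) (runs_seq h2 (runs_moveadd _ _ _))) _ _.
- lia.
- by have := hvb _ _ _ hm; rewrite !pevE; upd_split.
- by upd_case; apply/esym/hz; lia.
Qed.

Lemma implements_sub a b pa pb : implements a pa -> implements b pb ->
  exists p, implements (Minus a b) p.
Proof.
move=> ha hb; have [vb hvb] := eval_bound b.
exists (pa + pb + 3%:P * vb + 1%:P)%R => x regs n f o m hm hr hz /=.
set va := eval x (map f regs) a.
have h2 := implements_next o va hb hm hr hz.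
set v := eval x (map f regs) b in h2 *.
have h3 : runs (Loop n.+1 (Dec n)) (x, [::], o) (upd (upd f n va) n.+1 v) (3 * v + 1)
    (x, [::], o) (upd f n (va - v)).
  apply: (@runs_loop _ _ (fun=> _) (fun k => upd f n (va - k)) v 1).
  - move=> k hk; apply: runs_weak (runs_dec _ _ _) _ _ => //; upd_case.
  - by upd_case.
  - by upd_case; apply/esym/hz; lia.
  - lia.
apply: runs_weak (runs_seq (ha _ _ _ _ o _ hm hr hz) (runs_seq h2 h3)) _ _ => //.
by have := hvb _ _ _ hm; rewrite !pevE -/v; lia.
Qed.

Lemma implements_mul a b pa pb : implements a pa -> implements b pb ->
  exists p, implements (Mul a b) p.
Proof.
move=> ha hb; have [va hva] := eval_bound a; have [vb hvb] := eval_bound b.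
exists (pa + pb + va * (10%:P * vb + 4%:P) + 4%:P * vb + 2%:P)%R.
move=> x regs n f o m hm hr hz /=.
have h1 := implements_succ o ha hm hr hz.
have hr1 := all_ltn_weak (leqnSn n) hr; have hz1 := zero_weak (leqnSn n) hz.
have h2 := implements_next o (eval x (map f regs) a) hb hm hr1 hz1.
have := hva _ _ _ hm; have := hvb _ _ _ hm.
set u := eval x (map f regs) a in h1 h2 *.
set v := eval x (map f regs) b in h2 * => hv hu.
have h3 : runs (Loop n.+1 (CopyAdd n.+2 n n.+3)) (x, [::], o)
    (upd (upd f n.+1 u) n.+2 v) (u * (10 * v + 4) + 1)
    (x, [::], o) (upd (upd f n (u * v)) n.+2 v).
  apply: (@runs_loop _ _ (fun=> _) (fun k => upd (upd f n (k * v)) n.+2 v) u (10 * v + 2)).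
  - move=> k hk; apply: runs_weak (runs_copyadd _ _ _ _ _) _ _; rewrite ?mulSn; try lia.
    + by have := hz n.+3 (ltac:(lia)); upd_split.
    + by upd_split.
    + by upd_case.
  - by have hn := hz n (leqnn n); upd_case.
  - by upd_case; apply/esym/hz; lia.
  - lia.
apply: runs_weak (runs_seq h1 (runs_seq h2 (runs_seq h3 (runs_clear _ _ _)))) _ _.
  have : u * (10 * v + 4) <= pev va m * (10 * pev vb m + 4) by apply: leq_mul => //; lia.
  by rewrite !pevE; upd_split.
by have hn := hz n.+2 (ltac:(lia)); upd_case.
Qed.

Lemma implements_sum b e pb pe : implements b pb -> implements e pe ->
  exists p, implements (Sum b e) p.
Proof.
move=> hb he; have [vb hvb] := eval_bound b; have [ve hve] := eval_bound e.
exists (pb + vb * ((pe + 4%:P * ve) \Po ('X + vb)) + 9%:P * vb + 2%:P)%R.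
move=> x regs n f o m hm hr hz /=.
have h1 := implements_succ o hb hm hr hz.
have := hvb _ _ _ hm; set N := eval x (map f regs) b in h1 * => hN.
pose sm k := \sum_(i < k) eval x (val i :: map f regs) e.
have sm0 : sm 0 = 0 by rewrite /sm big_ord0.
have smS k : sm k.+1 = sm k + eval x (k :: map f regs) e.
  by rewrite /sm big_ord_recr.
rewrite -/(sm N); clearbody sm; pose F k := upd (upd f n.+2 k) n (sm k).
have h2 : runs (Loop n.+1 (Seq (ct (n.+2 :: regs) n.+3 e)
      (Seq (MoveAdd n.+3 n) (Inc n.+2)))) (x, [::], o) (upd f n.+1 N)
    (N * (pev pe (m + pev vb m) + 4 * pev ve (m + pev vb m) + 5) + 1)
    (x, [::], o) (upd (F N) n.+1 0).
  apply: (@runs_loop _ _ (fun=> _) F N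
      (pev pe (m + pev vb m) + 4 * pev ve (m + pev vb m) + 3)).
  - move=> k hk; set g := upd (F k) _ _.
    have eg : map g (n.+2 :: regs) = k :: map f regs.
      rewrite /= /g /F !(map_upd _ _ hr) //; last lia.
      by congr (_ :: _); upd_split.
    have hm' : bounded_env x (map g (n.+2 :: regs)) (m + pev vb m).
      by rewrite eg; apply: bounded_cons => //; lia.
    have hr' : all (fun r => r < n.+3) (n.+2 :: regs).
      by rewrite /= ltnS leqnn (all_ltn_weak _ hr) //; lia.
    have hz' j : n.+3 <= j -> g j = 0.
      by move=> hj; have := hz j; rewrite /g /F; upd_split; apply; lia.
    have := he x (n.+2 :: regs) n.+3 g o _ hm' hr' hz'; rewrite eg => h.
    apply: runs_weak (runs_seq h (runs_seq (runs_moveadd _ _ _) (runs_inc _ _ _))) _ _.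
    + lia.
    + have := hve _ _ _ hm'; rewrite eg => hv; upd_split.
    + have hn := hz n.+3 (ltac:(lia)).
      by have e1 := smS k; rewrite /g /F; upd_case.
  - by have hn := hz n (leqnn n); have hn2 := hz n.+2 (ltac:(lia)); rewrite /F; upd_case.
  - by [].
  - lia.
apply: runs_weak (runs_seq h1 (runs_seq h2 (runs_clear _ _ _))) _ _.
  have : N * (pev pe (m + pev vb m) + 4 * pev ve (m + pev vb m) + 5) <= 
      pev vb m * (pev pe (m + pev vb m) + 4 * pev ve (m + pev vb m) + 5).
    by rewrite leq_mul2r hN orbT.
  have -> : upd (F N) n.+1 0 n.+2 = N by rewrite /F; upd_split.
  rewrite !pevE; lia.
by have hn := hz n.+2 (ltac:(lia)); have hn1 := hz n.+1 (ltac:(lia)); rewrite /F; upd_case.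
Qed.

Lemma implements_letter P e pe : implements e pe ->
  exists p, implements (Letter P e) p.
Proof.
move=> he; have [ve hve] := eval_bound e.
exists (pe + 5%:P * ve + 3%:P * 'X + 5%:P)%R.
move=> x regs n f o m hm hr hz /=.
have h1 := implements_succ o he hm hr hz.
have := hve _ _ _ hm; set v := eval x (map f regs) e in h1 * => hv.
apply: runs_weak (runs_seq h1 (runs_letter _ _ _ _ _)) _ _.
  by rewrite !pevE; case/andP: hm => hx _; upd_split.
have hn := hz n (ltac:(lia)); have hn1 := hz n.+1 (ltac:(lia)).
have -> : upd f n.+1 v n.+1 = v by upd_split.
by upd_case.
Qed.

Lemma implements_var k : exists p, implements (Var k) p.
Proof.
exists (10%:P * 'X + 2%:P)%R => x regs n f o m hm hr hz /=.
rewrite !pevE; case: ltnP => hk; last first.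
  rewrite nth_default ?size_map //.
  have hn := hz n (leqnn n).
  by apply: runs_weak (runs_skip _ _) _ _; [lia|upd_case].
have hkn : nth 0 regs k < n by move/all_nthP: hr => /(_ 0); apply.
have := bounded_nth k hm; rewrite (nth_map 0) //.
move: (nth 0 regs k) hkn => r rn hv.
have hn := hz n (leqnn n); have hn1 := hz n.+1 (leqnSn n).
apply: runs_weak (runs_copyadd _ _ _ _ _) _ _; try lia.
by upd_case.
Qed.

Lemma implements_const c : exists p, implements (Const c) p.
Proof.
exists (2 * c + 1)%:P%R => x regs n f o m hm hr hz /=; rewrite pevC.
suff h g : runs (iter c (Seq (Inc n)) (Skip _)) (x, [::], o) g (2 * c + 1)
    (x, [::], o) (upd g n (g n + c)) by have := h f; rewrite hz.
elim: c g => [|c IH] g /=.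
  by apply: runs_weak (runs_skip _ _) _ _; [lia|upd_case].
apply: runs_weak (runs_seq (runs_inc _ _ _) (IH _)) _ _; first lia.
by upd_case.
Qed.

(** [Shr] is primitive because a power of two is not polynomially bounded; it is a loop of
    halvings. *)
Lemma implements_shr a b pa pb : implements a pa -> implements b pb ->
  exists p, implements (Shr a b) p.
Proof.
move=> ha hb; have [va hva] := eval_bound a; have [vb hvb] := eval_bound b.
exists (pa + pb + vb * (30%:P * va + 30%:P) + 1%:P)%R.
move=> x regs n f o m hm hr hz /=.
have h1 := ha _ _ _ _ o _ hm hr hz.
have := hva _ _ _ hm; have := hvb _ _ _ hm.
set u := eval x (map f regs) a in h1 *.
have h2 := implements_next o u hb hm hr hz.
set v := eval x (map f regs) b in h2 * => hv hu.
have hn := hz n.+2 (ltac:(lia)); have hn1 := hz n.+3 (ltac:(lia)).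
have hn2 := hz n.+1 (ltac:(lia)).
have h3 : runs (Loop n.+1 (CHalve n)) (x, [::], o) (upd (upd f n u) n.+1 v)
    (v * (12 * u + 14) + 1) (x, [::], o) (upd f n (u %/ 2 ^ v)).
  apply: (@runs_loop _ _ (fun=> _) (fun k => upd f n (u %/ 2 ^ k)) v (12 * u + 12)).
  - move=> k hk; apply: runs_weak (runs_halve _ _ _) _ _.
    + by upd_split.
    + by upd_split.
    + by rewrite leq_add2r /upd /=; have := leq_div u (2 ^ k); upd_split.
    + have := divnMA u (2 ^ k) 2; rewrite -expnSr => ->.
      by upd_case.
  - by upd_case; rewrite expn0 divn1.
  - by upd_case.
  - lia.
apply: runs_weak (runs_seq h1 (runs_seq h2 h3)) _ _ => //.
have : v * (12 * u + 14) <= pev vb m * (30 * pev va m + 30) by apply: leq_mul; lia.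
rewrite !pevE; lia.
Qed.

(** Together with [unload], a top-level copy of the fixpoints inside [ct], to which inductions can
    refer. *)
Fixpoint load (regs : seq nat) (n : nat) (args : nat -> term) k : cmd alpha :=
  if k is k'.+1
  then Seq (load regs n args k') (ct regs (n.+1 + k') (args k')) else Skip _.

Fixpoint unload n k : cmd alpha :=
  if k is k'.+1 then Seq (unload n k') (Clear (n.+1 + k')) else Skip _.

Lemma ct_call regs n m args e : ct regs n (Call m args e) =
  Seq (load regs n args m) (Seq (ct (mkseq (addn n.+1) m) (n.+1 + m) e)
        (Seq (MoveAdd (n.+1 + m) n) (unload n m))).
Proof.
rewrite [LHS]/=; congr (Seq _ (Seq _ (Seq _ _))); first by elim: m => //= m ->.
by elim: m => //= m ->.
Qed.

Lemma runs_unload n k w f V : (forall i, i < k -> f (n.+1 + i) <= V) ->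
  runs (unload n k) w f (k * (4 * V + 1) + 1) w
    (fun j => if n < j <= n + k then 0 else f j).
Proof.
elim: k => [|k IH] hV /=.
  apply: runs_weak (runs_skip _ _) _ _ => // j; case: ifP => //; lia.
have h1 := IH (fun i hi => hV i (leqW hi)).
apply: runs_weak (runs_seq h1 (runs_clear _ _ _)) _ _.
  have -> : (n < n.+1 + k <= n + k) = false by lia.
  have := hV k (ltnSn k); lia.
move=> j; rewrite /upd; case: eqP => [->|hj]; first by case: ifP => //; lia.
by have -> : (n < j <= n + k.+1) = (n < j <= n + k) by lia.
Qed.

Lemma implements_call m0 args e pe : (forall k, exists p, implements (args k) p) ->
  implements e pe -> exists p, implements (Call m0 args e) p.
Proof.
move=> hargs he; have [ve hve] := eval_bound e.
have [||va hva] := @poly_bound_upto m0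
  (fun k m v => forall x rho, bounded_env x rho m -> eval x rho (args k) <= v).
- by move=> k m v v' h vv' x rho /h /leq_trans; apply.
- by move=> k; have [p hp] := eval_bound (args k); exists p => m x rho; apply: hp.
have [||pa hpa] := @poly_bound_upto m0
  (fun k m v => forall x regs n f o, bounded_env x (map f regs) m ->
     all (fun r => r < n) regs -> (forall j, n <= j -> f j = 0) ->
     runs (ct regs n (args k)) (x, [::], o) f v (x, [::], o)
       (upd f n (eval x (map f regs) (args k)))).
- move=> k m v v' h vv' x regs n f o h1 h2 h3.
  by apply: runs_weak (h _ _ _ _ _ h1 h2 h3) _ _.
- move=> k; have [p hp] := hargs k; exists p => m x regs n f o h1 h2 h3.
  exact: hp.
exists (m0%:P * pa + 1%:P + ((pe + 4%:P * ve) \Po ('X + va)) + 1%:P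
        + m0%:P * (4%:P * va + 1%:P) + 1%:P)%R.
move=> x regs n f o m hm hr hz; rewrite ct_call [eval _ _ _]/=.
pose vals k := eval x (map f regs) (args k).
rewrite -[mkseq (fun k => eval _ _ _) m0]/(mkseq vals m0).
pose F k := fun j => if n < j <= n + k then vals (j - n.+1) else f j.
have hF k : map (F k) regs = map f regs.
  apply/eq_in_map => r /(allP hr) rn; rewrite /F; case: ifP => //; lia.
have h1 k : k <= m0 -> runs (load regs n args k) (x, [::], o) f
     (k * pev pa m + 1) (x, [::], o) (F k).
  elim: k => [|k IH] hk /=.
    by apply: runs_weak (runs_skip _ _) _ _ => // j; rewrite /F; case: ifP => //; lia.
  have hr' : all (fun r => r < n.+1 + k) regs by apply: all_ltn_weak hr; lia.
  have hz' j : n.+1 + k <= j -> F k j = 0.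
    by move=> hj; rewrite /F; case: ifP => [|_]; [lia|apply: hz; lia].
  have h2 := hpa _ m hk x regs (n.+1 + k) (F k) o; rewrite hF in h2.
  apply: runs_weak (runs_seq (IH (ltnW hk)) (h2 hm hr' hz')) _ _; first lia.
  move=> j; rewrite /upd /F -/(vals k); case: eqP => [->|hj].
    have -> : (n < n.+1 + k <= n + k.+1) by lia.
    by congr vals; lia.
  by have -> : (n < j <= n + k.+1) = (n < j <= n + k) by lia.
have eF : map (F m0) (mkseq (addn n.+1) m0) = mkseq vals m0.
  rewrite -map_comp; apply/eq_in_map => k; rewrite mem_iota => /andP[_ hk] /=.
  rewrite /F; have -> : (n < n.+1 + k <= n + m0) by lia.
  by congr vals; lia.
have hb : bounded_env x (map (F m0) (mkseq (addn n.+1) m0)) (m + pev va m).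
  rewrite eF; apply: bounded_mkseq; first by case/andP: hm.
  by move=> i hi; apply: hva.
have hrb : all (fun r => r < n.+1 + m0) (mkseq (addn n.+1) m0).
  by apply/allP => r /mapP[k]; rewrite mem_iota => /andP[_ hk] ->; lia.
have hzb j : n.+1 + m0 <= j -> F m0 j = 0.
  by move=> hj; rewrite /F; case: ifP => [|_]; [lia|apply: hz; lia].
have h2 := he x _ _ (F m0) o _ hb hrb hzb.
have := hve _ _ _ hb; rewrite eF in h2 *.
set v := eval x (mkseq vals m0) e in h2 *.
move=> hv.
have hn : n.+1 + m0 != n by lia.
have h3 := runs_moveadd (x, [::], o) (upd (F m0) (n.+1 + m0) v) hn.
have e3 : upd (F m0) (n.+1 + m0) v (n.+1 + m0) = v by rewrite /upd eqxx.
have e4 : upd (F m0) (n.+1 + m0) v n = 0.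
  rewrite /upd; case: eqP => [|_]; first lia.
  by rewrite /F ltnn /= hz.
rewrite e3 e4 add0n in h3.
set g := upd _ (n.+1 + m0) 0 in h3.
have hg i : i < m0 -> g (n.+1 + i) <= pev va m.
  move=> hi; rewrite /g !updE. do 2 (case: eqP => [?|_]; first lia).
  rewrite /F; have -> : (n < n.+1 + i <= n + m0) by lia.
  by apply: hva => //; lia.
have h4 := runs_unload (x, [::], o) hg.
apply: runs_weak (runs_seq (h1 _ (leqnn _)) (runs_seq h2 (runs_seq h3 h4))) _ _.
  by rewrite !pevE; lia.
move=> j; rewrite /g !updE; case: ifP => hj.
  case: eqP => [?|_]; first lia.
  by rewrite hz //; lia.
case: eqP => [->|h5]; first by case: eqP => [?|_]; [lia|rewrite hz //; lia].
by case: eqP => // _; rewrite /F hj.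
Qed.

Lemma implementable t : exists p, implements t p.
Proof.
elim: t => [k|c||a [p hp] b [q hq]|a [p hp] b [q hq]|a [p hp] b [q hq]
           |b [p hp] e [q hq]|P e [p hp]|a [p hp] b [q hq]|n args hargs e [q hq]].
- exact: implements_var.
- exact: implements_const.
- exists (8%:P * 'X + 2%:P)%R => x regs n f o m hm hr hz.
  apply: runs_weak (runs_len _ _ _ _) _ _.
    by rewrite !pevE; case/andP: hm => hx _; lia.
  by rewrite (hz n) // add0n.
- exact: implements_add hp hq.
- exact: implements_mul hp hq.
- exact: implements_sub hp hq.
- exact: implements_sum hp hq.
- exact: implements_letter hp.
- exact: implements_shr hp hq.
- exact: implements_call hargs hq.
Qed.



(** * Compiling generators, and the resulting machines *)

Lemma size_output_bound g : exists p, forall x rho m, bounded_env x rho m ->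
  size (output x rho g) <= pev p m.
Proof.
elim: g => [o|g1 [p1 h1] g2 [p2 h2]|b g [p hp]|b g1 [p1 h1] g2 [p2 h2]].
- by exists 1%:P%R => x rho m _; rewrite pevC.
- exists (p1 + p2)%R => x rho m h; rewrite pevD /= size_cat leq_add //; [exact: h1|exact: h2].
- have [v hv] := eval_bound b.
  exists (v * (p \Po ('X + v)))%R => x rho m h; rewrite !pevE /=.
  apply: leq_trans (_ : eval x rho b * pev p (m + pev v m) <= _); last first.
    by rewrite leq_mul2r hv ?orbT.
  have hb := hv _ _ _ h; move: (eval x rho b) hb => N hN.
  rewrite size_flatten /shape -map_comp sumnE big_map -{2}(size_iota 0 N).
  rewrite -sum1_size big_distrl /= !big_seq; apply: leq_sum => i.
  rewrite mem_iota mul1n => /andP[_ hi]; apply/hp/bounded_cons => //.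
  by apply: leq_trans hN; apply: ltnW.
- exists (p1 + p2)%R => x rho m h; rewrite pevD /=; case: ifP => _.
    by apply: leq_trans (h1 _ _ _ h) _; apply: leq_addr.
  by apply: leq_trans (h2 _ _ _ h) _; apply: leq_addl.
Qed.

Fixpoint cg (regs : seq nat) (n : nat) (g : gen) : cmd alpha :=
  match g with
  | GLetter a => Push 2 (Some (inr a))
  | GCat g1 g2 => Seq (cg regs n g1) (cg regs n g2)
  | GFor b g => Seq (ct regs n b)
      (Seq (Loop n (Seq (cg (n.+1 :: regs) n.+2 g) (Inc n.+1))) (Clear n.+1))
  | GIf b g1 g2 => Seq (ct regs n b)
      (If n.+3 nonempty (Seq (Clear n) (cg regs n.+1 g1)) (cg regs n.+1 g2))
  end.

Lemma generable g : exists p, forall x regs n f o m,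
  bounded_env x (map f regs) m ->
  all (fun r => r < n) regs -> (forall j, n <= j -> f j = 0) ->
  runs (cg regs n g) (x, [::], o) f (pev p m)
    (x, [::], catrev (output x (map f regs) g) o) f.
Proof.
elim: g => [a|g1 [p1 h1] g2 [p2 h2]|b g [p hp]|b g1 [p1 h1] g2 [p2 h2]].
- exists 2%:P%R => x regs n f o m _ _ _; rewrite pevC /=.
  have -> : runs (Push 2 (Some (inr a))) (x, [::], o) f 2 (x, [::], a :: o) f =
    exec (Push 2 (Some (inr a))) (store (x, [::], o) f) 2
     (upd (store (x, [::], o) f) 2 (Some (inr a) :: store (x, [::], o) f 2)).
    by congr exec; apply: functional_extensionality => -[|[|[|j]]].
  exact: ex_push.
- exists (p1 + p2)%R => x regs n f o m hm hr hz; rewrite pevD /=.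
  rewrite catrev_catl; apply: runs_seq; [exact: h1|exact: h2].
- have [v hv] := eval_bound b; have [q hq] := implementable b.
  exists (q + v * ((p + 4%:P) \Po ('X + v)) + 4%:P * v + 2%:P)%R.
  move=> x regs n f o m hm hr hz /=.
  have h1 := hq _ _ _ _ o _ hm hr hz; have := hv _ _ _ hm.
  set N := eval x (map f regs) b in h1 * => hN.
  pose out k := flatten [seq output x (i :: map f regs) g | i <- iota 0 k].
  have h2 : runs (Loop n (Seq (cg (n.+1 :: regs) n.+2 g) (Inc n.+1)))
      (x, [::], o) (upd f n N) (N * (pev p (m + pev v m) + 4) + 1)
      (x, [::], catrev (out N) o) (upd f n.+1 N).
    apply: (@runs_loop n _ (fun k => (x, [::], catrev (out k) o))
       (fun k => upd f n.+1 k) N (pev p (m + pev v m) + 2)).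
    + move=> k hk; set f' := upd (upd f n.+1 k) n _.
      have ef : map f' (n.+1 :: regs) = k :: map f regs.
        rewrite /= /f' !(map_upd _ _ hr) //.
        by congr (_ :: _); upd_split.
      have hm' : bounded_env x (map f' (n.+1 :: regs)) (m + pev v m).
        by rewrite ef; apply: bounded_cons => //; lia.
      have hr' : all (fun r => r < n.+2) (n.+1 :: regs).
        by rewrite /= ltnS leqnn (all_ltn_weak _ hr) //; lia.
      have hz' j : n.+2 <= j -> f' j = 0.
        by move=> hj; have := hz j; rewrite /f'; upd_split; apply; lia.
      have h2 := hp x _ n.+2 f' (catrev (out k) o) _ hm' hr' hz'.
      have e2 : out k.+1 = out k ++ output x (k :: map f regs) g.
        by rewrite /out -addn1 iotaD map_cat flatten_cat /= cats0.
      rewrite e2 catrev_catl -ef.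
      apply: runs_weak (runs_seq h2 (runs_inc _ _ _)) _ _; first lia.
      by rewrite /f'; upd_case.
    + by have hn := hz n.+1 (leqnSn n); upd_case.
    + by have hn := hz n (leqnn n); upd_case.
    + lia.
  apply: runs_weak (runs_seq h1 (runs_seq h2 (runs_clear _ _ _))) _ _.
    have : N * (pev p (m + pev v m) + 4) <= pev v m * (pev p (m + pev v m) + 4).
      by rewrite leq_mul2r hN orbT.
    by rewrite !pevE; upd_split.
  by have hn := hz n.+1 (leqnSn n); upd_case.
- have [v hv] := eval_bound b; have [q hq] := implementable b.
  exists (q + p1 + p2 + 4%:P * v + 2%:P)%R => x regs n f o m hm hr hz /=.
  have h3 := hq _ _ _ _ o _ hm hr hz; have := hv _ _ _ hm.
  set N := eval x (map f regs) b in h3 * => hN.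
  have hr' := all_ltn_weak (leqnSn n) hr; have hz' := zero_weak (leqnSn n) hz.
  have hn := hz n (leqnn n).
  apply: (@runs_weak _ _ _ (pev q m + (pev p1 m + pev p2 m + 4 * N + 1).+1) _ f) => //; last first.
    by rewrite !pevE; lia.
  apply: runs_seq h3 _; apply: runs_if; rewrite updE eqxx => hN0.
    rewrite hN0.
    have hc : runs (Clear n) (x, [::], o) (upd f n N) (4 * N + 1) (x, [::], o) f.
      by apply: runs_weak (runs_clear _ _ _) _ _; [rewrite updE eqxx|upd_case].
    have h4 := h1 x regs n.+1 f o m hm hr' hz'.
    by apply: runs_weak (runs_seq hc h4) _ _ => //; lia.
  have -> : upd f n N = f.
    by apply: functional_extensionality; rewrite hN0; upd_case.
  rewrite hN0 /=; apply: runs_weak (h2 x regs n.+1 f o m hm hr' hz') _ _ => //.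
  lia.
Qed.

Lemma decider_correct t : @polytime_decidable S (fun x => eval x [::] t != 0).
Proof.
have [p hp] := implementable t.
(* The value ends in counter 0, which is stack 3; the machine accepts when this stack is
   nonempty. *)
pose c := ct [::] 0 t; pose K := maxn (maxreg c) 3.
exists alpha, (fun a => Some (inl a)), (machine K c 3), (p + 1%:P)%R; split.
  by move=> a b [].
move=> x; have h := hp x [::] 0 (fun=> 0) [::] (size x).
have {}h := h (ltac:(by rewrite /bounded_env leqnn)) isT (fun _ _ => erefl).
have hK : maxreg c <= K := leq_maxl _ _.
have hres : 3 <= K := leq_maxr _ _.
have hs i : 0 < i -> store (x, [::], [::]) (fun=> 0) i = [::].
  by case: i => [|[|[|j]]].
have hn : pev p (size x) < pev (p + 1%:P)%R (size x) by rewrite !pevE addn1.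
have [h1 h2 h3] := machine_run hK hres erefl hs h hn.
split=> //; rewrite h2 /=.
by case: (eval _ _ _).
Qed.

(** Stack 2 holds the output with its last letter on top, so unloading it onto an empty stack
    restores the order. The target [K] is the last tape, where [polytime_computable] expects the
    result. *)
Lemma output_order K o s : 2 < K -> s 2 = map (fun a => Some (inr a)) o ->
  exists s', exec (While 2 nonempty (Move _ 2 K)) s (3 * size o + 1) s' /\
    s' K = catrev (map (fun a => Some (inr a)) o) (s K).
Proof.
move=> hK; elim: o s => [|a o IH] s hs.
  by exists s; split=> //; apply: ex_while0; rewrite hs.
pose s1 := upd (upd s 2 (map (fun a => Some (inr a)) o)) K (Some (inr a) :: s K).
have n2 : 2 != K by lia.
have [|s' [h1 h2]] := IH s1; first by rewrite /s1 !updE (negbTE n2).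
exists s'; split; last by rewrite h2 /s1 updE eqxx.
have -> : 3 * size (a :: o) + 1 = (2 + (3 * size o + 1)).+1 by rewrite /=; lia.
apply: ex_while h1; first by rewrite hs.
exact: ex_move hs.
Qed.

Lemma output_computable g : @polytime_computable S O (fun x => output x [::] g).
Proof.
have [p hp] := generable g; have [q hq] := size_output_bound g.
(* [K] lies beyond stack 2 and beyond every stack of [c0]; it is still empty when the output
   arrives. *)
pose c0 := cg [::] 0 g; pose K := (maxreg c0).+3.
pose c := Seq c0 (While 2 nonempty (Move _ 2 K)).
exists alpha, (fun a => Some (inl a)), (fun a => Some (inr a)), (machine K c 0).
exists (p + 3%:P * q + 2%:P)%R; split; [by move=> a b []|by move=> a b []|].
move=> x; have hb : bounded_env x [::] (size x) by rewrite /bounded_env leqnn.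
have h1 := hp x [::] 0 (fun=> 0) [::] _ hb isT (fun _ _ => erefl).
rewrite /= catrevE cats0 in h1.
have := @output_order K (rev (output x [::] g))
  (store (x, [::], rev (output x [::] g)) (fun=> 0)) (ltac:(by [])) erefl.
rewrite map_rev catrevE revK size_rev /= cats0 => -[s' [h2 h3]].
have hK : maxreg c <= K by rewrite /c /= !geq_max leqnn /K; lia.
have hs i : 0 < i -> store (x, [::], [::]) (fun=> 0) i = [::].
  by case: i => [|[|[|j]]].
have hn : pev p (size x) + (3 * size (output x [::] g) + 1) <
    pev (p + 3%:P * q + 2%:P)%R (size x).
  by have := hq _ _ _ hb; rewrite !pevE; lia.
have [h4 _ h5] := machine_run hK (leq0n K) erefl hs (ex_seq h1 h2) hn.
split=> //; have := h5 ord_max; rewrite h3; exact.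
Qed.

End Terms.

(** * Logic, division and finite look-up in the term language *)

Section Derived.
Variable S : finType.
Notation term := (term S).
Implicit Types (x : seq S) (rho : seq nat) (a b c e t : term).

Definition truth x rho t : bool := eval x rho t != 0.

(** The connectives are built so that no two of them unify up to unfolding, which
    lets their evaluation rules be used for rewriting. *)
Definition tZero a : term := Minus (Const S 1) a.
Definition tNot a : term := tZero (Add a (Const S 0)).
Definition tLeq a b : term := tZero (Mul (Const S 1) (Minus a b)).
Definition tLt a b : term := tZero (Mul (Minus (Add a (Const S 1)) b) (Const S 1)).
Definition tAnd a b : term := tZero (tZero (Mul a b)).
Definition tOr a b : term := tZero (tZero (Add a b)).
Definition tEq a b : term := tZero (Add (Minus a b) (Minus b a)).
Definition tIf c a b : term := Add (Mul (tZero (tZero c)) a) (Mul (tZero c) b).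
Definition tEx b e : term := tZero (tZero (Sum b e)).
Definition tAll b e : term := tZero (Sum b (tZero e)).

Lemma eval_zero x rho a : eval x rho (tZero a) = ~~ truth x rho a.
Proof. by rewrite /truth /=; case: eval => [|[]]. Qed.

Lemma truth_zero x rho a : truth x rho (tZero a) = ~~ truth x rho a.
Proof. by rewrite {1}/truth eval_zero; case: truth. Qed.

Lemma eval_truth x rho a : eval x rho (tZero a) = truth x rho (tZero a).
Proof. by rewrite eval_zero truth_zero. Qed.

Lemma truth_not x rho a : truth x rho (tNot a) = ~~ truth x rho a.
Proof. by rewrite truth_zero /truth /= addn0. Qed.

Lemma truth_leq x rho a b : truth x rho (tLeq a b) = (eval x rho a <= eval x rho b).
Proof. by rewrite truth_zero negbK /= mul1n. Qed.

Lemma truth_lt x rho a b : truth x rho (tLt a b) = (eval x rho a < eval x rho b).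
Proof. by rewrite truth_zero negbK /= muln1 addn1. Qed.

Lemma truth_and x rho a b : truth x rho (tAnd a b) = truth x rho a && truth x rho b.
Proof. by rewrite !truth_zero negbK /truth /= muln_eq0 negb_or. Qed.

Lemma truth_or x rho a b : truth x rho (tOr a b) = truth x rho a || truth x rho b.
Proof. by rewrite !truth_zero negbK /truth /= addn_eq0 negb_and. Qed.

Lemma truth_eq x rho a b : truth x rho (tEq a b) = (eval x rho a == eval x rho b).
Proof. by rewrite truth_zero negbK /= addn_eq0 !subn_eq0 eqn_leq. Qed.

Lemma eval_if x rho c a b : eval x rho (tIf c a b) =
  if truth x rho c then eval x rho a else eval x rho b.
Proof.
rewrite -[LHS]/(eval x rho (tZero (tZero c)) * eval x rho a +
  eval x rho (tZero c) * eval x rho b) !eval_zero truth_zero.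
by case: truth; rewrite /= ?mul1n ?addn0.
Qed.

Lemma sum_neq0 n (F : nat -> nat) :
  (\sum_(i < n) F i != 0) = has (fun i => F i != 0) (iota 0 n).
Proof.
elim: n => [|n IH]; first by rewrite big_ord0.
by rewrite -[in RHS]addn1 iotaD has_cat -IH big_ord_recr /= addn_eq0 negb_and orbF.
Qed.

Lemma truth_ex x rho b e : truth x rho (tEx b e) =
  has (fun i => truth x (i :: rho) e) (iota 0 (eval x rho b)).
Proof. by rewrite !truth_zero negbK; apply: sum_neq0. Qed.

Lemma truth_all x rho b e : truth x rho (tAll b e) =
  all (fun i => truth x (i :: rho) e) (iota 0 (eval x rho b)).
Proof.
rewrite truth_zero [truth _ _ _](@sum_neq0 _ (fun i => eval x (i :: rho) (tZero e))).
rewrite -all_predC; apply: eq_all => i /=.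
by rewrite -[_ != 0]/(truth x (i :: rho) (tZero e)) truth_zero negbK.
Qed.

Lemma truth_letter x rho P e : truth x rho (Letter P e) = letter P x (eval x rho e).
Proof. by rewrite /truth /=; case: letter. Qed.

Lemma eval_call x rho m (ts : seq term) e : size ts = m ->
  eval x rho (Call m (nth (Const S 0) ts) e) = eval x [seq eval x rho t | t <- ts] e.
Proof.
move=> <-; rewrite /=; congr eval; apply: (@eq_from_nth _ 0).
  by rewrite size_map size_mkseq.
by move=> i; rewrite size_mkseq => hi; rewrite nth_mkseq // (nth_map (Const S 0)).
Qed.

Definition tCall (ts : seq term) e := Call (size ts) (nth (Const S 0) ts) e.

Lemma eval_tcall x rho ts e :
  eval x rho (tCall ts e) = eval x [seq eval x rho t | t <- ts] e.
Proof. exact: eval_call. Qed.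

Lemma truth_tcall x rho ts e :
  truth x rho (tCall ts e) = truth x [seq eval x rho t | t <- ts] e.
Proof. by rewrite /truth eval_tcall. Qed.

Lemma eval_tcall1 x rho t e :
  eval x rho (tCall [:: t] e) = eval x [:: eval x rho t] e.
Proof. by rewrite eval_tcall. Qed.

Lemma truth_tcall2 x rho t1 t2 e :
  truth x rho (tCall [:: t1; t2] e) = truth x [:: eval x rho t1; eval x rho t2] e.
Proof. by rewrite truth_tcall. Qed.

Lemma truth_tcall3 x rho t1 t2 t3 e : truth x rho (tCall [:: t1; t2; t3] e) =
  truth x [:: eval x rho t1; eval x rho t2; eval x rho t3] e.
Proof. by rewrite truth_tcall. Qed.

(** For positive [b], exactly [a %/ b] of the multiples [i.+1 * b] with [i < a] are at most [a]. *)
Definition tDiv a b : term :=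
  tCall [:: a; b] (Sum (Var S 0) (tLeq (Mul (Add (Var S 0) (Const S 1)) (Var S 2)) (Var S 1))).
Definition tMod a b : term := Minus a (Mul (tDiv a b) b).

Lemma sum_lt n m : m <= n -> \sum_(i < n) (i < m) = m.
Proof.
elim: n m => [|n IH] m h; first by rewrite big_ord0; lia.
rewrite big_ord_recr /=; case: (ltnP n m) => hm.
  have -> : m = n.+1 by lia.
  rewrite -[in RHS](IH n) // addn1; congr _.+1; apply: eq_bigr => i _.
  by rewrite ltn_ord ltnS (ltnW (ltn_ord i)).
by rewrite IH ?addn0.
Qed.

Lemma eval_div x rho a b : 0 < eval x rho b ->
  eval x rho (tDiv a b) = eval x rho a %/ eval x rho b.
Proof.
move=> hb; rewrite eval_tcall; set va := eval x rho a; set vb := eval x rho b in hb *.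
set e := tLeq _ _.
rewrite -[LHS]/(\sum_(i < va) eval x [:: val i; va; vb] e).
rewrite -[RHS](@sum_lt va); last exact: leq_div.
apply: eq_bigr => i _; rewrite eval_truth truth_leq /= addn1.
by rewrite leq_divRL.
Qed.

Lemma eval_mod x rho a b : 0 < eval x rho b ->
  eval x rho (tMod a b) = eval x rho a %% eval x rho b.
Proof.
move=> hb; rewrite -[LHS]/(eval x rho a - eval x rho (tDiv a b) * eval x rho b).
by rewrite eval_div // [in X in X - _](divn_eq (eval x rho a) (eval x rho b)) addKn.
Qed.

(** Look-up in a finite table: exactly one test is 1 and selects its entry. The transition function
    and the accepting states of a machine enter terms in this way. *)
Definition tCase (I : finType) (f : I -> nat) (test : I -> term) : term :=
  foldr (fun i acc => Add (Mul (Const S (f i)) (test i)) acc) (Const S 0) (enum I).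

Lemma eval_case (I : finType) (f : I -> nat) (test : I -> term) x rho i0 :
  (forall i, eval x rho (test i) = (i == i0)) -> eval x rho (tCase f test) = f i0.
Proof.
move=> h; rewrite /tCase.
have : i0 \in enum I by rewrite mem_enum.
have : uniq (enum I) by apply: enum_uniq.
suff hs s : uniq s -> eval x rho (foldr (fun i acc => Add (Mul (Const S (f i)) (test i)) acc)
    (Const S 0) s) = if i0 \in s then f i0 else 0 by move=> /hs -> ->.
elim: s => //= i s IH /andP[hi /IH ->]; rewrite h in_cons eq_sym.
case: eqP => [e|_] /=; last by rewrite muln0.
by rewrite e (negbTE hi) muln1 addn0.
Qed.

Fixpoint tPolySeq (s : seq nat) (a : term) : term :=
  if s is c :: s' then Add (Mul (tPolySeq s' a) a) (Const S c) else Const S 0.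
Definition tPoly (p : {poly nat}) (a : term) : term := tPolySeq (polyseq p) a.

Lemma eval_poly p a x rho : eval x rho (tPoly p a) = pev p (eval x rho a).
Proof. by rewrite /tPoly /pev /horner; elim: (polyseq p) => //= c s ->. Qed.

(** Weakening past the innermost binder: a call rebuilds the outer environment from the indices 1 to
    [n]. *)
Definition tLift (n : nat) (t : term) : term := tCall [seq Var S i | i <- iota 1 n] t.

Lemma eval_lift x rho i t : eval x (i :: rho) (tLift (size rho) t) = eval x rho t.
Proof.
rewrite eval_tcall -map_comp -[1]/(1 + 0) iotaDl -map_comp; congr eval.
apply: (@eq_from_nth _ 0); first by rewrite size_map size_iota.
by move=> k; rewrite size_map size_iota => hk; rewrite (nth_map 0) ?size_iota // nth_iota.
Qed.

Definition tOdd (t : term) : term := Minus t (Mul (Const S 2) (Shr t (Const S 1))).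
Lemma eval_odd x rho t : eval x rho (tOdd t) = odd (eval x rho t).
Proof. by rewrite /=; lia. Qed.
Lemma truth_odd x rho t : truth x rho (tOdd t) = odd (eval x rho t).
Proof. by rewrite /truth eval_odd; case: odd. Qed.

End Derived.

Lemma bits_seq a : map Some (bits a) = flatten
  [seq if a %/ 2 ^ i != 0 then [:: Some (odd (a %/ 2 ^ i))] else [::] | i <- iota 0 a].
Proof.
rewrite /bits; set u := up_log 2 a.+1.
have hu i : (i < u) = (a %/ 2 ^ i != 0).
  rewrite -lt0n divn_gt0 ?expn_gt0 //; apply/idP/idP => h.
    by rewrite leqNgt; apply/negP => h'; have := up_log_min (isT : 1 < 2) h'; rewrite -/u; lia.
  rewrite ltnNge; apply/negP => h'.
  have := up_logP a.+1 (isT : 1 < 2); rewrite -/u => h2.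
  have : 2 ^ u <= 2 ^ i by rewrite leq_exp2l.
  lia.
have ua : u <= a by apply: up_log_min => //; apply: ltn_expl.
rewrite -{4}(subnKC ua) iotaD map_cat flatten_cat add0n.
rewrite [X in _ = _ ++ flatten X](_ : _ = nseq (a - u) [::]); last first.
  rewrite -[a - u in RHS](size_iota u); move: (leqnn u).
  have : {in iota u (a - u), forall i, u <= i} by move=> i; rewrite mem_iota => /andP[].
  elim: (iota u (a - u)) => //= i s IH h _; rewrite -hu ltnNge h ?mem_head //= IH //.
  by move=> j hj; apply: h; rewrite in_cons hj orbT.
have -> : forall n, flatten (nseq n (@nil (option bool))) = [::] by elim.
rewrite cats0; have : {in iota 0 u, forall i, i < u} by move=> i; rewrite mem_iota.
rewrite /mkseq; elim: (iota 0 u) => //= i s IH h; rewrite -hu h ?mem_head //= IH //.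
by move=> j hj; apply: h; rewrite in_cons hj orbT.
Qed.

(** * Emitting numbers in binary *)

Section Numbers.
Variable S : finType.
Notation gen := (gen S (option bool)).

Definition gNil : gen := GFor (Const S 0) (GLetter S None).

Definition gNum (n : nat) (t : term S) : gen :=
  let d := Shr (tLift n t) (Var S 0) in
  GCat (GFor t (GIf d (GIf (tOdd d) (GLetter S (Some true)) (GLetter S (Some false))) gNil))
       (GLetter S None).

Definition gNums n (ts : seq (term S)) : gen := foldr (fun t g => GCat (gNum n t) g) gNil ts.

Lemma output_num x rho t : output x rho (gNum (size rho) t) =
  rcons (map Some (bits (eval x rho t))) None.
Proof.
set d := Shr (tLift (size rho) t) (Var S 0).
have hd i : eval x (i :: rho) d = eval x rho t %/ 2 ^ i.
  by rewrite -[LHS]/(eval x (i :: rho) (tLift (size rho) t) %/ 2 ^ i) eval_lift.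
pose digit i : seq (option bool) := if eval x (i :: rho) d != 0 then
  (if truth x (i :: rho) (tOdd d) then [:: Some true] else [:: Some false]) else [::].
rewrite -[LHS]/(flatten [seq digit i | i <- iota 0 (eval x rho t)] ++ [:: None]).
rewrite cats1 bits_seq; congr (rcons (flatten _) _); apply: eq_map => i.
by rewrite /digit truth_odd hd; case: ifP => // _; case: odd.
Qed.

Lemma output_nums x rho ts : output x rho (gNums (size rho) ts) =
  encode_nats [seq eval x rho t | t <- ts].
Proof. by elim: ts => //= t ts IH; rewrite -/(gNum _ _) -[LHS]/(output x rho (gNum (size rho) t) ++ _) IH output_num. Qed.
End Numbers.

(** * Stars with two intervals per edge *)

Definition endpoints (l : seq (nat * nat)) : seq nat :=
  flatten [seq [:: i.1; i.2] | i <- l].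

Definition covers (l : seq (nat * nat)) (t : nat) : bool :=
  has (fun i => i.1 <= t < i.2) l.

Lemma endpoints_inj : injective endpoints.
Proof.
elim=> [|[a b] l IH] [|[a' b'] l'] //= [-> ->].
by rewrite -/(endpoints l) -/(endpoints l') => /IH ->.
Qed.

Lemma ltn_exp_up_log n : n < 2 ^ up_log 2 n.+1.
Proof. by have := up_logP n.+1 (isT : 1 < 2). Qed.

Lemma bits_inj : injective bits.
Proof.
suff h n : n = foldr (fun (b : bool) a => b + 2 * a) 0 (bits n).
  by move=> n n' e; rewrite (h n) (h n') e.
rewrite /bits; have := ltn_exp_up_log n; move: (up_log 2 n.+1) => k.
elim: k n => [|k IH] n /=; first by rewrite expn0; lia.
rewrite expnS => hn.
have -> : [seq odd (n %/ 2 ^ i) | i <- iota 1 k] = mkseq (fun i => odd (n %/ 2 %/ 2 ^ i)) k.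
  rewrite /mkseq -[1]/(1 + 0) iotaDl -map_comp; apply: eq_map => i /=.
  by rewrite add1n expnS divnMA.
by rewrite -IH; lia.
Qed.

Lemma encode_nats_cons n s :
  encode_nats (n :: s) = rcons (map Some (bits n)) None ++ encode_nats s.
Proof. by []. Qed.

Lemma encode_nats_inj : injective encode_nats.
Proof.
elim=> [|n s IH] [|n' s'] //; rewrite ?encode_nats_cons.
- by case: (bits n').
- by case: (bits n).
move=> e; suff [-> /IH ->] : n = n' /\ encode_nats s = encode_nats s' by [].
have : bits n = bits n' /\ encode_nats s = encode_nats s'.
  elim: (bits n) (bits n') e => [|b l IHl] [|b' l'] //=; first by case.
  by case=> -> /IHl[-> ->].
by case=> /bits_inj ->.
Qed.

(** The number of intervals precedes them, so an edge block delimits itself. *)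
Lemma edge_data_inj n (G G' : temporal_graph 'I_n) (l l' : seq ('I_n * 'I_n)) :
  flatten [seq edge_data G uv | uv <- l] = flatten [seq edge_data G' uv | uv <- l'] ->
  l = l' /\ {in l, forall uv, intervals G [set uv.1; uv.2] = intervals G' [set uv.1; uv.2]}.
Proof.
elim: l l' => [|[u v] l IH] [|[u' v'] l'] //=.
rewrite -!/(endpoints _) => -[/val_inj eu /val_inj ev es]; subst u' v'.
have hs k : size (endpoints k) = 2 * size k by elim: k => //= -[a b] k; rewrite mulnS => <-.
move/eqP; rewrite eqseq_cat ?hs ?es // => /andP[/eqP/endpoints_inj ei /eqP/IH[-> h]].
split=> // w; rewrite in_cons => /orP[/eqP ->|]; [exact: ei|exact: h].
Qed.

(** Equal encodings do not make instances equal, as the intervals outside the edges may differ; but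
    everything a matching depends on can be decoded. *)
Lemma encode_matching k (I I' : tmt_instance k) :
  encode I = encode I' -> has_timed_matching I -> has_timed_matching I'.
Proof.
case: I => n G r g l hG hk hg hu hl; case: I' => n' G' r' g' l' hG' hk' hg' hu' hl'.
rewrite /encode /has_timed_matching /= => /encode_nats_inj[e].
case: n' / e in G' r' l' hG' hk' hu' hl' * => eT _ eg /edge_data_inj[el ei].
case=> M [[hM hov] hc]; exists M; split; last by rewrite hc.
have eE : edges G = edges G' by rewrite -hl -hl' el.
have eI e : e \in edges G -> intervals G e = intervals G' e.
  by rewrite -hl inE => /mapP[uv /ei h ->].
split; first by rewrite -eE.
move=> e f he hf [h1 h2 [t ht]]; apply: (hov e f he hf); split=> //.
exists t; move: ht; rewrite /exists_at !eI //; exact: (subsetP hM).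
Qed.

(** * Stars as instances *)

Section Star.
Variables (m T g : nat) (iv : nat -> seq (nat * nat)).
Hypothesis iv_ok : forall j, j < m -> interval_list T (iv j).
Hypothesis iv_few : forall j, j < m -> size (iv j) <= 2.
Hypothesis g_gt0 : 0 < g.

Definition ray (j : 'I_m) : {set 'I_m.+1} := [set ord0; lift ord0 j].
(** [intervals] takes a node set, so the index of a ray is recovered from its larger node. *)
Definition ray_index (e : {set 'I_m.+1}) : nat := (\max_(v in e) val v).-1.

Lemma ray_indexE j : ray_index (ray j) = j.
Proof.
rewrite /ray_index big_setU1 ?inE //=.
by rewrite big_set1 max0n.
Qed.

Lemma ray_inj : injective ray.
Proof. by move=> i j /(congr1 ray_index); rewrite !ray_indexE => /val_inj. Qed.

Lemma ray_card e : e \in [set ray j | j : 'I_m] -> #|e| = 2.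
Proof. by case/imsetP=> j _ ->; rewrite cards2 -[ord0 == _]negbK eq_liftF. Qed.

Lemma ray_intervals e : e \in [set ray j | j : 'I_m] ->
  interval_list T (iv (ray_index e)).
Proof. by case/imsetP=> j _ ->; rewrite ray_indexE; apply: iv_ok. Qed.

Definition star_graph : temporal_graph 'I_m.+1 :=
  TemporalGraph ray_card ray_intervals.

Lemma star_edge u v : underlying star_graph u v ->
  (u == ord0) != (v == ord0).
Proof.
case/imsetP=> j _ e.
have uv : u != v.
  have : #|[set u; v]| = 2 by rewrite e; apply/ray_card/imset_f.
  by rewrite cards2; case: (u != v).
have := set21 u v; have := set22 u v; rewrite e !inE.
case/orP=> /eqP ev; case/orP=> /eqP eu; move: uv; rewrite eu ev ?eqxx //.
Qed.

Lemma star_edge0 j : underlying star_graph ord0 (lift ord0 j).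
Proof. exact: imset_f. Qed.

(** Every edge has exactly one end at the centre, so every second node of a cycle is the centre: odd
    length is impossible, and even length above 2 repeats the centre. *)
Lemma star_tree : temporal_tree star_graph.
Proof.
have sym : symmetric (underlying star_graph).
  by move=> u v; rewrite /underlying setUC.
have to0 u : connect (underlying star_graph) ord0 u.
  case: (unliftP ord0 u) => [j|] ->; last exact: connect0.
  exact/connect1/star_edge0.
split; first by rewrite card_ord.
  by move=> u v; apply: connect_trans (to0 v); rewrite (sym_connect_sym sym).
case=> [|x [|y [|z c]]] // _ /andP[].
rewrite [cycle _ _]/= [uniq _]/= => /and3P[/star_edge xy /star_edge yz hc].
case/and3P; rewrite !inE !negb_or => /and3P[nxy nxz _] /andP[nyz hy] _.
case: (eqVneq y ord0) => [y0|y0]; last first.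
  have ex : x = ord0 by move: xy; rewrite (negbTE y0); case: (x =P ord0).
  have ez : z = ord0 by move: yz; rewrite (negbTE y0); case: (z =P ord0).
  by rewrite ex ez eqxx in nxz.
have z0 : z != ord0 by rewrite -y0 eq_sym.
have x0 : x != ord0 by rewrite -y0.
case: c hc hy => [|w c] /= /andP[/star_edge]; first by rewrite (negbTE z0) (negbTE x0).
rewrite (negbTE z0); case: (w =P ord0) => // -> _.
by rewrite inE y0 eqxx.
Qed.

Definition star_edges : seq ('I_m.+1 * 'I_m.+1) :=
  [seq (ord0, lift ord0 j) | j <- enum 'I_m].

Lemma star_few e : e \in edges star_graph -> size (intervals star_graph e) <= 2.
Proof. by case/imsetP=> j _ ->; rewrite /= ray_indexE iv_few. Qed.

Lemma star_uniq : uniq [seq [set uv.1; uv.2] | uv <- star_edges].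
Proof. by rewrite -map_comp (map_inj_uniq ray_inj) enum_uniq. Qed.

Lemma star_edgesE :
  [set e in [seq [set uv.1; uv.2] | uv <- star_edges]] = edges star_graph.
Proof.
rewrite -map_comp; apply/setP => e; rewrite inE; apply/mapP/imsetP => -[j _ ->];
  by exists j; rewrite ?mem_enum.
Qed.

Definition star : tmt_instance 2 :=
  TmtInstance ord0 star_tree star_few g_gt0 star_uniq star_edgesE.

Lemma encode_star : encode star =
  encode_nats [:: m.+1, T, 0, g & flatten
    [seq [:: 0, j.+1, size (iv j) & endpoints (iv j)] | j <- iota 0 m]].
Proof.
rewrite /encode /=; congr (encode_nats [:: _, _, _, _ & flatten _]).
rewrite -val_enum_ord -!map_comp; apply: eq_map => j /=.
by rewrite /edge_data /= -/(ray j) ray_indexE.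
Qed.

Definition share (i j : nat) : Prop := exists t, covers (iv i) t && covers (iv j) t.

Lemma star_matching : has_timed_matching star <->
  exists N : {set 'I_m}, #|N| = g /\ {in N &, forall i j : 'I_m, i != j -> ~ share i j}.
Proof.
have ov i j : overlap star_graph (ray i) (ray j) <-> i != j /\ share i j.
  split.
    case=> hne _ [t]; rewrite /exists_at /= !ray_indexE => ht; split; last by exists t.
    by apply: contraNneq hne => ->.
  case=> hne [t ht]; split; first by apply: contraNneq hne => /ray_inj ->.
    by exists ord0; rewrite !set21.
  by exists t; rewrite /exists_at /= !ray_indexE.
split=> [[M [[hM hov] hc]]|[N [hc hN]]].
  exists [set j | ray j \in M]; split; last first.
    move=> i j; rewrite !inE => hi hj nij hs; apply: (hov _ _ hi hj).
    by apply/ov.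
  have <- : #|M| = g := hc.
  rewrite -(card_imset _ ray_inj); congr #|pred_of_set _|; apply/setP => e.
  apply/imsetP/idP => [[j]|he]; first by rewrite inE => h ->.
  by have /imsetP[j _ ej] := subsetP hM _ he; exists j; rewrite // inE -ej.
exists (ray @: N); rewrite (card_imset _ ray_inj); split=> //; split.
  by apply/subsetP => e /imsetP[j _ ->]; apply: imset_f.
by move=> e f /imsetP[i hi ->] /imsetP[j hj ->] /ov[]; apply: hN.
Qed.
End Star.

(** * Satisfiability as a choice of pairwise disjoint rays *)

Section SatStar.
Variables (Nv K w : nat) (lit : nat -> nat -> nat * bool).
Hypothesis lit_lt : forall C l, C < K -> l < w -> (lit C l).1 < Nv.
Hypothesis w_gt0 : 0 < w.

Definition satisfiable : Prop :=
  exists s : nat -> bool, forall C, C < K ->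
    exists2 l, l < w & s (lit C l).1 = (lit C l).2.

(** Variable [v] owns a block of time points: offsets below [K] are slots of positive literals,
    offset [K] is the common point of its two rays, and [K + 1] to [2 * K] are slots of negative
    literals. Each clause has one slot per sign, because literals of the same clause need not be
    kept apart. *)
Definition stride := 2 * K + 1.
Definition slot (C l : nat) : nat :=
  (lit C l).1 * stride + (if (lit C l).2 then 0 else K + 1) + C.

(** Ray [2 * v] stands for [v] being false; it blocks the slots of the positive
    literals on [v].  Ray [2 * v + 1] blocks those of the negative ones. *)
Definition gadget (j : nat) : seq (nat * nat) :=
  if j < 2 * Nv then
    if odd j then [:: (j %/ 2 * stride + K, j %/ 2 * stride + stride)]
    else [:: (j %/ 2 * stride, j %/ 2 * stride + (K + 1))]
  else let C := (j - 2 * Nv) %/ w in let l := (j - 2 * Nv) %% w in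
    [:: (slot C l, slot C l + 1); (Nv * stride + 1 + C, Nv * stride + 2 + C)].

Definition gadgets := 2 * Nv + K * w.
Definition horizon := Nv * stride + K + 2.

Lemma stride_lt v v' a : v < v' -> a <= stride -> v * stride + a <= v' * stride.
Proof.
move=> h ha; have : v.+1 * stride <= v' * stride by rewrite leq_mul2r h orbT.
by rewrite mulSn; lia.
Qed.

Lemma stride_inj v v' a a' : a < stride -> a' < stride ->
  v * stride + a = v' * stride + a' -> v = v' /\ a = a'.
Proof.
move=> ha ha' e; have ev : v = v'.
  by have := congr1 (divn^~ stride) e; rewrite !divnMDl ?divn_small ?addn0 // /stride; lia.
by split=> //; move: e; rewrite ev => /addnI.
Qed.

Lemma literal_index j : j < gadgets -> ~~ (j < 2 * Nv) ->
  (j - 2 * Nv) %/ w < K /\ (j - 2 * Nv) %% w < w.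
Proof.
move=> h1 h2; rewrite ltn_mod ltn_divLR //; split=> //.
by move: h1; rewrite /gadgets; lia.
Qed.

Lemma slot_lt C l : C < K -> l < w -> slot C l + 1 <= Nv * stride.
Proof.
move=> hC hl; rewrite /slot -!addnA; apply: stride_lt; first exact: lit_lt.
by rewrite /stride; case: ifP; lia.
Qed.

(** The clause points start at [Nv * stride + 1] because consecutive intervals must be strictly
    separated, and the slot of a literal may end at [Nv * stride]. *)
Lemma gadget_ok j : j < gadgets -> interval_list horizon (gadget j).
Proof.
move=> hj; rewrite /gadget /interval_list /horizon; case: ifP => [h1|/negbT h1].
  have hv : j %/ 2 < Nv by lia.
  have := @stride_lt _ _ stride hv (leqnn _); rewrite /stride => h2.
  by case: ifP => _ /=; rewrite !andbT; lia.
have [hC hl] := literal_index hj h1.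
move: (_ %/ _) (_ %% _) hC hl => C l hC hl.
by have := slot_lt hC hl; rewrite /= !andbT; lia.
Qed.

Lemma gadget_few j : size (gadget j) <= 2.
Proof. by rewrite /gadget; do !case: ifP. Qed.

Lemma gadget_var v (b : bool) t : v < Nv -> covers (gadget (2 * v + b)) t =
  (v * stride + (if b then K else 0) <= t < v * stride + (if b then stride else K + 1)).
Proof.
move=> hv; rewrite /gadget; have -> : 2 * v + b < 2 * Nv by lia.
have -> : (2 * v + b) %/ 2 = v by lia.
have -> : odd (2 * v + b) = b by rewrite oddD oddM /=; case: b.
by case: b => /=; rewrite /covers /= orbF ?addn0.
Qed.

Lemma gadget_lit C l t : l < w -> covers (gadget (2 * Nv + (C * w + l))) t =
  (t == slot C l) || (t == Nv * stride + 1 + C).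
Proof.
move=> hl; rewrite /gadget ltnNge leq_addr /= addKn divnMDl // divn_small // addn0.
by rewrite modnMDl modn_small // /covers /= orbF; lia.
Qed.

Let sh := share gadget.

Lemma share_sym i j : sh i j -> sh j i.
Proof. by case=> t; rewrite andbC; exists t. Qed.

Lemma share_vars v : v < Nv -> sh (2 * v + false) (2 * v + true).
Proof.
move=> hv; exists (v * stride + K).
by rewrite !gadget_var //; rewrite /stride; lia.
Qed.

Lemma share_clause C l l' : l < w -> l' < w ->
  sh (2 * Nv + (C * w + l)) (2 * Nv + (C * w + l')).
Proof.
by move=> h h'; exists (Nv * stride + 1 + C); rewrite !gadget_lit // eqxx !orbT.
Qed.

Lemma share_lit C l : C < K -> l < w ->
  sh (2 * (lit C l).1 + ~~ (lit C l).2) (2 * Nv + (C * w + l)).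
Proof.
move=> hC hl; exists (slot C l); rewrite gadget_lit // eqxx gadget_var ?lit_lt //.
by rewrite /slot /stride; case: (lit C l).2 => /=; lia.
Qed.

(** Blocks of different variables are disjoint and precede the clause points, so the common time
    lies in the block of [v], and its offset reveals the sign. *)
Lemma share_vars_lit v (b : bool) C l : v < Nv -> C < K -> l < w ->
  sh (2 * v + b) (2 * Nv + (C * w + l)) -> v = (lit C l).1 /\ b = ~~ (lit C l).2.
Proof.
move=> hv hC hl [t]; rewrite gadget_var // gadget_lit // => /andP[h1].
case/orP=> /eqP et; last first.
  have e2 : stride = 2 * K + 1 by [].
  by have := @stride_lt _ _ stride hv (leqnn _); case: b h1; lia.
pose a := t - v * stride.
have ha : a < stride by move: h1; rewrite /a /stride; case: b; lia.
have et' : v * stride + a = t by rewrite /a; case: b h1; lia.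
move: et'; rewrite {1}et /slot -addnA => /stride_inj[] // ; first by rewrite /stride; case: ifP; lia.
move=> ev ea; split=> //; move: h1 ea; rewrite /a.
by case: b; case: (lit C l).2 => //=; rewrite /stride; lia.
Qed.

Lemma share_lits C l C' l' : C < K -> C' < K -> l < w -> l' < w ->
  sh (2 * Nv + (C * w + l)) (2 * Nv + (C' * w + l')) -> C = C'.
Proof.
move=> hC hC' hl hl' [t]; rewrite !gadget_lit // => /andP[].
have := slot_lt hC hl; have := slot_lt hC' hl'.
move=> s1 s2 /orP[] /eqP -> /orP[] /eqP; try lia.
rewrite /slot -!addnA => /stride_inj[]; rewrite /stride; case: (lit C l).2; case: (lit C' l').2; lia.
Qed.

Lemma share_two_vars v (b : bool) v' (b' : bool) : v < Nv -> v' < Nv ->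
  sh (2 * v + b) (2 * v' + b') -> v = v'.
Proof.
move=> hv hv' [t]; rewrite !gadget_var // => /andP[h1 h2].
have h : v * stride + (t - v * stride) = v' * stride + (t - v' * stride).
  by move: h1 h2; case: b; case: b'; lia.
move/stride_inj: h; case=> //; move: h1 h2; rewrite /stride; case: b; case: b'; lia.
Qed.

(** The rays are partitioned into [Nv + K] groups of pairwise conflicting rays: two rays for each
    variable, [w] rays for each clause. A conflict-free set has at most one ray in each group, so
    one with [Nv + K] rays has exactly one. *)
Definition clique (j : nat) : nat :=
  if j < 2 * Nv then j %/ 2 else Nv + (j - 2 * Nv) %/ w.

Lemma gadget_cases j : j < gadgets ->
  (exists v (b : bool), [/\ v < Nv, j = 2 * v + b & clique j = v]) \/
  (exists C l, [/\ C < K, l < w, j = 2 * Nv + (C * w + l) & clique j = Nv + C]).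
Proof.
move=> hj; rewrite /clique; case: ifP => [h|/negbT h].
  by left; exists (j %/ 2), (odd j); split; rewrite // -?modn2; lia.
have [hC hl] := literal_index hj h.
right; exists ((j - 2 * Nv) %/ w), ((j - 2 * Nv) %% w); split=> //.
by rewrite -divn_eq; lia.
Qed.

Lemma clique_share i j : i < gadgets -> j < gadgets -> i != j ->
  clique i = clique j -> sh i j.
Proof.
move=> hi hj nij.
case: (gadget_cases hi) => [[v [b [hv ei ->]]]|[C [l [hC hl ei ->]]]];
case: (gadget_cases hj) => [[v' [b' [hv' ej ->]]]|[C' [l' [hC' hl' ej ->]]]]; try lia.
  move=> e; subst v'; move: nij; rewrite ei ej.
  case: b {ei}; case: b' {ej}; rewrite ?eqxx // => _; last exact: share_vars.
  exact/share_sym/share_vars.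
by move=> /addnI eC; rewrite ei ej -eC; apply: share_clause.
Qed.

Lemma clique_lt j : j < gadgets -> clique j < Nv + K.
Proof.
by move/gadget_cases => [[v [b [hv _ ->]]]|[C [l [hC hl _ ->]]]]; lia.
Qed.

Lemma satisfiable_star : satisfiable <->
  exists N : {set 'I_gadgets}, #|N| = Nv + K /\
    {in N &, forall i j : 'I_gadgets, i != j -> ~ sh i j}.
Proof.
split=> [[s hs]|[N [hc hN]]].
  (* [xchoose] wants a witness for every [C]; the implication makes one trivial outside the
     formula. *)
  have hsx C : exists l, (C < K) ==> (l < w) && (s (lit C l).1 == (lit C l).2).
    case: (ltnP C K) => hC; last by exists 0.
    by have [l h1 h2] := hs C hC; exists l; rewrite h1 h2 eqxx.
  pose ch C := xchoose (hsx C).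
  have chP C : C < K -> ch C < w /\ s (lit C (ch C)).1 = (lit C (ch C)).2.
    by move=> hC; have := xchooseP (hsx C); rewrite -/(ch C) hC => /andP[? /eqP].
  (* One ray per group: for a variable the ray of its value, for a clause the ray of a true
     literal. *)
  pose sel i := if i < Nv then 2 * i + s i else 2 * Nv + ((i - Nv) * w + ch (i - Nv)).
  have hsel (i : 'I_(Nv + K)) : sel i < gadgets.
    rewrite /sel /gadgets; case: (ltnP i Nv) => h.
      have : 2 * i + s i < 2 * Nv by case: (s i); lia.
      by move/leq_trans; apply; apply: leq_addr.
    have hC : i - Nv < K by have := ltn_ord i; lia.
    have [hl _] := chP _ hC; rewrite ltn_add2l.
    by apply: leq_trans (_ : (i - Nv).+1 * w <= _); [rewrite mulSn; lia|rewrite leq_mul2r hC orbT].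
  have csel (i : 'I_(Nv + K)) : clique (sel i) = i.
    rewrite /sel /clique; case: (ltnP i Nv) => h.
      have -> : 2 * i + s i < 2 * Nv by case: (s i) => /=; lia.
      by case: (s i) => /=; lia.
    have hC : i - Nv < K by have := ltn_ord i; lia.
    have [hl _] := chP _ hC.
    by rewrite ltnNge leq_addr /= addKn divnMDl // divn_small // addn0 subnKC.
  pose S (i : 'I_(Nv + K)) := Ordinal (hsel i).
  have Sinj : injective S.
    by move=> i j /(congr1 (clique \o val)) /=; rewrite !csel => /val_inj.
  exists (S @: setT); rewrite card_imset // cardsT card_ord; split=> //.
  move=> _ _ /imsetP[i _ ->] /imsetP[j _ ->] nij; rewrite /= /sel.
  have {}nij : val i != val j by apply: contraNneq nij => /val_inj ->.
  have hlit (k k' : 'I_(Nv + K)) : k < Nv -> Nv <= k' ->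
      ~ sh (2 * k + s k) (2 * Nv + ((k' - Nv) * w + ch (k' - Nv))).
    move=> hk hk'; have hC : k' - Nv < K by have := ltn_ord k'; lia.
    have [hl e] := chP _ hC; case/share_vars_lit => // -> ; rewrite e.
    by case: (lit _ _).2.
  case: (ltnP i Nv) => hi; case: (ltnP j Nv) => hj.
  - by move=> hsh; move: nij; rewrite /= (share_two_vars hi hj hsh) eqxx.
  - exact: hlit.
  - by move/share_sym; apply: hlit.
  - have hCi : i - Nv < K by have := ltn_ord i; lia.
    have hCj : j - Nv < K by have := ltn_ord j; lia.
    have [hli _] := chP _ hCi; have [hlj _] := chP _ hCj.
    by move=> hsh; have := share_lits hCi hCj hli hlj hsh; move: nij => /=; lia.
pose cl (j : 'I_gadgets) : 'I_(Nv + K) := Ordinal (clique_lt (ltn_ord j)).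
have clinj : {in N &, injective cl}.
  move=> i j hi hj /(congr1 val) /= e; apply/eqP; apply: contraT => nij.
  by case: (hN i j hi hj nij); apply: clique_share.
(* [cl] is injective on [N] and both sides have [Nv + K] elements, so every group is hit. *)
have clsurj k : k < Nv + K -> exists2 j : 'I_gadgets, j \in N & clique j = k.
  move=> hk; have : cl @: N == setT.
    by rewrite eqEcard subsetT cardsT card_ord card_in_imset // hc leqnn.
  move/eqP/setP/(_ (Ordinal hk)); rewrite inE => /imsetP[j hj /(congr1 val) /= ej].
  by exists j.
(* A variable is true when its odd ray is selected, the one that blocks its negative literals. *)
exists (fun v => [exists j in N, val j == 2 * v + true]) => C hC.
have hk : Nv + C < Nv + K by lia.
have [j hj] := clsurj _ hk.
case: (gadget_cases (ltn_ord j)) => [[v [b [hv _ ->]]]|[C' [l [hC' hl ej ->]]]]; first lia.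
move/addnI => eC; rewrite eC in ej; exists l => //.
have hv := lit_lt hC hl; have hv' : (lit C l).1 < Nv + K by lia.
have [i hi] := clsurj _ hv'.
case: (gadget_cases (ltn_ord i)) => [[v [b [_ ei ->]]]|[? [? [? ? _ ->]]]]; last lia.
move=> ev; rewrite ev in ei.
have nij : i != j by apply/eqP => e; move: ei; rewrite e ej; case: b; lia.
have nsh := hN i j hi hj nij.
(* The ray of the other value would cover the slot of the selected literal. *)
have eb : b = (lit C l).2.
  apply/eqP; rewrite -[b == _]negbK; apply/negP => hb; apply: nsh.
  rewrite ei ej; have -> : b = ~~ (lit C l).2 by move: hb; case: b {ei}; case: (lit C l).2.
  exact: share_lit.
rewrite -eb; case: b ei {eb} => ei; first by apply/existsP; exists i; rewrite hi /= ei eqxx.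
apply/negbTE/negP => /existsP[i' /andP[hi' /eqP ei']].
have nii' : i != i' by apply/eqP => e; move: ei; rewrite e ei'; lia.
by case: (hN i i' hi hi' nii'); rewrite ei ei'; apply: share_vars.
Qed.
End SatStar.

(** * Tableaux of Turing machines *)

Section Tableau.
Variables (A S W : finType) (inj : S + W -> A) (M : tm A).

Notation tapes_no := (extra_tapes M).+1.
Notation cell := (tm_state M * {ffun 'I_tapes_no -> option A})%type.
Implicit Types (c : config M) (d : cell) (T k : nat).

(** The tape as seen from its head, which stands at column [T] throughout. *)
Definition tape_cell (T : nat) (t : tape A) (k : nat) : option A :=
  if T <= k then nth None t.2 (k - T) else nth None t.1 (T - k.+1).

Definition row T c k : cell :=
  (cstate c, [ffun i => tape_cell T (ctapes c i) k]).

(** The cell at the next step: [d0] is the scanned cell, and [d1], [d2], [d3] are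
    the old cells on the left, at the position itself and on the right; the flags
    tell which of these three is the scanned one. *)
Definition next_cell (b1 b2 b3 : bool) d0 d1 d2 d3 : cell :=
  if halting d0.1 then d2 else
  let r := delta d0.1 d0.2 in
  (r.1, [ffun i => let old (b : bool) d := if b then (r.2 i).1 else d.2 i in
     match (r.2 i).2 with
     | MoveLeft => old b1 d1
     | Stay => old b2 d2
     | MoveRight => old b3 d3
     end]).

(** Under a head that moves left the content moves right, so column [k] receives the old column
    [k.-1]; symmetrically for a move to the right. *)
Lemma tape_cell_shift T (t : tape A) m a k : 0 < k ->
  let old j := if j == T then a else tape_cell T t j in
  tape_cell T (shift m (write a t)) k =
  match m with MoveLeft => old k.-1 | Stay => old k | MoveRight => old k.+1 end.
Proof.
case: t => l r k0; rewrite /tape_cell; case: m => /=.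
- case: (ltngtP T k) => hk.
  + have -> : k - T = (k.-1 - T).+1 by lia.
    have -> : T <= k.-1 by lia.
    case: (eqVneq k.-1 T) => [->|ne]; first by rewrite subnn.
    have -> : k.-1 - T = (k.-1 - T).-1.+1 by lia.
    by rewrite /= nth_behead.
  + have -> : (T <= k.-1) = false by lia.
    have -> : (k.-1 == T) = false by lia.
    by rewrite nth_behead; congr nth; lia.
  + have -> : (T <= k.-1) = false by lia.
    have -> : (k.-1 == T) = false by lia.
    by rewrite hk prednK // !subnn /= nth0.
- case: (ltngtP T k) => hk //; last by rewrite hk subnn.
  have -> : k - T = (k - T).-1.+1 by lia.
  by rewrite /= nth_behead.
- case: (ltngtP T k) => hk.
  + have -> : (T <= k.+1) by lia.
    have -> : (k.+1 == T) = false by lia.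
    rewrite nth_behead; case: r => [|b r]; first by rewrite !nth_nil.
    by have -> : k.+1 - T = (k - T).+1 by lia.
  + case: (eqVneq k.+1 T) => [<-|ne]; first by rewrite subnn.
    have -> : (T <= k.+1) = false by lia.
    by have -> : T - k.+1 = (T - k.+2).+1 by lia.
  + have -> : (T <= k.+1) by lia.
    have -> : (k.+1 == T) = false by lia.
    by rewrite nth_behead; congr nth; lia.
Qed.

Lemma row_step T c k : 0 < k ->
  row T (step c) k = next_cell (k.-1 == T) (k == T) (k.+1 == T)
    (row T c T) (row T c k.-1) (row T c k) (row T c k.+1).
Proof.
move=> k0; rewrite /step /next_cell /=; case: ifP => // _.
have -> : [ffun i => tape_cell T (ctapes c i) T] = [ffun i => read (ctapes c i)].
  by apply/ffunP => i; rewrite !ffunE /tape_cell leqnn subnn nth0.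
congr pair; apply/ffunP => i; by rewrite !ffunE /= tape_cell_shift.
Qed.

Notation origin := (option (option S)).
Notation Blank := (None : origin).
Notation Certificate := (Some None : origin).
Notation Input a := (Some (Some a) : origin).

(** What the input alone says about column [k] at time 0. The certificate field takes the [q]
    columns after the input, and its content is left open. *)
Definition origin_at (T n q : nat) (x : seq S) k : origin :=
  if k < T then Blank else
  if ohead (drop (k - T) x) is Some a then Input a else
  if k < T + n + q then Certificate else Blank.

Definition initial_cell (o : option A) : cell :=
  (start M, [ffun i => if i == ord0 then o else None]).

Definition allowed1 (o : origin) d : bool :=
  match o with
  | None => d == initial_cell None
  | Some (Some a) => d == initial_cell (Some (inj (inl a)))
  | Some None => (d == initial_cell None) ||
      [exists b, d == initial_cell (Some (inj (inr b)))]
  end.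

Definition is_blank d : bool := d == initial_cell None.
Definition is_cert (o : origin) : bool := if o is Some None then true else false.

(** The last case admits no letter after a blank of the certificate field, so that a certificate
    shorter than the field is a word without gaps. *)
Definition forbidden (o o' : origin) d d' : bool :=
  [|| ~~ allowed1 o d, ~~ allowed1 o' d' |
    is_cert o && is_blank d && ~~ is_blank d'].

Section Formula.
Variables (T q : nat) (x : seq S).
Hypothesis T_large : size x + q < T.
Let n := size x.
Let org := origin_at T n q x.

(** These constraints are Horn clauses except for the choice of the initial row, so
    a model may be any superset of the tableau of an accepting run: uniqueness of
    the content of a cell need not be required. *)
Definition models (Y : nat -> nat -> cell -> bool) : Prop :=
  [/\ forall t k d0 d1 d2 d3, t < T -> 0 < k < 2 * T ->
        Y t T d0 -> Y t k.-1 d1 -> Y t k d2 -> Y t k.+1 d3 ->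
        Y t.+1 k (next_cell (k.-1 == T) (k == T) (k.+1 == T) d0 d1 d2 d3),
      forall k, k <= 2 * T -> exists d, Y 0 k d,
      forall k d d', k < 2 * T -> forbidden (org k) (org k.+1) d d' ->
        ~~ (Y 0 k d && Y 0 k.+1 d') &
      forall d, ~~ accepting d.1 -> ~~ Y T T d].

Lemma initial_cell_inj : injective initial_cell.
Proof. by move=> o o' [] /ffunP/(_ ord0); rewrite !ffunE eqxx. Qed.

Lemma row_init (z : seq (S + W)) k :
  row T (init M (map inj z)) k =
  initial_cell (if T <= k then omap inj (ohead (drop (k - T) z)) else None).
Proof.
congr pair; apply/ffunP => i; rewrite !ffunE /tape_cell.
case: eqP => _ /=; last by case: leqP => _; rewrite nth_nil.
case: leqP => _; last by rewrite nth_nil.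
elim: z (k - T) => [|a z IH] [|j] //=. 
Qed.

Lemma ohead_word_pair (y : seq W) j : ohead (drop j (word_pair x y)) =
  if ohead (drop j x) is Some a then Some (inl a)
  else omap inr (ohead (drop (j - size x) y)).
Proof.
rewrite /word_pair; elim: {+}x j => [|a x' IH] [|j] //=.
- by rewrite drop0; case: y.
- by rewrite subn0; elim: y (j.+1) => [|b y IH] [|i] //=.
Qed.

Lemma ohead_drop_ge (B : Type) (s : seq B) j : size s <= j -> ohead (drop j s) = None.
Proof. by move=> h; rewrite drop_oversize. Qed.

Lemma ohead_drop_None (B : Type) (s : seq B) j : ohead (drop j s) = None -> size s <= j.
Proof. by elim: s j => [|a s IH] [|j] //= /IH. Qed.

Lemma allowed_row (y : seq W) k (r := row T (init M (map inj (word_pair x y)))) :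
  size y <= q -> ~~ forbidden (org k) (org k.+1) (r k) (r k.+1).
Proof.
move=> hy.
have h1 i : allowed1 (org i) (r i).
  rewrite /r row_init /org /origin_at.
  case: (ltnP i T) => hi /=; first by rewrite eqxx.
  rewrite ohead_word_pair; case: ohead => [a|] /=; first by rewrite eqxx.
  case: ltnP => hq /=.
    case: ohead => [b|] /=; last by rewrite eqxx.
    by apply/orP; right; apply/existsP; exists b.
  by rewrite ohead_drop_ge //=; rewrite -/n; lia.
rewrite /forbidden !h1 /=; apply/negP => /andP[/andP[]].
rewrite /is_blank /r !row_init /org /origin_at.
case: (ltnP k T) => // hk; rewrite (leqW hk) !ohead_word_pair.
case ex: (ohead _) => [a|] //.
have hj := ohead_drop_None ex.
rewrite (ohead_drop_ge (s := x)) ?subSn //; last by lia.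
case: ltnP => // _ /=.
move=> _ /eqP/initial_cell_inj eb; case ey: (ohead _) eb => // _.
by rewrite (ohead_drop_ge (s := y)) ?eqxx //; have := ohead_drop_None ey; lia.
Qed.

Lemma tableau_complete (y : seq W) :
  size y <= q -> accepting (cstate (run M T (map inj (word_pair x y)))) ->
  exists Y, models Y.
Proof.
move=> hy hacc; pose r t := row T (run M t (map inj (word_pair x y))).
exists (fun t k d => r t k == d); split.
- move=> t k d0 d1 d2 d3 ht /andP[hk _] /eqP <- /eqP <- /eqP <- /eqP <-.
  by rewrite /r /run iterS row_step.
- by move=> k _; exists (r 0 k).
- move=> k d d' _ hf; apply/negP => /andP[/eqP e /eqP e'].
  by have := allowed_row k hy; rewrite -/(r 0 k) -/(r 0 k.+1) e e' hf.
- by move=> d; apply: contra => /eqP <-.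
Qed.

(** The positions after [x] up to the first blank hold a certificate. *)
Lemma tableau_sound Y : models Y ->
  exists y : seq W, size y <= q /\
    accepting (cstate (run M T (map inj (word_pair x y)))).
Proof.
case=> hstep hex hforb hacc.
have [ch hch] : exists ch : nat -> cell, forall k, k <= 2 * T -> Y 0 k (ch k).
  have hx k : exists d, (k <= 2 * T) ==> Y 0 k d.
    case: (leqP k (2 * T)) => hk; first by have [d hd] := hex k hk; exists d; rewrite hd.
    by exists (initial_cell None).
  by exists (fun k => xchoose (hx k)) => k hk; exact: (implyP (xchooseP (hx k)) hk).
have hal k : k < 2 * T -> ~~ forbidden (org k) (org k.+1) (ch k) (ch k.+1).
  move=> hk; apply/negP => hf; have := hforb k _ _ hk hf.
  by rewrite !hch //; lia.
have hal1 k : k <= 2 * T -> allowed1 (org k) (ch k).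
  (* Column [k] is the right half of the pair starting at [k.-1]; only column 0 needs the left half
     of its pair. *)
  case: k => [|k] hk; last by have := hal k hk; rewrite /forbidden !negb_or !negbK => /and3P[].
  have := hal 0; rewrite /forbidden !negb_or !negbK; case: (T) T_large => // T' _.
  by case/(_ isT)/and3P.
pose wl k : option W := [pick b | ch k == initial_cell (Some (inj (inr b)))].
have hwl k : k <= 2 * T -> org k = Certificate ->
    ch k = initial_cell (omap (inj \o inr) (wl k)).
  move=> /hal1 + eo; rewrite eo /wl /=; case: pickP => [b /eqP -> //|hno].
  by case/orP => [/eqP //|/existsP[b]]; rewrite hno.
pose s := [seq wl (T + n + j) | j <- iota 0 q].
pose y := pmap id (take (find (fun o => ~~ isSome o) s) s).
have ss : size s = q by rewrite size_map size_iota.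
have ys : map Some y = take (find (fun o => ~~ isSome o) s) s.
  by rewrite /y; elim: (s) => //= -[b|] s' IH //=; rewrite IH.
have hcert j : j < q -> org (T + n + j) = Certificate.
  move=> hj; rewrite /org /origin_at ohead_drop_ge; last by rewrite -/n; lia.
  have -> : (T + n + j < T) = false by lia.
  by have -> : T + n + j < T + n + q by lia.
have hy j : j < q -> wl (T + n + j) = ohead (drop j y).
  have sticky i : i.+1 < q -> wl (T + n + i) = None -> wl (T + n + i.+1) = None.
    move=> hi hn; have hk : T + n + i < 2 * T by rewrite /n; lia.
    have := hal _ hk; rewrite -addnS !hcert //; last by lia.
    rewrite /forbidden !negb_or !negbK => /and3P[_ _].
    have hi' : i < q by lia.
    have -> : ch (T + n + i) = initial_cell None by rewrite hwl ?hn ?hcert //; lia.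
    rewrite /= /is_blank eqxx /= negbK => /eqP e.
    have : ch (T + n + i.+1) = initial_cell (omap (inj \o inr) (wl (T + n + i.+1))).
      by apply: hwl; [lia|apply: hcert].
    by rewrite e => /initial_cell_inj; case: (wl _).
  have hall : forall a b, a <= b -> b < q -> wl (T + n + a) = None ->
      wl (T + n + b) = None.
    move=> a; elim=> [|b IH]; first by rewrite leqn0 => /eqP ->.
    rewrite leq_eqVlt => /orP[/eqP -> //|ab] hb hn.
    by apply: sticky => //; apply: IH => //; lia.
  move=> hj; set f := find (fun o => ~~ isSome o) s in ys.
  have sy : size y = minn f q by rewrite -(size_map Some) ys size_take_min ss.
  have ns i : i < q -> nth None s i = wl (T + n + i).
    by move=> hi; rewrite (nth_map 0) ?size_iota // nth_iota.
  case: (ltnP j f) => hf.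
    have : nth None (map Some y) j = wl (T + n + j) by rewrite ys nth_take // ns.
    have hjy : j < size y by rewrite sy; lia.
    case ey: (ohead (drop j y)) => [b|]; last by have := ohead_drop_None ey; lia.
    by rewrite (nth_map b) // => <-; rewrite -{1}(cat_take_drop j y) nth_cat size_take hjy ltnn subnn nth0; case: (drop j y) ey => //= ? ? [->].
  rewrite ohead_drop_ge; last by rewrite sy; lia.
  have hfq : f < q by lia.
  have := nth_find None (a := fun o => ~~ isSome o) (s := s).
  rewrite has_find ss -/f hfq => /(_ isT); rewrite ns //.
  by case e: (wl _) => // _; apply: hall e.
have sy : size y <= q.
  by rewrite -(size_map Some) ys -ss size_take_min geq_minr.
exists y; split=> //.
pose r t := row T (run M t (map inj (word_pair x y))).
have h0 k : k <= 2 * T -> ch k = r 0 k.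
  move=> hk; have := hal1 k hk; rewrite /r row_init ohead_word_pair.
  have := hwl k hk; rewrite /org /origin_at; case: (ltnP k T) => hT.
    by move=> _ /eqP ->.
  case eo: (ohead (drop (k - T) x)) => [a|] /=; first by move=> _ /eqP.
  have := ohead_drop_None eo; rewrite -/n => hn.
  case: ltnP => hq; last first.
    move=> _ /eqP ->; rewrite (ohead_drop_ge (s := y)) // -/n.
    by lia.
  move=> /(_ erefl) -> _; have hj : k - T - n < q by lia.
  have ek : T + n + (k - T - n) = k by lia.
  by rewrite -hy // ek; case: (wl k).
(* Columns 0 and [2 * T] carry no transition, so each step loses one column on either side; at time
   [T] exactly the head column [T] remains. *)
have hr t k : t <= k -> k + t <= 2 * T -> t <= T -> Y t k (r t k).
  elim: t k => [|t IH] k h1 h2 h3; first by rewrite -h0 ?hch //; lia.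
  rewrite /r /run iterS row_step; last lia.
  by apply: hstep; try apply: IH; lia.
apply: contraT => hna; have := hacc (r T T) hna.
by rewrite hr //; lia.
Qed.
End Formula.
End Tableau.

Lemma divnMDs a b c : c < b -> (a * b + c) %/ b = a.
Proof.
by move=> h; rewrite divnMDl ?divn_small ?addn0 //; apply: leq_ltn_trans h.
Qed.

Lemma modnMDs a b c : c < b -> (a * b + c) %% b = c.
Proof. by move=> h; rewrite modnMDl modn_small. Qed.

(** * Clauses of a tableau, numbered in mixed radix *)

Section Coding.
Variables (A S W : finType) (inj : S + W -> A) (M : tm A).
Notation cell := (tm_state M * {ffun 'I_(extra_tapes M).+1 -> option A})%type.

Definition cells : seq cell := enum {: cell}.
Definition cell_no := size cells.
Definition cell_of (n : nat) : cell := nth (initial_cell M None) cells n.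
Definition code (d : cell) : nat := index d cells.

Lemma code_lt d : code d < cell_no.
Proof. by rewrite index_mem mem_enum. Qed.

Lemma codeK : cancel code cell_of.
Proof. by move=> d; rewrite /cell_of nth_index // mem_enum. Qed.

Lemma cell_ofK n : n < cell_no -> code (cell_of n) = n.
Proof. by move=> h; rewrite /code index_uniq // enum_uniq. Qed.

Lemma cell_no_gt0 : 0 < cell_no.
Proof. exact: leq_ltn_trans (code_lt (initial_cell M None)). Qed.

Section Clauses.
Variables (T q : nat) (x : seq S).
Hypothesis T_large : size x + q < T.
Let org := origin_at T (size x) q x.
Let D := cell_no.

(** All clauses get the same number of literals. Five for a transition and [cell_no] for the choice
    of an initial cell both fit; surplus positions repeat a literal of the clause. *)
Definition width := cell_no + 5.
Definition variables := (T + 1) * (2 * T + 2) * cell_no.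
(** One digit for each index and one for the clause type; a type that ignores an index merely
    repeats its clauses. *)
Definition clauses :=
  T * (2 * T + 1) * cell_no * cell_no * cell_no * cell_no * 4.

Definition variable (t k d : nat) := (t * (2 * T + 2) + k) * cell_no + d.

Definition next_code (b1 b2 b3 : bool) (d0 d1 d2 d3 : nat) : nat :=
  code (next_cell b1 b2 b3 (cell_of d0) (cell_of d1) (cell_of d2) (cell_of d3)).

Definition forbidden_code k d d' : bool :=
  forbidden inj (org k) (org k.+1) (cell_of d) (cell_of d').

Definition rejecting_code d : bool := ~~ accepting (cell_of d).1.

(** Literal [l] of a clause of type [y]: its sign and the three indices of its
    variable.  Indices for which there is nothing to say give a tautology. *)
Definition literal_at (l y k t d0 d1 d2 d3 : nat) : nat * nat * nat * nat :=
  if (y == 0) && (0 < k) && (k < 2 * T) then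
    if l == 0 then (0, t, T, d0) else
    if l == 1 then (0, t, k - 1, d1) else
    if l == 2 then (0, t, k, d2) else
    if l == 3 then (0, t, k + 1, d3) else
    (1, t + 1, k, next_code (k - 1 == T) (k == T) (k + 1 == T) d0 d1 d2 d3)
  else if y == 1 then
    if l < cell_no then (1, 0, k, l) else (1, 0, k, 0)
  else if (y == 2) && (k < 2 * T) && forbidden_code k d0 d1 then
    if l == 0 then (0, 0, k, d0) else (0, 0, k + 1, d1)
  else if (y == 3) && rejecting_code d0 then (0, T, T, d0)
  else if l == 0 then (0, 0, 0, 0) else (1, 0, 0, 0).

Definition literal (C l : nat) : nat * bool :=
  let C1 := C %/ 4 in let C2 := C1 %/ D in let C3 := C2 %/ D in
  let C4 := C3 %/ D in let C5 := C4 %/ D in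
  let r := literal_at l (C %% 4) (C5 %% (2 * T + 1)) (C5 %/ (2 * T + 1))
             (C4 %% D) (C3 %% D) (C2 %% D) (C1 %% D) in
  (variable r.1.1.2 r.1.2 r.2, r.1.1.1 != 0).

Let D_gt0 : 0 < D := cell_no_gt0.

Let lit_of (r : nat * nat * nat * nat) : nat * bool :=
  (variable r.1.1.2 r.1.2 r.2, r.1.1.1 != 0).

Lemma clause_digits C : C < clauses ->
  exists y k t d0 d1 d2 d3,
    [/\ [/\ t < T, k < 2 * T + 1 & y < 4], [/\ d0 < D, d1 < D, d2 < D & d3 < D] &
        forall l, literal C l = lit_of (literal_at l y k t d0 d1 d2 d3)].
Proof.
move=> hC; exists (C %% 4), (C %/ 4 %/ D %/ D %/ D %/ D %% (2 * T + 1)),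
  (C %/ 4 %/ D %/ D %/ D %/ D %/ (2 * T + 1)), (C %/ 4 %/ D %/ D %/ D %% D),
  (C %/ 4 %/ D %/ D %% D), (C %/ 4 %/ D %% D), (C %/ 4 %% D).
have hk : 0 < 2 * T + 1 by rewrite addn1.
have ht : C %/ 4 %/ D %/ D %/ D %/ D %/ (2 * T + 1) < T.
  rewrite (ltn_divLR _ _ hk) !(ltn_divLR _ _ D_gt0) (ltn_divLR _ _ (isT : 0 < 4)).
  exact: hC.
by split; [split; rewrite ?ltn_mod|split; rewrite ltn_mod|].
Qed.

Lemma digits_clause y k t d0 d1 d2 d3 :
  t < T -> k < 2 * T + 1 -> y < 4 -> d0 < D -> d1 < D -> d2 < D -> d3 < D ->
  exists2 C, C < clauses &
    forall l, literal C l = lit_of (literal_at l y k t d0 d1 d2 d3).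
Proof.
move=> ht hk hy h0 h1 h2 h3.
have hlt a b c N : a < N -> c < b -> a * b + c < N * b.
  move=> ha hc; apply: leq_trans (_ : a.+1 * b <= _); first by rewrite mulSn addnC ltn_add2r.
  by rewrite leq_mul2r ha orbT.
have hd := divnMDs; have hm := modnMDs.
exists ((((((t * (2 * T + 1) + k) * D + d0) * D + d1) * D + d2) * D + d3) * 4 + y).
  apply: (hlt _ _ _ _ _ hy); apply: (hlt _ _ _ _ _ h3); apply: (hlt _ _ _ _ _ h2).
  by apply: (hlt _ _ _ _ _ h1); apply: (hlt _ _ _ _ _ h0); apply: (hlt _ _ _ _ ht hk).
by move=> l; rewrite /literal (hd _ _ _ hy) (hm _ _ _ hy) (hd _ _ _ h3) (hm _ _ _ h3) (hd _ _ _ h2)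
  (hm _ _ _ h2) (hd _ _ _ h1) (hm _ _ _ h1) (hd _ _ _ h0) (hm _ _ _ h0) (hd _ _ _ hk) (hm _ _ _ hk).
Qed.

Lemma variable_lt t k d : t <= T -> k < 2 * T + 2 -> d < D -> variable t k d < variables.
Proof.
move=> ht hk hd; rewrite /variable /variables.
apply: leq_trans (_ : (t * (2 * T + 2) + k).+1 * D <= _).
  by rewrite mulSn addnC ltn_add2r.
rewrite leq_mul2r; apply/orP; right.
apply: leq_trans (_ : t.+1 * (2 * T + 2) <= _); first by rewrite mulSn addnC ltn_add2r.
by rewrite leq_mul2r addn1 ltnS ht orbT.
Qed.

Lemma literal_lt C l : C < clauses -> l < width -> (literal C l).1 < variables.
Proof.
move=> /clause_digits[y [k [t [d0 [d1 [d2 [d3 [[ht hk hy] [h0 h1 h2 h3] ->]]]]]]]] hl.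
have hT : 0 < T by lia.
rewrite /literal_at /lit_of.
have hn b1 b2 b3 : next_code b1 b2 b3 d0 d1 d2 d3 < D := code_lt _.
by do ! case: ifP => ?; apply: variable_lt => //=; lia.
Qed.

Lemma models_satisfiable : (exists Y, models (M := M) inj T q x Y) <->
  satisfiable clauses width literal.
Proof.
split=> [[Y [htr hex hforb hacc]]|[s hs]].
  pose s v := Y (v %/ D %/ (2 * T + 2)) (v %/ D %% (2 * T + 2)) (cell_of (v %% D)).
  have sE t k d : k < 2 * T + 2 -> d < D -> s (variable t k d) = Y t k (cell_of d).
    by move=> hk hd; rewrite /s /variable !(divnMDs _ hd) !(modnMDs _ hd) (divnMDs _ hk) (modnMDs _ hk).
  exists s => C /clause_digits[y [k [t [d0 [d1 [d2 [d3 [[ht hk hy] [h0 h1 h2 h3] hl]]]]]]]].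
  have fin l : l < width -> 
      s (variable (literal_at l y k t d0 d1 d2 d3).1.1.2 (literal_at l y k t d0 d1 d2 d3).1.2
                  (literal_at l y k t d0 d1 d2 d3).2)
      = ((literal_at l y k t d0 d1 d2 d3).1.1.1 != 0) ->
      exists2 l, l < width & s (literal C l).1 = (literal C l).2.
    by move=> hw e; exists l; rewrite // hl.
  have w5 l : l < 5 -> l < width by rewrite /width; lia.
  rewrite /literal_at in fin.
  case c0: ((y == 0) && (0 < k) && (k < 2 * T)) fin => fin.
    case/andP: c0 => /andP[_ k0] k1.
    case e0: (Y t T (cell_of d0)); last first.
      by apply: (fin 0); [exact: w5|rewrite /= sE //; lia].
    case e1: (Y t (k - 1) (cell_of d1)); last first.
      by apply: (fin 1); [exact: w5|rewrite /= sE //; lia].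
    case e2: (Y t k (cell_of d2)); last first.
      by apply: (fin 2); [exact: w5|rewrite /= sE //; lia].
    case e3: (Y t (k + 1) (cell_of d3)); last first.
      by apply: (fin 3); [exact: w5|rewrite /= sE //; lia].
    (* All four premises hold, so the clause is satisfied by its conclusion. *)
    apply: (fin 4); first exact: w5.
    rewrite /= /next_code sE; [|lia|exact: code_lt]; rewrite codeK.
    rewrite subn1 in e1 *; rewrite addn1 in e3 *; rewrite addn1.
    by apply: htr => //; rewrite k0 k1.
  case c1: (y == 1) fin => fin.
    have [d hd] := hex k (ltac:(lia)).
    apply: (fin (code d)); first by rewrite /width; have := code_lt d; lia.
    by rewrite code_lt /= sE ?codeK //; [lia|exact: code_lt].
  case c2: ((y == 2) && (k < 2 * T) && forbidden_code k d0 d1) fin => fin.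
    case/andP: c2 => /andP[_ hk2] hf.
    have := hforb _ _ _ hk2 hf; rewrite negb_and => /orP[/negbTE e|/negbTE e].
      by apply: (fin 0); [exact: w5|rewrite /= sE //; lia].
    by apply: (fin 1); [exact: w5|rewrite /= sE ?addn1 //; lia].
  case c3: ((y == 3) && rejecting_code d0) fin => fin.
    case/andP: c3 => _ /hacc/negbTE e.
    by apply: (fin 0); [exact: w5|rewrite /= sE //; lia].
  case e: (s (variable 0 0 0)).
    by apply: (fin 1); [exact: w5|rewrite /= e].
  by apply: (fin 0); [exact: w5|rewrite /= e].
have get y k t d0 d1 d2 d3 :
    t < T -> k < 2 * T + 1 -> y < 4 -> d0 < D -> d1 < D -> d2 < D -> d3 < D ->
    exists2 l, l < width & let r := literal_at l y k t d0 d1 d2 d3 in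
      s (variable r.1.1.2 r.1.2 r.2) = (r.1.1.1 != 0).
  move=> a1 a2 a3 a4 a5 a6 a7.
  have [C hC e] := digits_clause a1 a2 a3 a4 a5 a6 a7.
  by have [l hl] := hs C hC; rewrite e => hl'; exists l.
have hT : 0 < T by lia.
exists (fun t k d => s (variable t k (code d))); split.
- move=> t k d0 d1 d2 d3 ht /andP[k0 k1] e0 e1 e2 e3.
  have hk : k < 2 * T + 1 by lia.
  have [l _] := get 0 k t _ _ _ _ ht hk isT (code_lt d0) (code_lt d1) (code_lt d2) (code_lt d3).
  rewrite /literal_at k0 k1 /=.
  case: ifP => _ /=; first by rewrite e0.
  case: ifP => _ /=; first by rewrite subn1 e1.
  case: ifP => _ /=; first by rewrite e2.
  case: ifP => _ /=; first by rewrite addn1 e3.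
  by rewrite /next_code !codeK subn1 !addn1.
- move=> k hk; have hk' : k < 2 * T + 1 by lia.
  (* Clauses of type 1 ignore the time and the four cells, which are set to 0. *)
  have [l _] := get 1 k 0 _ _ _ _ hT hk' isT D_gt0 D_gt0 D_gt0 D_gt0.
  rewrite /literal_at /=; case: ifP => hl /= e.
    by exists (cell_of l); rewrite cell_ofK.
  by exists (cell_of 0); rewrite cell_ofK.
- move=> k d d' hk hf; have hk' : k < 2 * T + 1 by lia.
  have [l _] := get 2 k 0 _ _ _ _ hT hk' isT (code_lt d) (code_lt d') D_gt0 D_gt0.
  rewrite /literal_at /= hk /forbidden_code !codeK hf /=.
  by case: ifP => _ /= e; rewrite ?addn1 in e; rewrite e ?andbF.
- move=> d hd.
  have [l _] := get 3 0 0 _ _ _ _ hT (ltac:(lia)) isT (code_lt d) D_gt0 D_gt0 D_gt0.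
  by rewrite /literal_at /= /rejecting_code codeK hd /= => ->.
Qed.

End Clauses.
End Coding.

(** * Computing the reduction *)

Section Quads.
Variable S : finType.
Notation term := (term S).
Notation quad := (term * term * term * term)%type.

(** A term has a single value, so a literal is a quadruple of terms with the branching pushed into
    the components; [evalq_if] turns it back into one conditional. *)
Definition qIf (c : term) (a b : quad) : quad :=
  (tIf c a.1.1.1 b.1.1.1, tIf c a.1.1.2 b.1.1.2, tIf c a.1.2 b.1.2, tIf c a.2 b.2).

Definition evalq x rho (a : quad) : nat * nat * nat * nat :=
  (eval x rho a.1.1.1, eval x rho a.1.1.2, eval x rho a.1.2, eval x rho a.2).

Lemma evalq_if x rho c a b : evalq x rho (qIf c a b) =
  if truth x rho c then evalq x rho a else evalq x rho b.
Proof. by rewrite /evalq /qIf !eval_if; case: truth. Qed.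

Lemma eval_and x rho (a b : term) :
  eval x rho (tAnd a b) = truth x rho a && truth x rho b.
Proof. by rewrite eval_truth truth_and. Qed.

Lemma encode_nats_cat s1 s2 : encode_nats (s1 ++ s2) = encode_nats s1 ++ encode_nats s2.
Proof. by rewrite /encode_nats map_cat flatten_cat. Qed.

Lemma encode_nats_flatten ss : encode_nats (flatten ss) = flatten (map encode_nats ss).
Proof. by elim: ss => //= s ss <-; rewrite encode_nats_cat. Qed.
End Quads.

Section Reduction.
Variables (A S W : finType) (inj : S + W -> A) (M : tm A) (p q : {poly nat}).
Notation cell := (tm_state M * {ffun 'I_(extra_tapes M).+1 -> option A})%type.
Notation term := (term S).
Notation origin := (option (option S)).
Notation V := (Var S).
Notation C := (Const S).

Definition certlen (x : seq S) := pev q (size x).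
(** Long enough for the machine on every certificate of admissible length, plus the room on the tape
    that [T_large] demands. *)
Definition time (x : seq S) :=
  pev p (size x + certlen x) + (size x + (certlen x + 1)).

Definition tq : term := tPoly q (Len S).
Definition tT : term := Add (tPoly p (Add (Len S) tq)) (Add (Len S) (Add tq (C 1))).

Lemma eval_tq x rho : eval x rho tq = certlen x.
Proof. exact: eval_poly. Qed.

Lemma eval_tT x rho : eval x rho tT = time x.
Proof.
by rewrite -[LHS]/(eval x rho (tPoly p _) + (_ + (eval x rho tq + 1))) eval_poly /= eval_tq.
Qed.

Definition tInput (P : pred S) (k : term) : term := tAnd (tLeq tT k) (Letter P (Minus k tT)).
Definition tCert (k : term) : term :=
  tAnd (tLeq tT k) (tAnd (tNot (tInput predT k)) (tLt k (Add (Add tT (Len S)) tq))).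
Definition tOrg (o : origin) (k : term) : term :=
  match o with
  | Some (Some a) => tInput (pred1 a) k
  | Some None => tCert k
  | None => tNot (tOr (tInput predT k) (tCert k))
  end.

Lemma truth_org o k x rho : truth x rho (tOrg o k) =
  (o == origin_at (time x) (size x) (certlen x) x (eval x rho k)).
Proof.
have hi P : truth x rho (tInput P k) = (time x <= eval x rho k) &&
    letter P x (eval x rho k - time x).
  rewrite truth_and truth_leq truth_letter eval_tT.
  by rewrite -[eval _ _ (Minus _ _)]/(_ - eval x rho tT) eval_tT.
have hc : truth x rho (tCert k) = [&& time x <= eval x rho k,
    ~~ letter predT x (eval x rho k - time x) &
    eval x rho k < time x + size x + certlen x].
  rewrite !truth_and truth_not hi truth_lt truth_leq eval_tT.
  rewrite -[eval _ _ (Add _ _)]/(eval x rho tT + size x + eval x rho tq) eval_tT eval_tq.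
  by case: (time x <= _).
rewrite /origin_at /letter; case: o => [[a|]|] /=.
- rewrite hi /letter; case: (ltnP (eval x rho k) (time x)) => //= _.
  by case: ohead => [b|] /=; [rewrite eq_sym|case: ifP].
- rewrite hc /letter; case: (ltnP (eval x rho k) (time x)) => //= _.
  by case: ohead => [b|] //=; case: ifP.
rewrite truth_not truth_or hi hc /letter.
case: (ltnP (eval x rho k) (time x)) => //= _.
by case: ohead => [b|] //=; case: ifP.
Qed.

Definition tIs (d : term) (delta : cell) : term := tEq d (C (code delta)).

Lemma truth_is x rho d delta : eval x rho d < cell_no M ->
  truth x rho (tIs d delta) = (delta == cell_of M (eval x rho d)).
Proof.
move=> h; rewrite truth_eq; apply/eqP/eqP => [->|->]; first by rewrite codeK.
by rewrite /= cell_ofK.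
Qed.

Definition tBool (b : bool) (t : term) : term := if b then t else tNot t.

Lemma truth_bool x rho b t : truth x rho (tBool b t) = (b == truth x rho t).
Proof. by case: b; rewrite /= ?truth_not; case: truth. Qed.

(** The input matters only through the two origins, which range over a finite type like the cells;
    hence a table. *)
Definition tForbidden (k d d' : term) : term :=
  @tCase S (origin * origin * cell * cell)%type
    (fun o => forbidden inj o.1.1.1 o.1.1.2 o.1.2 o.2)
    (fun o => tAnd (tAnd (tAnd (tOrg o.1.1.1 k) (tOrg o.1.1.2 (Add k (C 1))))
                         (tIs d o.1.2)) (tIs d' o.2)).

Lemma truth_forbidden x rho k d d' :
  eval x rho d < cell_no M -> eval x rho d' < cell_no M ->
  truth x rho (tForbidden k d d') =
  forbidden_code inj M (time x) (certlen x) x (eval x rho k) (eval x rho d) (eval x rho d').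
Proof.
move=> h h'; rewrite /truth (@eval_case _ _ _ _ _ _
  (origin_at (time x) (size x) (certlen x) x (eval x rho k),
   origin_at (time x) (size x) (certlen x) x (eval x rho k).+1,
   cell_of M (eval x rho d), cell_of M (eval x rho d'))).
  by rewrite /forbidden_code /=; case: forbidden.
by case=> [[[o o'] e] e']; rewrite eval_and !truth_and !truth_org !truth_is //= addn1.
Qed.

Definition tNext (b1 b2 b3 d0 d1 d2 d3 : term) : term :=
  @tCase S (bool * bool * bool * cell * cell * cell * cell)%type
    (fun o => code (next_cell o.1.1.1.1.1.1 o.1.1.1.1.1.2 o.1.1.1.1.2 o.1.1.1.2 o.1.1.2 o.1.2 o.2))
    (fun o => tAnd (tAnd (tAnd (tAnd (tAnd (tAnd (tBool o.1.1.1.1.1.1 b1) (tBool o.1.1.1.1.1.2 b2))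
        (tBool o.1.1.1.1.2 b3)) (tIs d0 o.1.1.1.2)) (tIs d1 o.1.1.2)) (tIs d2 o.1.2)) (tIs d3 o.2)).

Lemma eval_next x rho b1 b2 b3 d0 d1 d2 d3 :
  eval x rho d0 < cell_no M -> eval x rho d1 < cell_no M ->
  eval x rho d2 < cell_no M -> eval x rho d3 < cell_no M ->
  eval x rho (tNext b1 b2 b3 d0 d1 d2 d3) =
  next_code M (truth x rho b1) (truth x rho b2) (truth x rho b3)
    (eval x rho d0) (eval x rho d1) (eval x rho d2) (eval x rho d3).
Proof.
move=> h0 h1 h2 h3; rewrite (@eval_case _ _ _ _ _ _
  (truth x rho b1, truth x rho b2, truth x rho b3, cell_of M (eval x rho d0),
   cell_of M (eval x rho d1), cell_of M (eval x rho d2), cell_of M (eval x rho d3))) //.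
case=> [[[[[[c1 c2] c3] e0] e1] e2] e3].
by rewrite eval_and !truth_and !truth_bool !truth_is.
Qed.

Definition tRejecting (d : term) : term :=
  @tCase S cell (fun e => ~~ accepting e.1) (fun e => tIs d e).

Lemma truth_rejecting x rho d : eval x rho d < cell_no M ->
  truth x rho (tRejecting d) = rejecting_code M (eval x rho d).
Proof.
move=> h; rewrite /truth (@eval_case _ _ _ _ _ _ (cell_of M (eval x rho d))).
  by rewrite /rejecting_code; case: accepting.
by move=> e; rewrite eval_truth truth_is.
Qed.

(** The environment consists of the arguments of [literal_at]. *)
Definition tLiteralAt : term * term * term * term :=
  let l := V 0 in let y := V 1 in let k := V 2 in let t := V 3 in
  let d0 := V 4 in let d1 := V 5 in let d2 := V 6 in let d3 := V 7 in
  qIf (tAnd (tAnd (tEq y (C 0)) (tLt (C 0) k)) (tLt k (Mul (C 2) tT)))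
    (qIf (tEq l (C 0)) (C 0, t, tT, d0)
    (qIf (tEq l (C 1)) (C 0, t, Minus k (C 1), d1)
    (qIf (tEq l (C 2)) (C 0, t, k, d2)
    (qIf (tEq l (C 3)) (C 0, t, Add k (C 1), d3)
      (C 1, Add t (C 1), k, tNext (tEq (Minus k (C 1)) tT) (tEq k tT)
         (tEq (Add k (C 1)) tT) d0 d1 d2 d3)))))
  (qIf (tEq y (C 1))
    (qIf (tLt l (C (cell_no M))) (C 1, C 0, k, l) (C 1, C 0, k, C 0))
  (qIf (tAnd (tAnd (tEq y (C 2)) (tLt k (Mul (C 2) tT))) (tForbidden k d0 d1))
    (qIf (tEq l (C 0)) (C 0, C 0, k, d0) (C 0, C 0, Add k (C 1), d1))
  (qIf (tAnd (tEq y (C 3)) (tRejecting d0)) (C 0, tT, tT, d0)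
    (qIf (tEq l (C 0)) (C 0, C 0, C 0, C 0) (C 1, C 0, C 0, C 0))))).

Lemma evalq_literal_at x l y k t d0 d1 d2 d3 :
  d0 < cell_no M -> d1 < cell_no M -> d2 < cell_no M -> d3 < cell_no M ->
  evalq x [:: l; y; k; t; d0; d1; d2; d3] tLiteralAt =
  literal_at inj M (time x) (certlen x) x l y k t d0 d1 d2 d3.
Proof.
move=> h0 h1 h2 h3; rewrite /tLiteralAt /literal_at.
have e2 rho : eval x rho (Mul (C 2) tT) = 2 * time x by rewrite -(eval_tT x rho).
rewrite !(evalq_if, truth_and, truth_eq, truth_lt, e2, eval_tT) truth_forbidden //.
rewrite truth_rejecting // /evalq eval_next // !truth_eq !eval_tT.
by [].
Qed.
End Reduction.

Section Generator.
Variables (A S W : finType) (inj : S + W -> A) (M : tm A) (p q : {poly nat}).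
Notation term := (term S).
Notation V := (Var S).
Notation C := (Const S).
Notation T := (time p q).
Notation tT := (tT S p q).
Notation D := (cell_no M).

Definition nvars (x : seq S) := variables M (T x).
Definition nclauses (x : seq S) := clauses M (T x).
Definition lit (x : seq S) := literal inj M (T x) (certlen q x) x.

Definition tVars : term :=
  Mul (Mul (Add tT (C 1)) (Add (Mul (C 2) tT) (C 2))) (C D).
Definition tClauses : term :=
  Mul (Mul (Mul (Mul (Mul (Mul tT (Add (Mul (C 2) tT) (C 1))) (C D)) (C D)) (C D)) (C D)) (C 4).

Lemma eval_vars x rho : eval x rho tVars = nvars x.
Proof.
by rewrite -[LHS]/((eval x rho tT + 1) * (2 * eval x rho tT + 2) * D) eval_tT.
Qed.

Lemma eval_clauses x rho : eval x rho tClauses = nclauses x.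
Proof.
by rewrite -[LHS]/(eval x rho tT * (2 * eval x rho tT + 1) * D * D * D * D * 4) eval_tT.
Qed.

(** The environment consists of the clause index and the literal index. *)
Definition tDigits : seq term :=
  let C1 := tDiv (V 0) (C 4) in let C2 := tDiv C1 (C D) in
  let C3 := tDiv C2 (C D) in let C4 := tDiv C3 (C D) in let C5 := tDiv C4 (C D) in
  let R := Add (Mul (C 2) tT) (C 1) in
  [:: V 1; tMod (V 0) (C 4); tMod C5 R; tDiv C5 R;
      tMod C4 (C D); tMod C3 (C D); tMod C2 (C D); tMod C1 (C D)].

Definition tLitPart (part : term * term * term * term -> term) : term :=
  tCall tDigits (part (tLiteralAt inj M p q)).

Definition tLitVar : term :=
  Add (Mul (Add (Mul (tLitPart (fun r => r.1.1.2)) (Add (Mul (C 2) tT) (C 2)))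
                (tLitPart (fun r => r.1.2))) (C D)) (tLitPart (fun r => r.2)).
Definition tLitSign : term := tLitPart (fun r => r.1.1.1).

Lemma eval_literal x c l :
  lit x c l = (eval x [:: c; l] tLitVar, truth x [:: c; l] tLitSign).
Proof.
have D0 := cell_no_gt0 M.
pose C1 := c %/ 4; pose C2 := C1 %/ D; pose C3 := C2 %/ D; pose C4 := C3 %/ D.
pose C5 := C4 %/ D.
have e0 : [seq eval x [:: c; l] t | t <- tDigits] =
   [:: l; c %% 4; C5 %% (2 * T x + 1); C5 %/ (2 * T x + 1); C4 %% D; C3 %% D; C2 %% D; C1 %% D].
  have eR : eval x [:: c; l] (Add (Mul (C 2) tT) (C 1)) = 2 * T x + 1.
    by rewrite -(eval_tT p q x [:: c; l]).
  have R0 : 0 < 2 * T x + 1 by rewrite addn1.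
  have hD : 0 < eval x [:: c; l] (C D) by [].
  have h1 : eval x [:: c; l] (tDiv (V 0) (C 4)) = C1 by rewrite eval_div.
  have h2 : eval x [:: c; l] (tDiv (tDiv (V 0) (C 4)) (C D)) = C2 by rewrite eval_div ?h1.
  have h3 : eval x [:: c; l] (tDiv (tDiv (tDiv (V 0) (C 4)) (C D)) (C D)) = C3.
    by rewrite eval_div ?h2.
  have h4 : eval x [:: c; l] (tDiv (tDiv (tDiv (tDiv (V 0) (C 4)) (C D)) (C D)) (C D)) = C4.
    by rewrite eval_div ?h3.
  have h5 : eval x [:: c; l] (tDiv (tDiv (tDiv (tDiv (tDiv (V 0) (C 4)) (C D)) (C D)) (C D)) (C D)) = C5.
    by rewrite eval_div ?h4.
  by rewrite /tDigits [LHS]map_cons !map_cons !eval_mod ?eval_div ?eR.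
have hm a : a %% D < D by rewrite ltn_mod.
have := evalq_literal_at inj p q x l (c %% 4) (C5 %% (2 * T x + 1)) (C5 %/ (2 * T x + 1))
  (hm C4) (hm C3) (hm C2) (hm C1).
have eP part : eval x [:: c; l] (tLitPart part) = eval x [:: l; c %% 4;
   C5 %% (2 * T x + 1); C5 %/ (2 * T x + 1); C4 %% D; C3 %% D; C2 %% D; C1 %% D]
   (part (tLiteralAt inj M p q)) by rewrite eval_tcall e0.
rewrite /lit /literal => <-.
rewrite /truth eP -[eval x [:: c; l] tLitVar]/((eval x [:: c; l] (tLitPart (fun r => r.1.1.2)) *
   (2 * eval x [:: c; l] tT + 2) + eval x [:: c; l] (tLitPart (fun r => r.1.2))) * D +
    eval x [:: c; l] (tLitPart (fun r => r.2))).
by rewrite !eP eval_tT.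
Qed.

Notation Nv := nvars.
Notation K := nclauses.
Notation w := (width M).
Definition gadget_of (x : seq S) := gadget (Nv x) (K x) w (lit x).

Definition tStride := Add (Mul (C 2) tClauses) (C 1).

(** The numbers of the block that describes an edge in the encoding: centre, leaf, number of
    intervals, endpoints. [tLitRay] is its counterpart for literals. *)
Definition tVarRay : seq term :=
  let v := Mul (Shr (V 0) (C 1)) tStride in
  [:: C 0; Add (V 0) (C 1); C 1;
      Add v (tIf (tOdd (V 0)) tClauses (C 0));
      Add v (tIf (tOdd (V 0)) tStride (Add tClauses (C 1)))].

Definition tLitRay : seq term :=
  let c := tDiv (V 0) (C w) in let l := tMod (V 0) (C w) in
  let v := tCall [:: c; l] tLitVar in let s := tCall [:: c; l] tLitSign in
  let slot := Add (Add (Mul v tStride) (tIf s (C 0) (Add tClauses (C 1)))) c in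
  let pt := Mul tVars tStride in
  [:: C 0; Add (Add (Mul (C 2) tVars) (V 0)) (C 1); C 2; slot; Add slot (C 1);
      Add (Add pt (C 1)) c; Add (Add pt (C 2)) c].

Definition tHead : seq term :=
  [:: Add (Add (Mul (C 2) tVars) (Mul tClauses (C w))) (C 1);
      Add (Add (Mul tVars tStride) tClauses) (C 2); C 0; Add tVars tClauses].

Definition reduction_gen : gen S (option bool) :=
  GCat (gNums 0 tHead) (GCat (GFor (Mul (C 2) tVars) (gNums 1 tVarRay))
                             (GFor (Mul tClauses (C w)) (gNums 1 tLitRay))).

Lemma eval_stride x rho : eval x rho tStride = stride (K x).
Proof. by rewrite -[LHS]/(2 * eval x rho tClauses + 1) eval_clauses. Qed.

Definition ray_data (x : seq S) j : seq nat :=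
  [:: 0, j.+1, size (gadget_of x j) & endpoints (gadget_of x j)].

Lemma eval_var_ray x j : j < 2 * Nv x ->
  [seq eval x [:: j] t | t <- tVarRay] = ray_data x j.
Proof.
move=> hj; rewrite /ray_data /gadget_of /gadget hj.
set rho := [:: j].
have eA a b : eval x rho (Add a b) = eval x rho a + eval x rho b by [].
have eM a b : eval x rho (Mul a b) = eval x rho a * eval x rho b by [].
have eS : eval x rho (Shr (V 0) (C 1)) = j %/ 2 by [].
have eV : eval x rho (V 0) = j by [].
rewrite /tVarRay !map_cons !(eA, eM, eval_stride, eval_if, truth_odd, eval_clauses, eS, eV).
have eC c : eval x rho (C c) = c by [].
by rewrite !eC addn1; case: (odd j); rewrite /= ?addn0.
Qed.

Lemma eval_lit_ray x j : [seq eval x [:: j] t | t <- tLitRay] = ray_data x (2 * Nv x + j).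
Proof.
rewrite /ray_data /gadget_of /gadget ltnNge leq_addr addKn.
set rho := [:: j].
have w0 : 0 < w by rewrite /width addn_gt0 orbT.
have eA a b : eval x rho (Add a b) = eval x rho a + eval x rho b by [].
have eM a b : eval x rho (Mul a b) = eval x rho a * eval x rho b by [].
have eC c : eval x rho (C c) = c by [].
have eV : eval x rho (V 0) = j by [].
have eD : eval x rho (tDiv (V 0) (C w)) = j %/ w by rewrite eval_div.
have eMod : eval x rho (tMod (V 0) (C w)) = j %% w by rewrite eval_mod.
have ec : [seq eval x rho t | t <- [:: tDiv (V 0) (C w); tMod (V 0) (C w)]] = [:: j %/ w; j %% w].
  by rewrite !map_cons eD eMod.
have es : truth x rho (tCall [:: tDiv (V 0) (C w); tMod (V 0) (C w)] tLitSign) =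
    truth x [:: j %/ w; j %% w] tLitSign by rewrite truth_tcall ec.
have ev : eval x rho (tCall [:: tDiv (V 0) (C w); tMod (V 0) (C w)] tLitVar) =
    eval x [:: j %/ w; j %% w] tLitVar by rewrite eval_tcall ec.
rewrite /tLitRay !map_cons.
rewrite !(eA, eM, eD, eMod, eval_stride, eval_if, es, ev, eval_clauses, eval_vars, eV, eC).
rewrite /slot eval_literal; move: (eval x _ tLitVar) (truth x _ tLitSign) => v s.
by rewrite [in RHS]/= addn1.
Qed.

Lemma output_reduction x : output x [::] reduction_gen =
  encode_nats [:: (gadgets (Nv x) (K x) w).+1, horizon (Nv x) (K x), 0, Nv x + K x & flatten
    [seq ray_data x j | j <- iota 0 (gadgets (Nv x) (K x) w)]].
Proof.
rewrite -[LHS]/(output x [::] (gNums 0 tHead) ++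
  (flatten [seq output x [:: i] (gNums 1 tVarRay) | i <- iota 0 (eval x [::] (Mul (C 2) tVars))] ++
   flatten [seq output x [:: i] (gNums 1 tLitRay) | i <- iota 0 (eval x [::] (Mul tClauses (C w)))])).
set h := [:: _, _, _, _ & _].
have -> : h = [:: (gadgets (Nv x) (K x) w).+1; horizon (Nv x) (K x); 0; Nv x + K x] ++
   flatten [seq ray_data x j | j <- iota 0 (gadgets (Nv x) (K x) w)] by [].
rewrite encode_nats_cat (@output_nums _ x [::]) encode_nats_flatten -map_comp.
congr (encode_nats _ ++ _).
  have eA a b : eval x [::] (Add a b) = eval x [::] a + eval x [::] b by [].
  have eM a b : eval x [::] (Mul a b) = eval x [::] a * eval x [::] b by [].
  have eC c : eval x [::] (C c) = c by [].
  by rewrite /tHead !map_cons !(eA, eM, eC, eval_vars, eval_stride, eval_clauses) addn1.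
rewrite /gadgets iotaD map_cat flatten_cat add0n.
have -> : eval x [::] (Mul (C 2) tVars) = 2 * Nv x by rewrite -(eval_vars x [::]).
have -> : eval x [::] (Mul tClauses (C w)) = K x * w by rewrite -(eval_clauses x [::]).
congr (flatten _ ++ flatten _).
  apply/eq_in_map => j; rewrite mem_iota => /andP[_ hj].
  by rewrite (@output_nums _ x [:: j]) eval_var_ray.
rewrite -[in RHS](addn0 (2 * Nv x)) iotaDl -map_comp; apply: eq_map => j.
by rewrite (@output_nums _ x [:: j]) eval_lit_ray.
Qed.

End Generator.

(** * NP-hardness *)

Lemma run_halted (A : finType) (M : tm A) n n' w :
  n <= n' -> halting (cstate (run M n w)) -> run M n' w = run M n w.
Proof.
move=> /subnK <- h; rewrite /run iterD; elim: (n' - n) => //= k ->.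
by rewrite /step h.
Qed.

Lemma D_MAX_star (m T g : nat) (iv : nat -> seq (nat * nat))
    (iv_ok : forall j, j < m -> interval_list T (iv j))
    (iv_few : forall j, j < m -> size (iv j) <= 2) (g_gt0 : 0 < g) :
  D_MAX_01_TMT 2 (encode_nats [:: m.+1, T, 0, g & flatten
    [seq [:: 0, j.+1, size (iv j) & endpoints (iv j)] | j <- iota 0 m]]) <->
  exists N : {set 'I_m}, #|N| = g /\
    {in N &, forall i j : 'I_m, i != j -> ~ share iv i j}.
Proof.
rewrite -(star_matching iv_ok iv_few g_gt0) -(encode_star iv_ok iv_few g_gt0).
split=> [[I [e hI]]|h]; last by exists (star iv_ok iv_few g_gt0).
exact: encode_matching (esym e) hI.
Qed.

Lemma D_MAX_NP_hard : NP_hard (D_MAX_01_TMT 2).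
Proof.
move=> S L [W [V [q [[A [inj [M [p [_ hV]]]]] hL]]]].
exists (fun x => output x [::] (reduction_gen inj M p q)); split.
  exact: output_computable.
move=> x; rewrite output_reduction.
have hT : size x + certlen q x < time p q x by rewrite /time; lia.
have hw : 0 < width M by rewrite /width addn_gt0 orbT.
have hlt := literal_lt inj (M := M) hT.
have hok := gadget_ok hlt hw.
have hfew j (_ : j < gadgets (nvars M p q x) (nclauses M p q x) (width M)) :=
  gadget_few (nvars M p q x) (nclauses M p q x) (width M) (lit inj M p q x) j.
have hg : 0 < nvars M p q x + nclauses M p q x.
  by rewrite addn_gt0 /nvars /variables !muln_gt0 !addn_gt0 cell_no_gt0 !orbT.
rewrite (D_MAX_star hok hfew hg) -(satisfiable_star hlt hw) -(models_satisfiable inj M hT).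
(* The length of the tableau depends on [x] only. On a shorter certificate the time bound of the
   machine is smaller, but a halted machine stays where it is. *)
have hrun y : size y <= certlen q x ->
    (accepting (cstate (run M (time p q x) (map inj (word_pair x y)))) <->
     V (word_pair x y)).
  move=> hy; have [h1 h2] := hV (word_pair x y); rewrite -h2.
  rewrite (run_halted (n := pev p (size (word_pair x y)))) //.
  rewrite /word_pair size_cat !size_map /time.
  by apply: leq_trans (leq_addr _ _); apply: pev_mono; rewrite leq_add2l.
rewrite hL; split=> [[y [hy hv]]|[Y hY]].
  by apply: (tableau_complete hT hy); apply/hrun.
have [y [hy hv]] := tableau_sound hT hY.
by exists y; split=> //; apply/hrun.
Qed.

(** * Certifying trees and instances *)

Section TreeDepth.
Variables (V : finType) (e : rel V) (r : V).
Hypotheses (e_sym : symmetric e) (e_irr : irreflexive e).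

(** In a tree rooted at [r], the depth satisfies this, and the existence of such
    a function certifies a tree: a cycle would have two edges at a vertex of
    maximal depth. *)
Definition depth_function (dep : V -> nat) : Prop :=
  (forall v, v != r -> exists2 w, e v w & dep w < dep v) /\
  (forall v w w', e v w -> e v w' -> dep w <= dep v -> dep w' <= dep v -> w = w').

Lemma depth_tree dep : depth_function dep -> is_tree e.
Proof.
case=> hlow huniq.
have to_r v : connect e v r.
  have [n] := ubnP (dep v); elim: n v => // n IH v hn.
  case: (eqVneq v r) => [->|/hlow[w vw hw]]; first exact: connect0.
  by apply: connect_trans (connect1 vw) (IH _ _); apply: leq_trans hw _.
split; first by apply/card_gt0P; exists r.
  move=> u v; apply: connect_trans (to_r u) _.
  by rewrite (sym_connect_sym e_sym).
move=> c hc hcyc.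
have [v vc vmax] : exists2 v, v \in c & forall w, w \in c -> dep w <= dep v.
  case: c hc {hcyc} => // x c _.
  case: (@arg_maxnP V x (fun v => v \in x :: c) dep) => [|v vc hv]; first exact: mem_head.
  by exists v.
(* With a deepest node in front, its neighbours on the cycle are the second node and the last one,
   which differ because the cycle has at least three nodes. *)
have [i s es] := rot_to vc.
have : ucycle e (v :: s) by rewrite -es rot_ucycle.
have hs : 1 < size s by have := congr1 size es; rewrite size_rot /=; lia.
have hd w : w \in v :: s -> dep w <= dep v by rewrite -es mem_rot; apply: vmax.
case: s hs hd {es} => [|w [|w' s]] // _ hd /andP[].
rewrite /= rcons_path => /and4P[vw _ _ lv] /and3P[_ hw _].
have hl : last w' s \in w' :: s by apply: mem_last.
move: hw; rewrite (huniq v w (last w' s)) ?hl //.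
- by rewrite e_sym.
- by apply: hd; rewrite !inE eqxx orbT.
- by apply: hd; rewrite 2!in_cons hl !orbT.
Qed.

Fixpoint reach k v : bool :=
  if k is k'.+1 then [exists w, reach k' w && e w v] else v == r.

Lemma reach_path p : path e r p -> reach (size p) (last r p).
Proof.
elim/last_ind: p => [|p v IH] /=; first by rewrite eqxx.
rewrite rcons_path size_rcons last_rcons => /andP[/IH h hv].
by apply/existsP; exists (last r p); apply/andP.
Qed.

(** The depth is the distance from [r]. A neighbour of [v] that is no deeper than [v] is joined to
    [r] by a strictly descending path, which cannot pass through [v]. Two such neighbours are
    therefore connected without [v] and, if distinct, close a cycle through it. *)
Lemma tree_depth : is_tree e -> exists2 dep, depth_function dep &
  forall v, dep v < #|V|.
Proof.
case=> _ hconn hacyc.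
have hr v : exists2 k, reach k v & k < #|V|.
  have /connectP[p0 hp0 ->] := hconn r v.
  case: (shortenP hp0) => p hp hu _; exists (size p); first exact: reach_path.
  by have := max_card (mem (r :: p)); rewrite (card_uniqP hu).
have hex v : exists k, reach k v by have [k] := hr v; exists k.
pose dep v := ex_minn (hex v).
have depP v : reach (dep v) v by rewrite /dep; case: ex_minnP.
have dep_min v k : reach k v -> dep v <= k.
  by rewrite /dep; case: ex_minnP => m _; apply.
have hlow v : v != r -> exists2 w, e v w & dep w < dep v.
  move=> vr; have := depP v; case ed: (dep v) => [|k] /=; first by rewrite (negbTE vr).
  case/existsP=> w /andP[hw wv]; exists w; first by rewrite e_sym.
  by rewrite ltnS; apply: dep_min.
exists dep; last by move=> v; have [k /dep_min h1 h2] := hr v; apply: leq_ltn_trans h2.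
split=> // v w w' vw vw' hw hw'; apply/eqP; apply: contraT => nww'.
pose e' := [rel a b | [&& e a b, a != v & b != v]].
have e'_sym : symmetric e' by move=> a b; rewrite /= e_sym [(a != v) && _]andbC.
have nbr a : e v a -> a != v by move=> h; apply/eqP => ea; rewrite ea e_irr in h.
have conn a : a != v -> dep a <= dep v -> connect e' r a.
  have [n] := ubnP (dep a); elim: n a => // n IH a hn nav ha.
  case: (eqVneq a r) => [->|/hlow[b ab hb]]; first exact: connect0.
  have nbv : b != v by apply/eqP => eb; move: hb; rewrite eb ltnNge ha.
  apply: connect_trans (IH b _ nbv _) _; [exact: leq_trans hb _|by lia|].
  by apply: connect1; rewrite /= e_sym ab nbv.
have : connect e' w w'.
  apply: connect_trans (conn w' (nbr _ vw') hw').
  by rewrite (sym_connect_sym e'_sym); apply: conn hw; apply: nbr.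
case/connectP=> p0 hp0 ew'; case: (shortenP hp0) ew' => p hp hu _ ew'.
have nvp : v \notin w :: p.
  elim: p w {hw vw hu ew' nww' hp0} hp (nbr _ vw) => [|b p IH] a /=.
    by move=> _ nav; rewrite inE eq_sym.
  by case/andP=> /and3P[_ _ nbv] /IH/(_ nbv) h nav; rewrite in_cons eq_sym negb_or nav.
have hpe : path e w p by apply: sub_path hp => a b /and3P[].
case: (hacyc [:: v, w & p]).
  by case: (p) ew' nww' => [-> |] /=; rewrite ?eqxx.
by rewrite /ucycle cons_uniq nvp hu andbT /= vw rcons_path hpe /= -ew' e_sym vw'.
Qed.
End TreeDepth.

Lemma all_iotaP (P : pred nat) n :
  reflect (forall i, i < n -> P i) (all P (iota 0 n)).
Proof.
apply: (iffP allP) => h i; first by move=> hi; apply: h; rewrite mem_iota.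
by rewrite mem_iota => /andP[_]; apply: h.
Qed.

Lemma has_iotaP (P : pred nat) n :
  reflect (exists2 i, i < n & P i) (has P (iota 0 n)).
Proof.
apply: (iffP hasP) => -[i]; first by rewrite mem_iota => /andP[_ hi] h; exists i.
by move=> hi h; exists i; rewrite ?mem_iota.
Qed.

Definition same_pair (T : eqType) (a b c d : T) : bool :=
  ((a == c) && (b == d)) || ((a == d) && (b == c)).

Lemma eq_set2 (V : finType) (a b c d : V) :
  ([set a; b] == [set c; d]) = same_pair a b c d.
Proof.
apply/eqP/idP => [e|]; last first.
  by case/orP=> /andP[/eqP -> /eqP ->] //; rewrite setUC.
have /setP h := e; have := h a; have := h b; have := h c; have := h d.
rewrite !inE !eqxx ?orbT /same_pair.
rewrite [c == a]eq_sym [c == b]eq_sym [d == a]eq_sym [d == b]eq_sym.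
by do 4 case: (_ == _).
Qed.

(** * Instances as lists of numbers *)

Definition edge_record := (nat * nat * seq (nat * nat))%type.

Definition numbers (N T r g : nat) (E : seq edge_record) : seq nat :=
  [:: N, T, r, g &
    flatten [seq [:: e.1.1, e.1.2, size e.2 & endpoints e.2] | e <- E]].

Definition clash (l l' : seq (nat * nat)) : bool :=
  has (fun i => has (fun i' => (i.1 < i'.2) && (i'.1 < i.2)) l') l.

Section Certified.
Variables (N T r g m : nat) (eu ev : nat -> nat) (el : nat -> seq (nat * nat)).
Variables (dep : nat -> nat) (mem : nat -> bool).

Definition adj v w := has (fun j => same_pair v w (eu j) (ev j)) (iota 0 m).

Definition edges_ok : bool := all (fun j => [&& eu j < N, ev j < N, eu j != ev j,
  interval_list T (el j) & size (el j) <= 2]) (iota 0 m).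

Definition distinct_ok : bool := all (fun j => all (fun j' =>
  (j == j') || ~~ same_pair (eu j) (ev j) (eu j') (ev j')) (iota 0 m)) (iota 0 m).

Definition lower_ok : bool := all (fun v => (v == r) ||
  has (fun w => adj v w && (dep w < dep v)) (iota 0 N)) (iota 0 N).

Definition unique_ok : bool := all (fun v => all (fun w => all (fun w' =>
  [|| w == w', ~~ adj v w, ~~ adj v w', dep v < dep w | dep v < dep w'])
    (iota 0 N)) (iota 0 N)) (iota 0 N).

Definition meets j j' := [|| eu j == eu j', eu j == ev j', ev j == eu j' | ev j == ev j'].

Definition matching_ok : bool := all (fun j => all (fun j' =>
  [|| j == j', ~~ mem j, ~~ mem j', ~~ meets j j' | ~~ clash (el j) (el j')])
    (iota 0 m)) (iota 0 m).

(** Stated for arbitrary functions of the edge index rather than for a list, since the verifier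
    reads the same data through the block table of the certificate; [certified_ext] passes between
    the two. *)
Definition certified : bool :=
  [&& r < N, 0 < g, count mem (iota 0 m) == g, edges_ok, distinct_ok, lower_ok,
      unique_ok & matching_ok].

(** Every node but the root has a lower neighbour, hence lies on an edge. This keeps [N], which is
    written in binary, within the word length. *)
Lemma certified_size : certified -> N <= 2 * m + 1.
Proof.
case/and5P=> _ _ _ _ /and4P[_ /all_iotaP hl _ _].
have : {subset iota 0 N <= r :: flatten [seq [:: eu j; ev j] | j <- iota 0 m]}.
  move=> v; rewrite mem_iota in_cons => /andP[_ /hl/orP[->//|]].
  case/hasP=> w _ /andP[/hasP[j hj hs] _].
  apply/orP; right; apply/flattenP; exists [:: eu j; ev j]; first exact: map_f.
  by rewrite !inE; case/orP: hs => /andP[-> _]; rewrite ?orbT.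
move/(uniq_leq_size (iota_uniq 0 N)); rewrite size_iota /= addn1.
have -> // : size (flatten [seq [:: eu j; ev j] | j <- iota 0 m]) = 2 * m.
by rewrite -{2}(size_iota 0 m); elim: (iota 0 m) => //= j s ->; rewrite mulnS.
Qed.
End Certified.

(** Nonempty half-open intervals meet when each starts before the other ends, and then at the larger
    start. Comparing endpoints avoids a search through the time steps, of which there may be
    exponentially many. *)
Lemma clashP T (l l' : seq (nat * nat)) :
  interval_list T l -> interval_list T l' ->
  reflect (exists t, covers l t && covers l' t) (clash l l').
Proof.
have lt k i : interval_list T k -> i \in k -> i.1 < i.2.
  case/and3P=> _; rewrite -/(endpoints k) => + _; elim: k => // -[a b] k IH.
  rewrite /endpoints /= -/(endpoints k) in_cons => /andP[ab hk] /orP[/eqP -> //|].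
  by apply: IH; apply: path_sorted hk.
move=> hl hl'; apply: (iffP idP).
  case/hasP=> -[a b] hi /hasP[[a' b'] hi'] /andP[/= h1 h2].
  exists (maxn a a'); have := lt _ _ hl hi; have := lt _ _ hl' hi' => /= h3 h4.
  by apply/andP; split; apply/hasP; [exists (a, b)|exists (a', b')] => //=; lia.
case=> t /andP[/hasP[[a b] hi hit] /hasP[[a' b'] hi' hit']].
apply/hasP; exists (a, b) => //; apply/hasP; exists (a', b') => //=.
by move: hit hit' => /=; lia.
Qed.

Definition no_edge : edge_record := (0, 0, [::]).
Definition eu (E : seq edge_record) j := (nth no_edge E j).1.1.
Definition ev (E : seq edge_record) j := (nth no_edge E j).1.2.
Definition el (E : seq edge_record) j := (nth no_edge E j).2.

Notation certified_list N T r g E dep mem :=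
  (certified N T r g (size E) (eu E) (ev E) (el E) dep mem).

Lemma instance_certified (I : tmt_instance 2) : has_timed_matching I ->
  exists N T r g E dep mem, [/\ encode I = encode_nats (numbers N T r g E),
    certified_list N T r g E dep mem & forall v, dep v < N].
Proof.
case: I => n G root g L hT hk hg hu hL [M [[hM hov] /= hc]].
pose data (uv : 'I_n * 'I_n) : edge_record := (val uv.1, val uv.2, intervals G [set uv.1; uv.2]).
have irr : irreflexive (underlying G).
  by move=> v; apply/negP => /edges_card; rewrite setUid cards1.
have sym : symmetric (underlying G) by move=> u v; rewrite /underlying setUC.
have [d [hlow huniq] hd] := tree_depth root sym irr hT.
pose E := map data L; pose m := size E.
pose uv j := nth (root, root) L j; pose S j := [set (uv j).1; (uv j).2].
(* A number that is not a node gets the depth of the root, which keeps the bound on [dep]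
   unconditional. *)
pose dep v := d (insubd root v); pose mem j := S j \in M.
have sE : size L = m by rewrite /m size_map.
have Ej j : j < m -> nth no_edge E j = data (uv j).
  by move=> hj; rewrite (nth_map (root, root)) ?sE.
have Sedge j : j < m -> S j \in edges G.
  move=> hj; rewrite -hL inE; apply: (map_f (fun uv => [set uv.1; uv.2])).
  by rewrite mem_nth ?sE.
have Sinj j j' : j < m -> j' < m -> S j = S j' -> j = j'.
  move=> hj hj' e; apply/eqP; rewrite -(nth_uniq set0 _ _ hu) ?size_map ?sE //.
  by rewrite !(nth_map (root, root)) ?sE // -/(S j) -/(S j') e.
have edgeS e : e \in edges G -> exists2 j, j < m & e = S j.
  rewrite -hL inE => /mapP[w /(nthP (root, root))[j hj <-] ->].
  by exists j; rewrite // -sE.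
have adjE (v w : 'I_n) : adj m (eu E) (ev E) v w = underlying G v w.
  apply/has_iotaP/idP => [[j hj]|/edgeS[j hj /eqP]].
    rewrite /eu /ev Ej // => hs; have := Sedge j hj; rewrite /underlying.
    by have /eqP -> : [set v; w] == S j by rewrite eq_set2.
  by rewrite eq_set2 => hs; exists j; rewrite // /eu /ev Ej.
have depE (v : 'I_n) : dep v = d v by rewrite /dep valKd.
exists n, (lifetime G), (val root), g, E, dep, mem; split; last first.
- by move=> v; have := hd (insubd root v); rewrite card_ord.
- apply/and5P; split=> //; first exact: ltn_ord.
  + have <- : #|M| = g := hc.
    rewrite -size_filter; apply/eqP.
    have uf : uniq [seq S j | j <- iota 0 m & mem j].
      rewrite map_inj_in_uniq ?filter_uniq ?iota_uniq // => i j.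
      rewrite !mem_filter !mem_iota => /and3P[_ _ hi] /and3P[_ _ hj]; exact: Sinj.
    rewrite -(size_map S) -(card_uniqP uf); apply: eq_card => e.
    apply/mapP/idP => [[j]|he]; first by rewrite mem_filter => /andP[hj _] ->.
    have [j hj ej] := edgeS _ (subsetP hM _ he).
    by exists j; rewrite // mem_filter mem_iota hj /mem -ej he.
  + apply/all_iotaP => j hj; rewrite /eu /ev /el Ej //= !ltn_ord /=.
    rewrite (intervals_ok (Sedge j hj)) (hk _ (Sedge j hj)) !andbT.
    by have := edges_card (Sedge j hj); rewrite cards2 (inj_eq val_inj); case: (_ == _).
  apply/and4P; split.
  + apply/all_iotaP => j hj; apply/all_iotaP => j' hj'.
    rewrite /eu /ev !Ej // -implyNb; apply/implyP; apply: contra => hs.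
    by apply/eqP/Sinj => //; apply/eqP; rewrite eq_set2.
  + apply/all_iotaP => v hv; pose o := Ordinal hv.
    case: (eqVneq o root) => [<-|/hlow[w ow hw]]; first by rewrite eqxx.
    apply/orP; right; apply/has_iotaP; exists (val w); first exact: ltn_ord.
    by rewrite -[v]/(val o) adjE ow !depE.
  + apply/all_iotaP => v hv; apply/all_iotaP => w hw; apply/all_iotaP => w' hw'.
    rewrite -[v]/(val (Ordinal hv)) -[w]/(val (Ordinal hw)) -[w']/(val (Ordinal hw')).
    rewrite !adjE !depE.
    case vw: underlying; rewrite ?orbT //; case vw': underlying; rewrite ?orbT //=.
    case: ltnP => hd1; rewrite ?orbT //; case: ltnP => hd2; rewrite ?orbT //= orbF.
    by have /(congr1 val) /= -> := huniq _ _ _ vw vw' hd1 hd2; rewrite eqxx.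
  + apply/all_iotaP => j hj; apply/all_iotaP => j' hj'.
    case: eqP => //= njj'; case hm: (mem j) => //=; case hm': (mem j') => //=.
    rewrite -negb_and; apply/negP => /andP[hmeet hcl].
    apply: (hov _ _ hm hm'); split; first by apply/eqP => /Sinj e; apply/njj'/e.
      move: hmeet; rewrite /meets /eu /ev !Ej //= => /or4P[] /eqP/val_inj e.
      * by exists (uv j).1; rewrite set21 e set21.
      * by exists (uv j).1; rewrite set21 e set22.
      * by exists (uv j).2; rewrite set22 e set21.
      * by exists (uv j).2; rewrite set22 e set22.
    move: hcl; rewrite /el !Ej // => /clashP.
    by apply; apply: intervals_ok; apply: Sedge.
congr encode_nats; rewrite /numbers; congr [:: _, _, _, _ & flatten _].
by rewrite -map_comp; apply: eq_map => w.
Qed.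

Lemma certified_instance N T r g E dep mem : certified_list N T r g E dep mem ->
  exists I : tmt_instance 2,
    encode I = encode_nats (numbers N T r g E) /\ has_timed_matching I.
Proof.
case/and5P=> hr hg /eqP hcount hedges /and4P[hdist hlow huniq hmatch].
pose root := Ordinal hr; pose m := size E.
pose o v : 'I_N := insubd root v.
have oK v : v < N -> val (o v) = v by move=> hv; rewrite val_insubd hv.
pose S j := [set o (eu E j); o (ev E j)].
have hE j : j < m -> [/\ eu E j < N, ev E j < N, eu E j != ev E j,
    interval_list T (el E j) & size (el E j) <= 2].
  by move=> hj; move/all_iotaP: hedges => /(_ j hj)/and5P[].
have sameE j v w : j < m -> v < N -> w < N ->
    (S j == [set o v; o w]) = same_pair (eu E j) (ev E j) v w.
  move=> hj hv hw; have [hu1 hv1 _ _ _] := hE j hj.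
  by rewrite eq_set2 /same_pair -!val_eqE /= !oK.
have Sinj j j' : j < m -> j' < m -> S j = S j' -> j = j'.
  move=> hj hj' /eqP; have [hu1 hv1 _ _ _] := hE j' hj'; rewrite sameE // => hs.
  by move/all_iotaP: hdist => /(_ j hj)/all_iotaP/(_ j' hj'); rewrite hs orbF => /eqP.
pose edgs := [set S (val j) | j : 'I_m].
have edgsP e : e \in edgs -> exists2 j, j < m & e = S j.
  by case/imsetP=> j _ ->; exists (val j); rewrite ?ltn_ord.
have Sedge j : j < m -> S j \in edgs.
  by move=> hj; apply/imsetP; exists (Ordinal hj).
(* [intervals] takes a node set, so an edge is looked up by its ends; [distinct_ok] makes the first
   match the only one. *)
pose ix (e : {set 'I_N}) := find (fun j => S j == e) (iota 0 m).
have ixS j : j < m -> ix (S j) = j.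
  move=> hj; have hh : has (fun i => S i == S j) (iota 0 m).
    by apply/has_iotaP; exists j; rewrite ?eqxx.
  have hf : ix (S j) < m by rewrite /ix -{2}(size_iota 0 m) -has_find.
  have := nth_find 0 hh; rewrite -/(ix (S j)) nth_iota // add0n => /eqP.
  exact: Sinj.
have ecard e : e \in edgs -> #|e| = 2.
  case/edgsP=> j hj ->; have [hu1 hv1 hne _ _] := hE j hj.
  by rewrite cards2 -val_eqE /= !oK // hne.
have eint e : e \in edgs -> interval_list T (el E (ix e)).
  by case/edgsP=> j hj ->; rewrite ixS //; have [] := hE j hj.
pose G := TemporalGraph ecard eint.
have adjE (v w : 'I_N) : underlying G v w = adj m (eu E) (ev E) v w.
  rewrite /underlying /=; apply/idP/has_iotaP => [/edgsP[j hj /esym/eqP e]|[j hj hs]].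
    exists j => //; move: e; rewrite -(valKd root v) -(valKd root w) sameE ?ltn_ord //.
    by rewrite !valKd /same_pair ![_ == val _]eq_sym [X in _ || X]andbC.
  suff /eqP e : S j == [set v; w] by rewrite -e; apply: Sedge.
  rewrite -(valKd root v) -(valKd root w) sameE ?ltn_ord //.
  by move: hs; rewrite /same_pair ![_ == val _]eq_sym [X in _ || X]andbC.
have tree : temporal_tree G.
  apply: (@depth_tree _ _ root _ (fun v => dep (val v))).
    by move=> u v; rewrite /underlying setUC.
  split=> [v nv|v w w'].
    move/all_iotaP: hlow => /(_ v (ltn_ord v)); rewrite -val_eqE /= in nv.
    rewrite (negbTE nv) => /has_iotaP[w hw /andP[h1 h2]].
    by exists (Ordinal hw) => //; rewrite adjE.
  rewrite !adjE => h1 h2 h3 h4; apply/val_inj/eqP.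
  move/all_iotaP: huniq => /(_ v (ltn_ord v))/all_iotaP/(_ w (ltn_ord w)).
  move/all_iotaP/(_ w' (ltn_ord w')); rewrite h1 h2 /=.
  by rewrite !ltnNge h3 h4 !orbF.
have few e : e \in edges G -> size (intervals G e) <= 2.
  by case/edgsP=> j hj ->; rewrite /= ixS //; have [] := hE j hj.
pose L := [seq (o (eu E j), o (ev E j)) | j <- iota 0 m].
have Lu : uniq [seq [set uv.1; uv.2] | uv <- L].
  rewrite -map_comp map_inj_in_uniq ?iota_uniq // => i j.
  rewrite !mem_iota => /andP[_ hi] /andP[_ hj]; exact: Sinj.
have LE : [set e in [seq [set uv.1; uv.2] | uv <- L]] = edges G.
  apply/setP => e; rewrite inE -map_comp; apply/mapP/idP => [[j]|/edgsP[j hj ->]].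
    by rewrite mem_iota => /andP[_ hj] ->; apply: Sedge.
  by exists j; rewrite // mem_iota.
exists (TmtInstance root tree few hg Lu LE); split.
  congr encode_nats; rewrite /numbers /=; congr [:: _, _, _, _ & flatten _].
  rewrite -map_comp -[in RHS](mkseq_nth no_edge E) -map_comp; apply/eq_in_map => j.
  rewrite mem_iota => /andP[_ hj] /=; have [hu1 hv1 _ _ _] := hE j hj.
  by rewrite /edge_data /= -/(S j) ixS // !oK.
exists [set e in [seq S j | j <- iota 0 m & mem j]]; split; last first.
  rewrite /= -hcount -size_filter -(size_map S).
  have uf : uniq [seq S j | j <- iota 0 m & mem j].
    rewrite map_inj_in_uniq ?filter_uniq ?iota_uniq // => i j.
    rewrite !mem_filter !mem_iota => /and3P[_ _ hi] /and3P[_ _ hj]; exact: Sinj.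
  by rewrite -(card_uniqP uf); apply: eq_card => e; rewrite inE.
split=> /=.
  apply/subsetP => e; rewrite inE => /mapP[j]; rewrite mem_filter mem_iota.
  by case/and3P=> _ _ hj ->; apply: Sedge.
move=> e f; rewrite !inE => /mapP[j + ->] /mapP[j' + ->].
rewrite !mem_filter !mem_iota => /and3P[hm _ hj] /and3P[hm' _ hj'].
case=> ne [v /andP[hv hv']] [t]; rewrite /exists_at /= !ixS // => ht.
have [hu1 hv1 _ hi1 _] := hE j hj; have [hu2 hv2 _ hi2 _] := hE j' hj'.
move/all_iotaP: hmatch => /(_ j hj)/all_iotaP/(_ j' hj'); rewrite hm hm' /=.
case/or3P=> [/eqP ejj'|/negP h|/negP h].
- by rewrite ejj' eqxx in ne.
- case: h; move: hv hv'; rewrite !inE /meets.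
  by case/orP=> /eqP -> /orP[] /eqP/(congr1 val); rewrite !oK // => ->;
     rewrite eqxx ?orbT.
- by case: h; apply/(clashP hi1 hi2); exists t.
Qed.

(** * Verifying encoded instances *)

Definition bit (a j : nat) : bool := odd (a %/ 2 ^ j).

Lemma bitS a j : bit a j.+1 = bit (a %/ 2) j.
Proof. by rewrite /bit expnS divnMA. Qed.

Lemma bit0 a : bit a 0 = odd a.
Proof. by rewrite /bit expn0 divn1. Qed.

Lemma bits_ext k a b : a < 2 ^ k -> b < 2 ^ k ->
  (forall j, j < k -> bit a j = bit b j) -> a = b.
Proof.
elim: k a b => [|k IH] a b; first by rewrite expn0; lia.
rewrite expnS => ha hb h.
have := h 0 isT; rewrite !bit0 => h0.
suff : a %/ 2 = b %/ 2 by lia.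
by apply: IH => [||j hj]; [lia|lia|rewrite -!bitS; apply: h].
Qed.

(** Position [j] is the highest one at which the numbers differ. This form compares numbers that are
    too large to be values. *)
Lemma ltn_bits k a b : a < 2 ^ k -> b < 2 ^ k ->
  (a < b) = has (fun j => [&& ~~ bit a j, bit b j &
    all (fun i => (i <= j) || (bit a i == bit b i)) (iota 0 k)]) (iota 0 k).
Proof.
elim: k a b => [|k IH] a b; first by rewrite expn0 /=; lia.
rewrite expnS => ha hb; have ha' : a %/ 2 < 2 ^ k by lia.
have hb' : b %/ 2 < 2 ^ k by lia.
have {}IH := IH _ _ ha' hb'.
have h1 : (a < b) = (a %/ 2 < b %/ 2) || [&& ~~ odd a, odd b & a %/ 2 == b %/ 2] by lia.
rewrite h1 IH; apply/orP/has_iotaP.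
  case=> [/has_iotaP[j hj /and3P[ha0 hb0 /all_iotaP hall]]|/and3P[ha0 hb0 /eqP e]].
    exists j.+1 => //; apply/and3P; split; rewrite ?bitS //.
    by apply/all_iotaP => -[|i] // hi; rewrite !bitS; apply: hall.
  exists 0 => //; apply/and3P; split; rewrite ?bit0 //.
  by apply/all_iotaP => -[|i] // hi; rewrite !bitS e eqxx orbT.
case=> -[|j] hj /and3P[ha0 hb0 /all_iotaP hall].
  right; rewrite !bit0 in ha0 hb0; rewrite ha0 hb0; apply/eqP.
  apply: (@bits_ext k); try lia; move=> i hi.
  by have := hall i.+1 hi; rewrite !bitS => /eqP.
left; apply/has_iotaP; exists j => //; apply/and3P; split; rewrite -?bitS //.
by apply/all_iotaP => i hi; have := hall i.+1 hi; rewrite !bitS.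
Qed.

(** * Finding tokens and bits in an encoded list *)

Lemma size_bits a : size (bits a) = up_log 2 a.+1.
Proof. exact: size_mkseq. Qed.

Lemma nth_bits a j : nth false (bits a) j = bit a j.
Proof.
case: (ltnP j (size (bits a))) => hj.
  by rewrite nth_mkseq // -size_bits.
rewrite nth_default // /bit divn_small //.
apply: leq_trans (ltn_exp_up_log a) _; rewrite leq_exp2l //.
by rewrite -size_bits.
Qed.

Lemma size_encode_cons k s :
  size (encode_nats (k :: s)) = (size (bits k)).+1 + size (encode_nats s).
Proof. by rewrite encode_nats_cons size_cat size_rcons size_map. Qed.

Lemma count_None_encode s : count_mem None (encode_nats s) = size s.
Proof.
elim: s => // k s IH; rewrite encode_nats_cons count_cat IH -cats1 count_cat /=.
by rewrite (_ : count_mem None (map Some (bits k)) = 0) //; elim: (bits k).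
Qed.


(** A separator closes its own token, so the positions before token [i] are those preceded by fewer
    than [i] separators. Counting them, as [tTok] does, gives the start of the token. *)
Lemma token_start a i p : p < size (encode_nats a) ->
  (count_mem None (take p (encode_nats a)) < i) = (p < size (encode_nats (take i a))).
Proof.
rewrite -{1 2}(cat_take_drop i a) encode_nats_cat => hp.
case: (ltnP p (size (encode_nats (take i a)))) => h.
  rewrite take_cat h; case: (lastP (take i a)) h (size_take_min i a) => [|s k] //.
  rewrite -cats1 encode_nats_cat size_cat [encode_nats [:: k]]encode_nats_cons cats0 size_rcons size_map.
  rewrite addnS ltnS => h hs.
  have -> : take p (encode_nats s ++ rcons [seq Some i | i <- bits k] None) =
     take p (encode_nats s ++ [seq Some i | i <- bits k]).
    rewrite -cats1 catA take_cat size_cat size_map ltn_neqAle h andbT.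
    by case: eqP => [->|] //=; rewrite subnn cats0 take_oversize ?size_cat ?size_map.
  rewrite size_cat /= addn1 in hs; apply: leq_ltn_trans (_ : size s < i); last by lia.
  apply: leq_trans (_ : count_mem None (encode_nats s ++ [seq Some i | i <- bits k]) <= _).
    by rewrite -{2}(cat_take_drop p (encode_nats s ++ _)) count_cat leq_addr.
  rewrite count_cat count_None_encode.
  by rewrite (_ : count_mem None (map Some (bits k)) = 0) ?addn0 //; elim: (bits k).
apply/negbTE; rewrite -leqNgt take_cat ltnNge h /= count_cat count_None_encode.
apply: leq_trans (leq_addr _ _); rewrite size_take_min leq_min leqnn /=.
rewrite leqNgt; apply/negP => hi; move: hp.
by rewrite drop_oversize ?cats0 1?ltnNge ?h //; apply: ltnW.
Qed.

(** A certificate letter carries a bit of the depth table, a bit of the table of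
    block starts, and a membership bit. *)
Notation cert := (bool * bool * bool)%type.
Notation sym := (option bool + cert)%type.
Notation fterm := (term sym).
Notation V := (Var sym).
Notation C := (Const sym).

Definition in_instance : pred sym := fun s => if s is inl _ then true else false.
Definition is_sep : pred sym := fun s => if s is inl None then true else false.
Definition is_one : pred sym := fun s => if s is inl (Some true) then true else false.
Definition is_zero : pred sym := fun s => if s is inl (Some false) then true else false.
Definition on_cert (P : pred cert) : pred sym := fun s => if s is inr c then P c else false.

Definition tn : fterm := Sum (Len sym) (Letter in_instance (V 0)).
Definition tTok (i : fterm) : fterm :=
  tCall [:: i] (Sum tn (tLt (Sum (V 0) (Letter is_sep (V 0))) (V 1))).
Definition tCount : fterm := Sum tn (Letter is_sep (V 0)).
(** The comparison with the start of the next token keeps [j] off the separator and off later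
    tokens; beyond the last digit the bit is 0. *)
Definition tBit (i j : fterm) : fterm := tCall [:: i; j]
  (tAnd (tLt (Add (Add (tTok (V 0)) (V 1)) (C 1)) (tTok (Add (V 0) (C 1))))
        (Letter is_one (Add (tTok (V 0)) (V 1)))).
Definition tIff (b c : fterm) : fterm := tEq (tNot b) (tNot c).
(** [n + v] bits suffice: a token has at most [n] bits, and [v < 2 ^ v]. *)
Definition tEqv (i v : fterm) : fterm := tCall [:: i; v]
  (tAll (Add tn (V 1 : fterm)) (tIff (tBit (V 1) (V 0)) (tOdd (Shr (V 2) (V 0))))).
Definition tLtn (i i' : fterm) : fterm := tCall [:: i; i']
  (tEx tn (tAnd (tNot (tBit (V 1) (V 0))) (tAnd (tBit (V 2) (V 0))
    (tAll tn (tOr (tLeq (V 0) (V 1)) (tIff (tBit (V 2) (V 0)) (tBit (V 3) (V 0)))))))).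
(** The passage from a token to a value: a search through the numbers up to [n], with default 0 for
    a larger token. *)
Definition tVal (i : fterm) : fterm := tCall [:: i]
  (Sum (Add tn (C 1)) (Mul (V 0) (tNot (tNot (tEqv (V 1) (V 0)))))).
(** Entry [i] is written in unary, as the number of marks in the [i]-th segment of [n] certificate
    letters. *)
Definition tTable (P : pred cert) (i : fterm) : fterm := tCall [:: i]
  (Sum tn (Letter (on_cert P) (Add (Add tn (Mul (V 1) tn)) (V 0)))).

Section Pair.
Variables (x : seq (option bool)) (y : seq cert).
Let z := word_pair x y.
Let n := size x.

Lemma letter_pair P i : letter P z i =
  if i < n then P (inl (nth None x i))
  else if ohead (drop (i - n) y) is Some c then P (inr c) else false.
Proof.
rewrite /letter /z ohead_word_pair; case: ltnP => hi.
  by rewrite (drop_nth None hi).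
by rewrite (drop_oversize hi) /=; case: ohead.
Qed.

Lemma eval_n rho : eval z rho tn = n.
Proof.
rewrite -[RHS](@sum_lt (size z) n); last by rewrite /z size_cat size_map leq_addr.
rewrite [LHS]/=; apply: eq_bigr => i _; rewrite letter_pair.
by case: ltnP => // _; case: ohead.
Qed.
End Pair.

Section Tokens.
Variables (a : seq nat) (y : seq cert).
Let x := encode_nats a.
Let z := word_pair x y.
Let n := size x.
Let nv i := nth 0 a i.

Lemma sum_sep p : p <= n -> \sum_(i < p) letter is_sep z i = count_mem None (take p x).
Proof.
elim: p => [|p IH] hp; first by rewrite big_ord0 take0.
rewrite big_ord_recr (take_nth None hp) -cats1 count_cat IH ?(ltnW hp) //= addn0.
by rewrite letter_pair hp; case: (nth None x p).
Qed.

Lemma eval_tok rho i : eval z rho (tTok i) = size (encode_nats (take (eval z rho i) a)).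
Proof.
rewrite eval_tcall1; move: (eval z rho i) => k.
rewrite -[LHS]/(\sum_(p < eval z [:: k] tn) eval z [:: val p; k]
  (tLt (Sum (V 0) (Letter is_sep (V 0))) (V 1))) eval_n.
rewrite -[RHS](@sum_lt n); last first.
  by rewrite /n /x -{2}(cat_take_drop k a) encode_nats_cat size_cat leq_addr.
apply: eq_bigr => p _; rewrite eval_truth truth_lt /=.
by rewrite sum_sep ?token_start // ltnW.
Qed.

Lemma eval_count rho : eval z rho tCount = size a.
Proof.
rewrite -[LHS]/(\sum_(p < eval z rho tn) letter is_sep z p) eval_n.
by rewrite sum_sep // take_size count_None_encode.
Qed.

Lemma token_next i : i < size a ->
  size (encode_nats (take i.+1 a)) = size (encode_nats (take i a)) + (size (bits (nv i))).+1.
Proof.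
by move=> hi; rewrite (take_nth 0 hi) -cats1 encode_nats_cat size_cat size_encode_cons addn0.
Qed.

Lemma nth_token i j : i < size a -> j < size (bits (nv i)) ->
  nth None x (size (encode_nats (take i a)) + j) = Some (bit (nv i) j).
Proof.
move=> hi hj; rewrite /x -{1}(cat_take_drop i a) encode_nats_cat nth_cat ltnNge leq_addr /= addKn.
rewrite (drop_nth 0 hi) encode_nats_cons nth_cat size_rcons size_map ltnS (ltnW hj).
by rewrite nth_rcons size_map hj (nth_map false) // nth_bits.
Qed.

Lemma bit_ge k j : size (bits k) <= j -> bit k j = false.
Proof. by move=> h; rewrite -nth_bits nth_default. Qed.

Lemma truth_bit rho i j : truth z rho (tBit i j) = bit (nv (eval z rho i)) (eval z rho j).
Proof.
rewrite truth_tcall2; move: (eval z rho i) (eval z rho j) => k l.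
rewrite truth_and truth_lt truth_letter.
rewrite -[eval _ _ (Add (Add _ _) _)]/(eval z [:: k; l] (tTok (V 0)) + l + 1).
rewrite -[eval _ _ (Add _ _)]/(eval z [:: k; l] (tTok (V 0)) + l) !eval_tok /= addn1.
case: (ltnP k (size a)) => hk; last first.
  rewrite !take_oversize ?addn1 ?(leqW hk) // /nv nth_default // bit_ge //.
  by rewrite ltnNge; case: leqP => //; lia.
rewrite addn1 token_next // addnS ltnS ltn_add2l.
case: (ltnP l (size (bits (nv k)))) => hl; last by rewrite bit_ge.
have hln : size (encode_nats (take k a)) + l < n.
  have := token_next hk; have : size (encode_nats (take k.+1 a)) <= n.
    by rewrite /n /x -{2}(cat_take_drop k.+1 a) encode_nats_cat size_cat leq_addr.
  lia.
by rewrite letter_pair hln nth_token //=; case: bit.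
Qed.

Lemma truth_iff rho b c : truth z rho (tIff b c) = (truth z rho b == truth z rho c).
Proof. by rewrite truth_eq !eval_truth !truth_not; do 2 case: truth. Qed.

Lemma size_bits_le i : size (bits (nv i)) <= n.
Proof.
case: (ltnP i (size a)) => hi; last by rewrite /nv nth_default.
have := token_next hi; have : size (encode_nats (take i.+1 a)) <= n.
  by rewrite /n /x -{2}(cat_take_drop i.+1 a) encode_nats_cat size_cat leq_addr.
lia.
Qed.

Lemma nv_lt k i : n <= k -> nv i < 2 ^ k.
Proof.
move=> h; apply: leq_trans (ltn_exp_up_log _) _; rewrite leq_exp2l // -size_bits.
exact: leq_trans (size_bits_le i) h.
Qed.

Lemma truth_eqv rho i v : truth z rho (tEqv i v) = (nv (eval z rho i) == eval z rho v).
Proof.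
rewrite truth_tcall2; move: (eval z rho i) (eval z rho v) => k w.
rewrite truth_all -[eval _ _ (Add _ _)]/(eval z [:: k; w] tn + w) eval_n.
have hb j : truth z [:: j; k; w] (tIff (tBit (V 1) (V 0)) (tOdd (Shr (V 2) (V 0)))) =
    (bit (nv k) j == bit w j) by rewrite truth_iff truth_bit truth_odd.
apply/all_iotaP/eqP => [h|e j _]; last by rewrite hb e.
apply: (@bits_ext (n + w)); first exact/nv_lt/leq_addr.
  by apply: leq_trans (ltn_expl w (isT : 1 < 2)) _; rewrite leq_exp2l // leq_addl.
by move=> j /h; rewrite hb => /eqP.
Qed.

Lemma truth_ltn rho i i' :
  truth z rho (tLtn i i') = (nv (eval z rho i) < nv (eval z rho i')).
Proof.
rewrite truth_tcall2; move: (eval z rho i) (eval z rho i') => k l.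
rewrite truth_ex (@ltn_bits n) ?nv_lt // eval_n; apply: eq_has => j.
rewrite !truth_and truth_not !truth_bit /=; congr [&& _, _ & _].
rewrite truth_all eval_n; apply: eq_all => i0.
by rewrite truth_or truth_leq truth_iff !truth_bit.
Qed.

Definition small i := if nv i <= n then nv i else 0.

Lemma eval_val rho i : eval z rho (tVal i) = small (eval z rho i).
Proof.
rewrite eval_tcall1; move: (eval z rho i) => k.
rewrite -[LHS]/(\sum_(v < eval z [:: k] tn + 1)
  (val v * eval z [:: val v; k] (tNot (tNot (tEqv (V 1) (V 0)))))) eval_n addn1.
have hv (v : nat) : eval z [:: v; k] (tNot (tNot (tEqv (V 1) (V 0)))) = (nv k == v).
  by rewrite eval_truth 2!truth_not negbK truth_eqv.
rewrite (eq_bigr (fun v : 'I_n.+1 => val v * (nv k == val v))); last by move=> v _; rewrite hv.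
rewrite /small; case: leqP => h.
  rewrite (bigD1 (Ordinal (h : nv k < n.+1))) //= eqxx muln1 big1 ?addn0 // => v.
  by rewrite -val_eqE /= eq_sym => /negbTE ->; rewrite muln0.
rewrite big1 // => v _; case: eqP => [e|_]; last exact: muln0.
by move: h; rewrite e ltnNge -ltnS ltn_ord.
Qed.

Definition table (P : pred cert) (i : nat) : nat :=
  \sum_(j < n) (if ohead (drop (i * n + j) y) is Some c then P c else false).

Lemma eval_table P rho i : eval z rho (tTable P i) = table P (eval z rho i).
Proof.
rewrite eval_tcall1; move: (eval z rho i) => k.
rewrite -[LHS]/(\sum_(j < eval z [:: k] tn) letter (on_cert P) z
  (eval z [:: val j; k] tn + k * eval z [:: val j; k] tn + val j)) eval_n.
apply: eq_bigr => j _; rewrite eval_n letter_pair -addnA ltnNge leq_addr /= addKn.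
by case: ohead.
Qed.
End Tokens.

(** * Recognising encoded lists *)

Lemma bits_half k : 0 < k -> bits k = odd k :: bits k./2.
Proof.
move=> hk; apply: (@eq_from_nth _ false).
  by rewrite /= !size_mkseq up_log2S.
by move=> [|j] _; rewrite nth_bits ?bit0 //= nth_bits bitS divn2.
Qed.

Lemma bits_surj bs : last true bs -> exists k, bits k = bs.
Proof.
elim: bs => [|b bs IH]; first by exists 0.
move=> /= hl; have [k hk] : exists k, bits k = bs.
  by case: bs hl IH => [|c bs] hl IH; [exists 0|apply: IH].
have h0 : 0 < b + 2 * k.
  case: b hl => // hl; case: k hk => // hk; move: hl; rewrite -hk.
  by rewrite (_ : bits 0 = [::]).
exists (b + 2 * k); rewrite bits_half //; congr cons; first by case: (b); lia.
by rewrite -hk; congr bits; case: (b); lia.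
Qed.

(** Digits come with the least significant first, so a leading zero shows as [Some false] right
    before a separator. *)
Definition adjacent_ok (c d : option bool) : bool := ~~ ((c == Some false) && (d == None)).
Definition canonical (x : seq (option bool)) : bool :=
  (last None x == None) && sorted adjacent_ok x.

Lemma canonical_decode x : canonical x -> exists a, x = encode_nats a.
Proof.
case/andP=> /eqP hl hs; suff [bss hall ->] : exists2 bss : seq (seq bool), all (last true) bss &
    x = flatten [seq rcons (map Some bs) None | bs <- bss].
  elim: bss hall => [|bs bss IH] /=; first by exists [::].
  case/andP=> /bits_surj[k <-] /IH[a ->]; exists (k :: a).
  by rewrite encode_nats_cons.
elim: x hl hs => [|c x IH]; first by exists [::].
case: c => [b|] hl hs; last first.
  have [bss hall ->] := IH hl (path_sorted hs).
  by exists ([::] :: bss).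
have hl' : last None x = None by case: (x) hl.
have [[|bs bss] hall e] := IH hl' (path_sorted hs); first by rewrite e in hl.
exists ((b :: bs) :: bss); last by rewrite e.
case/andP: hall => h1 h2; apply/andP; split=> //=.
case: bs h1 e => [|c bs] // _ e; move: hs; rewrite e /= => /andP[+ _].
by rewrite /adjacent_ok; case: b {hl}.
Qed.

Lemma encode_canonical a : canonical (encode_nats a).
Proof.
have hw bs rest : last true bs -> sorted adjacent_ok rest ->
    sorted adjacent_ok (rcons (map Some bs) None ++ rest).
  move=> h1 h2; elim: bs h1 => [_|b [|c bs] IH hl] /=; first by case: rest h2.
    by case: b hl => // _; case: (rest) h2.
  by rewrite /adjacent_ok /= andbF; apply: IH hl.
have hb k : last true (bits k).
  elim/ltn_ind: k => k IH; case: (posnP k) => [->|hk]; first by rewrite (_ : bits 0 = [::]).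
  rewrite bits_half //=; have hk2 : k./2 < k by lia.
  have := IH _ hk2; case e: (bits k./2) => [|c s] //= _.
  case: (posnP k./2) => h; first by lia.
  by rewrite bits_half in e.
elim: a => // k a; rewrite /canonical encode_nats_cons => /andP[/eqP h1 h2].
rewrite hw // andbT last_cat last_rcons; apply/eqP.
by case: (encode_nats a) h1.
Qed.

Definition tCanonical : fterm :=
  tAnd (tOr (tEq tn (C 0)) (Letter is_sep (Minus tn (C 1))))
       (tAll tn (tNot (tAnd (Letter is_zero (V 0)) (Letter is_sep (Add (V 0) (C 1)))))).

Lemma truth_canonical x y rho : truth (word_pair x y) rho tCanonical = canonical x.
Proof.
have hsep i : i < size x -> letter is_sep (word_pair x y) i = (nth None x i == None).
  by move=> hi; rewrite letter_pair hi /=; case: nth.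
have hzero i : i < size x -> letter is_zero (word_pair x y) i = (nth None x i == Some false).
  by move=> hi; rewrite letter_pair hi /=; case: nth => [[]|].
have hsep' i : size x <= i -> letter is_sep (word_pair x y) i = false.
  by move=> hi; rewrite letter_pair ltnNge hi /=; case: ohead.
rewrite truth_and truth_or truth_eq truth_letter truth_all.
rewrite -[eval _ _ (Minus _ _)]/(eval (word_pair x y) rho tn - 1) eval_n; congr andb.
  case: x hsep {hzero hsep'} => [|c x] h; first by [].
  by rewrite subn1 h //= -last_nth.
apply/all_iotaP/(sortedP None) => h i hi.
  have := h i (ltnW hi); rewrite truth_not truth_and !truth_letter /=.
  by rewrite addn1 hsep // hzero // ltnW.
rewrite truth_not truth_and !truth_letter /= addn1 hzero //.
case: (ltnP i.+1 (size x)) => hi'; last by rewrite hsep' ?andbF.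
by rewrite hsep //; apply: h.
Qed.

(** The claimed place of edge [j], counted in tokens. Its block begins with the two ends and the
    number of intervals; the endpoints of the intervals follow, three tokens on, at [tStart j]. *)
Definition tBlk (j : fterm) : fterm := tTable (fun c => c.1.2) j.
Definition tDep (v : fterm) : fterm := tTable (fun c => c.1.1) v.
Definition tMem (j : fterm) : fterm := Letter (on_cert (fun c => c.2)) (Add tn (Mul j tn)).
Definition tStart (j : fterm) : fterm := Add (tBlk j) (C 3).
Definition tEu (j : fterm) : fterm := tVal (tBlk j).
Definition tEv (j : fterm) : fterm := tVal (Add (tBlk j) (C 1)).
Definition tKk (j : fterm) : fterm := tVal (Add (tBlk j) (C 2)).
Definition tN : fterm := tVal (C 0).
Definition tR : fterm := tVal (C 2).
Definition tG : fterm := tVal (C 3).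

Definition tSame (a b c d : fterm) : fterm :=
  tOr (tAnd (tEq a c) (tEq b d)) (tAnd (tEq a d) (tEq b c)).
Definition tAdj (m v w : fterm) : fterm := tCall [:: m; v; w]
  (tEx (V 0) (tSame (V 2) (V 3) (tEu (V 0)) (tEv (V 0)))).
(** Once neighbouring endpoints increase, the bound by the lifetime, which is token 1, need only be
    tested at the last one. *)
Definition tIntervals (j : fterm) : fterm := tCall [:: tStart j; tKk j]
  (tAnd (tAll (Minus (Mul (C 2) (V 1)) (C 1))
          (tLtn (Add (V 1) (V 0)) (Add (Add (V 1) (V 0)) (C 1))))
        (tNot (tLtn (C 1) (Minus (Add (V 0) (Mul (C 2) (V 1))) (C 1))))).
Definition tClash (j j' : fterm) : fterm :=
  tCall [:: tStart j; tKk j; tStart j'; tKk j']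
  (tEx (V 1) (tEx (V 4) (tAnd
    (tLtn (Add (V 2) (Mul (C 2) (V 1))) (Add (Add (V 4) (Mul (C 2) (V 0))) (C 1)))
    (tLtn (Add (V 4) (Mul (C 2) (V 0))) (Add (Add (V 2) (Mul (C 2) (V 1))) (C 1)))))).
Definition tMeets (j j' : fterm) : fterm :=
  tOr (tEq (tEu j) (tEu j')) (tOr (tEq (tEu j) (tEv j'))
  (tOr (tEq (tEv j) (tEu j')) (tEq (tEv j) (tEv j')))).

(** In the following formulas the outermost variable is the number of edges. *)
Definition tEdges : fterm := tAll (V 0)
  (tAnd (tLt (tEu (V 0)) tN) (tAnd (tLt (tEv (V 0)) tN)
  (tAnd (tNot (tEq (tEu (V 0)) (tEv (V 0)))) (tIntervals (V 0))))).
Definition tDistinct : fterm := tAll (V 0) (tAll (V 1)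
  (tOr (tEq (V 1) (V 0)) (tNot (tSame (tEu (V 1)) (tEv (V 1)) (tEu (V 0)) (tEv (V 0)))))).
Definition tLower : fterm := tAll tN (tOr (tEq (V 0) tR)
  (tEx tN (tAnd (tAdj (V 2) (V 1) (V 0)) (tLt (tDep (V 0)) (tDep (V 1)))))).
Definition tUnique : fterm := tAll tN (tAll tN (tAll tN
  (tOr (tEq (V 1) (V 0)) (tOr (tNot (tAdj (V 3) (V 2) (V 1)))
  (tOr (tNot (tAdj (V 3) (V 2) (V 0))) (tOr (tLt (tDep (V 2)) (tDep (V 1)))
       (tLt (tDep (V 2)) (tDep (V 0))))))))).
Definition tMatching : fterm := tAll (V 0) (tAll (V 1)
  (tOr (tEq (V 1) (V 0)) (tOr (tNot (tMem (V 1))) (tOr (tNot (tMem (V 0)))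
  (tOr (tNot (tMeets (V 1) (V 0))) (tNot (tClash (V 1) (V 0)))))))).
Definition tCertified : fterm :=
  tAnd (tLt tR tN) (tAnd (tLt (C 0) tG) (tAnd (tEq (Sum (V 0) (tMem (V 0))) tG)
  (tAnd tEdges (tAnd tDistinct (tAnd tLower (tAnd tUnique tMatching)))))).

(** Chains the claimed places: the first block is at token 4, after the four header numbers, each
    block begins where the previous one ends, and place [m] is the end of the list. *)
Definition tLayout : fterm :=
  tAnd (tLeq (C 4) tCount) (tAnd (tEq (tBlk (C 0)) (C 4)) (tAnd (tEq (tBlk (V 0)) tCount)
  (tAll (V 0) (tAnd (tEq (tBlk (Add (V 0) (C 1))) (Add (tStart (V 0)) (Mul (C 2) (tKk (V 0)))))
    (tOr (tEqv (Add (tBlk (V 0)) (C 2)) (C 1)) (tEqv (Add (tBlk (V 0)) (C 2)) (C 2))))))).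
(** Excludes the default 0 of [tVal] for the numbers that are used as values. *)
Definition tSmall (i : fterm) : fterm := tEqv i (tVal i).
Definition tExact : fterm :=
  tAnd (tSmall (C 0)) (tAnd (tSmall (C 2)) (tAnd (tSmall (C 3))
  (tAll (V 0) (tAnd (tSmall (tBlk (V 0))) (tSmall (Add (tBlk (V 0)) (C 1))))))).

Definition tVerifier : fterm :=
  tAnd tCanonical (tEx tn (tAnd tLayout (tAnd tExact tCertified))).

Lemma eval_add z rho (s t : fterm) : eval z rho (Add s t) = eval z rho s + eval z rho t.
Proof. by []. Qed.
Lemma eval_mul z rho (s t : fterm) : eval z rho (Mul s t) = eval z rho s * eval z rho t.
Proof. by []. Qed.
Lemma eval_minus z rho (s t : fterm) : eval z rho (Minus s t) = eval z rho s - eval z rho t.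
Proof. by []. Qed.
Lemma eval_const z rho c : eval z rho (C c) = c.
Proof. by []. Qed.
Definition evalE := (eval_add, eval_mul, eval_minus, eval_const).

(** * What the verifier computes *)

Section Verifier.
Variables (a : seq nat) (y : seq cert).
Let x := encode_nats a.
Let z := word_pair x y.
Let n := size x.
Let nv i := nth 0 a i.
Let sm i := small a i.

Definition cblk j := table a y (fun c => c.1.2) j.
Definition cdep v := table a y (fun c => c.1.1) v.
Definition cmem j := if ohead (drop (j * n) y) is Some c then c.2 else false.
Definition ceu j := sm (cblk j).
Definition cev j := sm (cblk j + 1).
Definition ckk j := sm (cblk j + 2).
Definition cel j : seq (nat * nat) := mkseq (fun i =>
  (nv (cblk j + 3 + 2 * i), nv (cblk j + 3 + 2 * i + 1))) (ckk j).

Definition layout m : bool := [&& 4 <= size a, cblk 0 == 4, cblk m == size a &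
  all (fun j => (cblk (j + 1) == cblk j + 3 + 2 * ckk j) &&
     ((nv (cblk j + 2) == 1) || (nv (cblk j + 2) == 2))) (iota 0 m)].
Definition exactly m : bool := [&& nv 0 == sm 0, nv 2 == sm 2, nv 3 == sm 3 &
  all (fun j => (nv (cblk j) == ceu j) && (nv (cblk j + 1) == cev j)) (iota 0 m)].

Lemma eval_blk rho j : eval z rho (tBlk j) = cblk (eval z rho j).
Proof. exact: eval_table. Qed.
Lemma eval_dep rho j : eval z rho (tDep j) = cdep (eval z rho j).
Proof. exact: eval_table. Qed.
Lemma truth_mem rho j : truth z rho (tMem j) = cmem (eval z rho j).
Proof.
rewrite truth_letter eval_add eval_mul !eval_n letter_pair ltnNge leq_addr /= addKn.
by rewrite /cmem; case: ohead.
Qed.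
Lemma eval_start rho j : eval z rho (tStart j) = cblk (eval z rho j) + 3.
Proof. by rewrite eval_add eval_blk. Qed.
Lemma eval_eu rho j : eval z rho (tEu j) = ceu (eval z rho j).
Proof. by rewrite eval_val eval_blk. Qed.
Lemma eval_ev rho j : eval z rho (tEv j) = cev (eval z rho j).
Proof. by rewrite eval_val eval_add eval_blk. Qed.
Lemma eval_kk rho j : eval z rho (tKk j) = ckk (eval z rho j).
Proof. by rewrite eval_val eval_add eval_blk. Qed.

Lemma truth_layout m : truth z [:: m] tLayout = layout m.
Proof.
rewrite !truth_and truth_leq !truth_eq !eval_blk eval_count truth_all; congr [&& _, _, _ & _].
apply: eq_all => j; rewrite truth_and truth_or truth_eq !truth_eqv.
by rewrite eval_blk !evalE eval_kk !eval_blk.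
Qed.

Lemma truth_small rho i : truth z rho (tSmall i) = (nv (eval z rho i) == sm (eval z rho i)).
Proof. by rewrite truth_eqv eval_val. Qed.

Lemma truth_exactly m : truth z [:: m] tExact = exactly m.
Proof.
rewrite 3!truth_and !truth_small truth_all; congr [&& _, _, _ & _].
apply: eq_all => j; rewrite truth_and !truth_small eval_add eval_blk.
by [].
Qed.

Lemma truth_same rho s t s' t' : truth z rho (tSame s t s' t') =
  same_pair (eval z rho s) (eval z rho t) (eval z rho s') (eval z rho t').
Proof. by rewrite truth_or !truth_and !truth_eq. Qed.

Lemma truth_adj rho m v w : truth z rho (tAdj m v w) =
  adj (eval z rho m) ceu cev (eval z rho v) (eval z rho w).
Proof.
rewrite truth_tcall3 truth_ex; apply: eq_has => j.
by rewrite truth_same eval_eu eval_ev.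
Qed.

Lemma truth_meets rho j j' : truth z rho (tMeets j j') =
  meets ceu cev (eval z rho j) (eval z rho j').
Proof. by rewrite !truth_or !truth_eq !eval_eu !eval_ev. Qed.

Lemma truth_tcall4 rho t1 t2 t3 t4 e : truth z rho (tCall [:: t1; t2; t3; t4] e) =
  truth z [:: eval z rho t1; eval z rho t2; eval z rho t3; eval z rho t4] e.
Proof. by rewrite truth_tcall. Qed.

Lemma size_instance : size a <= n.
Proof. by rewrite -[size a]count_None_encode /n count_size. Qed.

Lemma truth_clash rho j j' : truth z rho (tClash j j') =
  clash (cel (eval z rho j)) (cel (eval z rho j')).
Proof.
rewrite truth_tcall4 !eval_start !eval_kk.
rewrite truth_ex /clash has_map; apply: eq_has => i /=.
rewrite truth_ex has_map; apply: eq_has => i' /=.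
by rewrite truth_and !truth_ltn !evalE.
Qed.

Lemma ckk_cases m j : layout m -> j < m ->
  ((ckk j == 1) || (ckk j == 2)) && (nv (cblk j + 2) == ckk j).
Proof.
case/and4P=> h4 _ _ /all_iotaP h hj; have /andP[_ hk] := h j hj.
(* The word has at least four letters, so 1 and 2 do not exceed the limit beyond which [small] falls
   back to 0. *)
have hn := leq_trans h4 size_instance.
rewrite /ckk /sm /small -/n; change (nth 0 a (cblk j + 2)) with (nv (cblk j + 2)).
by case/orP: hk => /eqP ->; case: ifP; lia.
Qed.

Lemma truth_intervals m rho j : layout m -> eval z rho j < m ->
  truth z rho (tIntervals j) = interval_list (nv 1) (cel (eval z rho j)) &&
    (size (cel (eval z rho j)) <= 2).
Proof.
move=> hl hj; have /andP[hk _] := ckk_cases hl hj.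
rewrite truth_tcall2 eval_start eval_kk; move: (eval z rho j) hk {hj} => i.
rewrite /cel size_mkseq; move: (cblk i + 3) (ckk i) => s k hk.
rewrite truth_and truth_not truth_all truth_ltn !evalE.
rewrite -[eval _ _ (V 0)]/s -[eval _ _ (V 1)]/k.
have -> : all (fun i => truth z [:: i; s; k] (tLtn (Add (V 1) (V 0))
   (Add (Add (V 1) (V 0)) (C 1)))) (iota 0 (2 * k - 1)) =
   all (fun i => nv (s + i) < nv (s + i + 1)) (iota 0 (2 * k - 1)).
  by apply: eq_all => i0; rewrite truth_ltn !evalE.
have e1 : s + 2 - 1 = s + 1 by lia.
have e2 : s + 2 * 2 - 1 = s + 2 + 1 by lia.
have e3 : s + 1 + 1 = s + 2 by lia.
case/orP: hk => /eqP -> /=; rewrite /interval_list /= /nv ?muln0 ?muln1 ?addn0 !andbT.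
  by rewrite e1; lia.
by rewrite e2 e3; lia.
Qed.

Lemma truth_certified m : layout m -> truth z [:: m] tCertified =
  certified (sm 0) (nv 1) (sm 2) (sm 3) m ceu cev cel cdep cmem.
Proof.
move=> hl.
have eN rho : eval z rho tN = sm 0 by rewrite eval_val.
have eR rho : eval z rho tR = sm 2 by rewrite eval_val.
have eG rho : eval z rho tG = sm 3 by rewrite eval_val.
rewrite 7!truth_and; congr [&& _, _, _, _, _, _, _ & _].
- by rewrite truth_lt eN eR.
- by rewrite truth_lt eG.
- rewrite truth_eq eG; congr (_ == _).
  suff hs k : \sum_(j < k) eval z [:: val j; m] (tMem (V 0)) = count cmem (iota 0 k).
    exact: hs.
  elim: k => [|k IH]; first by rewrite big_ord0.
  rewrite big_ord_recr -[in RHS]addn1 iotaD count_cat -IH; congr (_ + _).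
  rewrite [RHS]/= addn0; have := truth_mem [:: k; m] (V 0).
  by rewrite /truth /=; case: letter => <-.
- rewrite truth_all; apply: eq_in_all => j; rewrite mem_iota => /andP[_ hj].
  by rewrite 3!truth_and truth_not truth_eq 2!truth_lt eval_eu eval_ev !eN (truth_intervals hl).
- rewrite truth_all; apply: eq_all => j; rewrite truth_all; apply: eq_all => j'.
  by rewrite truth_or truth_eq truth_not truth_same !eval_eu !eval_ev.
- rewrite truth_all eN; apply: eq_all => v; rewrite truth_or truth_eq eR.
  congr orb; rewrite truth_ex eN; apply: eq_has => w.
  by rewrite truth_and truth_adj truth_lt !eval_dep.
- rewrite truth_all eN; apply: eq_all => v; rewrite truth_all eN; apply: eq_all => w.
  rewrite truth_all eN; apply: eq_all => w'.
  by rewrite 4!truth_or truth_eq 2!truth_not !truth_adj 2!truth_lt !eval_dep.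
rewrite truth_all; apply: eq_all => j; rewrite truth_all; apply: eq_all => j'.
by rewrite 4!truth_or truth_eq 4!truth_not !truth_mem truth_meets truth_clash.
Qed.

Lemma truth_verifier : truth z [::] tVerifier =
  has (fun m => [&& layout m, exactly m &
    certified (sm 0) (nv 1) (sm 2) (sm 3) m ceu cev cel cdep cmem]) (iota 0 n).
Proof.
rewrite truth_and truth_canonical encode_canonical truth_ex eval_n; apply: eq_has => m.
rewrite truth_and truth_layout truth_and truth_exactly; case hl: layout => //=.
by rewrite truth_certified.
Qed.
End Verifier.

(** * Accepted words encode instances, and conversely *)

Definition block (e : edge_record) : seq nat :=
  [:: e.1.1, e.1.2, size e.2 & endpoints e.2].

Lemma certified_ext N T r g m eu ev el dep mem eu' ev' el' dep' mem' :
  (forall j, j < m -> eu j = eu' j) -> (forall j, j < m -> ev j = ev' j) ->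
  (forall j, j < m -> el j = el' j) -> (forall v, v < N -> dep v = dep' v) ->
  (forall j, j < m -> mem j = mem' j) ->
  certified N T r g m eu ev el dep mem = certified N T r g m eu' ev' el' dep' mem'.
Proof.
move=> hu hv hl hd hm.
have hall (P Q : pred nat) k : (forall j, j < k -> P j = Q j) ->
    all P (iota 0 k) = all Q (iota 0 k).
  by move=> h; apply: eq_in_all => j; rewrite mem_iota => /andP[_]; apply: h.
have hadj v w : adj m eu ev v w = adj m eu' ev' v w.
  by apply: eq_in_has => j; rewrite mem_iota => /andP[_ hj]; rewrite hu // hv.
congr [&& _, _, _, _, _, _, _ & _].
- by congr (_ == _); apply: eq_in_count => j; rewrite mem_iota => /andP[_]; apply: hm.
- by apply: (hall) => j hj; rewrite hu // hv // hl.
- by apply: (hall) => j hj; apply: (hall) => j' hj'; rewrite !hu // !hv.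
- apply: (hall) => v hv'; congr orb; apply: eq_in_has => w; rewrite mem_iota => /andP[_ hw].
  by rewrite hadj !hd.
- by apply: (hall) => v hv'; apply: (hall) => w hw; apply: (hall) => w' hw'; rewrite !hadj !hd.
by apply: (hall) => j hj; apply: (hall) => j' hj'; rewrite /meets !hm // !hu // !hv // !hl.
Qed.

Section Decode.
Variables (a : seq nat) (y : seq cert).
Let F j : edge_record := (ceu a y j, cev a y j, cel a y j).

(** The claimed blocks adjoin each other from token 4 to the end, so reading them one after the
    other recovers the whole list. *)
Lemma layout_numbers m : layout a y m -> exactly a y m ->
  a = numbers (small a 0) (nth 0 a 1) (small a 2) (small a 3) (mkseq F m).
Proof.
move=> hl; have ckk2 j (hj : j < m) := ckk_cases hl hj.
case/and4P: hl => h4 /eqP b0 /eqP bm /all_iotaP hs.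
case/and4P=> /eqP x0 /eqP x2 /eqP x3 /all_iotaP hx.
have step j : j < m -> cblk a y j.+1 = cblk a y j + (3 + 2 * ckk a y j).
  by move=> /hs/andP[/eqP + _]; rewrite addn1 addnA.
(* By induction from the end: the last place is the length of the list, and the places increase. *)
have hb d : d <= m -> cblk a y (m - d) <= size a.
  elim: d => [|d IH] hd; first by rewrite subn0 bm.
  have := IH (ltnW hd); have -> : m - d = (m - d.+1).+1 by lia.
  by rewrite step; lia.
suff h k : k <= m -> take (cblk a y k) a =
    [:: small a 0; nth 0 a 1; small a 2; small a 3] ++ flatten (map block (mkseq F k)).
  by have := h m (leqnn m); rewrite bm take_size.
elim: k => [|k IH] hk.
  rewrite b0 -[X in take 4 X]drop0 -(map_nth_iota 0) ?subn0 //=.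
  by rewrite x0 x2 x3.
rewrite step // takeD IH ?(ltnW hk) // -catA; congr (_ ++ _).
have -> : mkseq F k.+1 = rcons (mkseq F k) (F k) by rewrite /mkseq -addn1 iotaD map_cat cats1.
rewrite map_rcons -cats1 flatten_cat /= cats0; congr (_ ++ _).
rewrite -(map_nth_iota 0); last first.
  have := hb (m - k.+1) (leq_subr _ _); rewrite subKn // step //; lia.
have /andP[/eqP e0 /eqP e1] := hx k hk.
have /andP[hk2 /eqP e2] := ckk2 k hk.
rewrite /block /F /= /cel size_mkseq -[in RHS]e0 -[in RHS]e1 -e2 e2.
move: (cblk a y k) (ckk a y k) hk2 e2 => b c hc e2.
have -> : b.+1 = b + 1 by rewrite addn1.
have -> : (b + 1).+1 = b + 2 by lia.
congr [:: _, _ & _].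
case/orP: hc e2 => /eqP -> e2 /=; rewrite e2 /= ?muln0 ?muln1 ?addn0.
  by congr [:: _; _; _]; congr nth; lia.
by congr [:: _; _; _; _; _]; congr nth; lia.
Qed.
End Decode.

Lemma size_endpoints l : size (endpoints l) = 2 * size l.
Proof. by elim: l => //= -[b c] l; rewrite mulnS => <-. Qed.

Lemma nth_endpoints l i : i < size l ->
  (nth 0 (endpoints l) (2 * i), nth 0 (endpoints l) (2 * i + 1)) = nth (0, 0) l i.
Proof.
elim: l i => [|[b c] l IH] [|i] // hi.
by rewrite -[RHS](IH i hi) mulnS add2n !addSn.
Qed.

Lemma table_mkseq (a : seq nat) (P : pred cert) (f : nat -> nat) (g : nat -> cert) i :
  let n := size (encode_nats a) in
  i < n -> f i <= n -> (forall c, P (g c) = (c %% n < f (c %/ n))) ->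
  table a (mkseq g (n * n)) P i = f i.
Proof.
move=> n hi hf hg; rewrite /table -/n -[RHS](@sum_lt n) //; apply: eq_bigr => j _.
have n0 : 0 < n by apply: leq_ltn_trans hi.
have hj : i * n + j < n * n.
  apply: leq_trans (_ : i.+1 * n <= _); last by rewrite leq_mul2r hi orbT.
  by rewrite mulSn addnC ltn_add2r.
rewrite (drop_nth (g 0)) ?size_mkseq // nth_mkseq //= hg.
by rewrite (divnMDs _ (ltn_ord j)) (modnMDs _ (ltn_ord j)).
Qed.

Section Encode.
Variables (N T r g : nat) (E : seq edge_record) (d : nat -> nat) (mm : nat -> bool).
Hypotheses (hcert : certified N T r g (size E) (eu E) (ev E) (el E) d mm)
           (hd : forall v, d v < N).
Let a := numbers N T r g E.
Let n := size (encode_nats a).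
Let m := size E.
Let B j := 4 + size (flatten (map block (take j E))).
(** Letter [c] lies in segment [c %/ n] at offset [c %% n]. Segments of [n] letters hold all entries
    in unary, since depths and block places are at most [n]; [n] segments suffice for all nodes and
    edges. *)
Definition certificate : seq cert :=
  mkseq (fun c => (c %% n < d (c %/ n), c %% n < B (c %/ n), mm (c %/ n))) (n * n).
Let y := certificate.

Let hE j : j < m -> [/\ eu E j < N, ev E j < N, el E j != [::] & size (el E j) <= 2].
Proof.
move=> hj; case/and5P: hcert => _ _ _ /all_iotaP/(_ j hj)/and5P[h1 h2 _ h3 h4] _.
by split=> //; case/and3P: h3.
Qed.

Let aE : a = [:: N; T; r; g] ++ flatten (map block E).
Proof. by []. Qed.

Lemma B_next j : j < m -> B j.+1 = B j + (3 + 2 * size (el E j)).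
Proof.
move=> hj; rewrite /B (take_nth no_edge hj) map_rcons -cats1 flatten_cat size_cat /=.
by rewrite cats0 size_endpoints addnA.
Qed.

Lemma nth_block j c : j < m -> c < 3 + 2 * size (el E j) ->
  nth 0 a (B j + c) = nth 0 (block (nth no_edge E j)) c.
Proof.
move=> hj hc; rewrite aE -{1}(cat_take_drop j E) (drop_nth no_edge hj).
rewrite map_cat flatten_cat catA nth_cat size_cat /= -/(B j) ltnNge leq_addr /= addKn.
rewrite -!/(_ ++ _) -cat_cons -!cat_cons nth_cat /= size_endpoints.
by rewrite -/(el E j) hc.
Qed.

Lemma B_size : B m = size a.
Proof. by rewrite /B take_size aE size_cat. Qed.

(** A block has at least five numbers, as its interval list is nonempty. Thus [4 + 5 * m] is at most
    the word length, which leaves room for the [2 * m + 1] nodes of [certified_size]. *)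
Lemma B_ge j : j <= m -> 4 + 5 * j <= B j.
Proof.
elim: j => [|j IH] hj //; rewrite B_next //; have := IH (ltnW hj).
by have [_ _ + _] := hE hj; case: (el E j) => //= *; lia.
Qed.

Lemma B_le j : j <= m -> B j <= n.
Proof.
move=> hj; apply: leq_trans (_ : size a <= _); last first.
  by rewrite -[size a]count_None_encode count_size.
rewrite aE size_cat /B leq_add2l -{2}(cat_take_drop j E) map_cat flatten_cat size_cat.
exact: leq_addr.
Qed.

Lemma verifier_complete : truth (word_pair (encode_nats a) y) [::] tVerifier.
Proof.
have hmn : 4 + 5 * m <= n := leq_trans (B_ge (leqnn _)) (B_le (leqnn _)).
have hN : N <= n by have := certified_size hcert; rewrite -/m; lia.
have eB j : j <= m -> cblk a y j = B j.
  by move=> hj; apply: table_mkseq => //; [rewrite -/n; lia|exact: B_le].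
have hsm i v : nth 0 a i = v -> v <= n -> small a i = v.
  by move=> <- h; rewrite /small -/n h.
have nthB j c : j < m -> c < 3 + 2 * size (el E j) ->
    nth 0 a (cblk a y j + c) = nth 0 (block (nth no_edge E j)) c.
  by move=> hj hc; rewrite eB ?(ltnW hj) // nth_block.
have eeu j : j < m -> nth 0 a (cblk a y j) = eu E j.
  by move=> hj; have := @nthB j 0 hj; rewrite addn0; apply.
have eev j : j < m -> nth 0 a (cblk a y j + 1) = ev E j.
  by move=> hj; rewrite nthB.
have ekk j : j < m -> nth 0 a (cblk a y j + 2) = size (el E j).
  by move=> hj; rewrite nthB.
have n4 : 4 <= n by lia.
have eckk j : j < m -> ckk a y j = size (el E j).
  by move=> hj; apply: hsm (ekk j hj) _; have [_ _ _] := hE hj; lia.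
have eceu j : j < m -> ceu a y j = eu E j.
  by move=> hj; apply: hsm (eeu j hj) _; have [+ _ _ _] := hE hj; lia.
have ecev j : j < m -> cev a y j = ev E j.
  by move=> hj; apply: hsm (eev j hj) _; have [_ + _ _] := hE hj; lia.
have ecel j : j < m -> cel a y j = el E j.
  move=> hj; rewrite /cel eckk //; apply: (@eq_from_nth _ (0, 0)); rewrite size_mkseq // => i hi.
  by rewrite nth_mkseq // -nth_endpoints // -!addnA !nthB //; lia.
have edep v : v < N -> cdep a y v = d v.
  move=> hv; apply: table_mkseq => //; first exact: leq_trans hN.
  by apply: leq_trans hN; apply: ltnW.
have emem j : j < m -> cmem a y j = mm j.
  move=> hj; rewrite /cmem -/n /y /certificate; have hjn : j < n by lia.
  have n0 : 0 < n by lia.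
  rewrite (drop_nth (false, false, false)) ?size_mkseq ?ltn_pmul2r //= nth_mkseq ?ltn_pmul2r //=.
  by rewrite mulnK.
case/and5P: (hcert) => hr hg /eqP hcount _ _.
have hgn : g <= n.
  by rewrite -hcount; apply: leq_trans (count_size _ _) _; rewrite size_iota -/m; lia.
have s0 : small a 0 = N by apply: hsm.
have s2 : small a 2 = r by apply: hsm => //; lia.
have s3 : small a 3 = g by apply: hsm.
rewrite truth_verifier; apply/has_iotaP; exists m; first by rewrite -/n; lia.
apply/and3P; split.
- apply/and4P; split; first by rewrite -B_size; have := B_ge (leqnn m); lia.
  + by rewrite eB // /B take0.
  + by rewrite eB // B_size.
  apply/all_iotaP => j hj; apply/andP; split.
    by rewrite !eB ?addn1 ?(ltnW hj) // B_next // -addnA eckk.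
  by rewrite ekk //; have [_ _ + +] := hE hj; case: (el E j) => [|? [|? []]].
- apply/and4P; split; [by rewrite s0|by rewrite s2|by rewrite s3|].
  by apply/all_iotaP => j hj; rewrite eeu // eev // eceu // ecev // !eqxx.
rewrite s0 s2 s3.
by rewrite (certified_ext _ _ _ eceu ecev ecel edep emem).
Qed.
End Encode.

Theorem D_MAX_in_NP : in_NP (D_MAX_01_TMT 2).
Proof.
exists cert, (fun z => eval z [::] tVerifier != 0), ('X * 'X)%R; split.
  exact: (@decider_correct _ bool).
move=> x; split=> [[I [-> /instance_certified[N [T [r [g [E [dp [mm [-> hc hd]]]]]]]]]]|].
  exists (certificate N T r g E dp mm); split; last exact: verifier_complete.
  by rewrite size_mkseq -[X in _ <= X]/(pev _ _) pevM pevX.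
case=> y [_]; rewrite -[_ != 0]/(truth (word_pair x y) [::] tVerifier) => hv.
(* The test of canonicity makes [x] a list of numbers, about which the remaining tests speak. *)
have [a ea] : exists a, x = encode_nats a.
  move: hv; rewrite truth_and truth_canonical => /andP[hx _]; exact: canonical_decode.
move: hv; rewrite ea truth_verifier => /has_iotaP[m _ /and3P[hl hx hc]].
pose F j : edge_record := (ceu a y j, cev a y j, cel a y j).
have hE : certified_list (small a 0) (nth 0 a 1) (small a 2) (small a 3) (mkseq F m) (cdep a y) (cmem a y).
  rewrite size_mkseq; move: hc; congr is_true.
  by apply: certified_ext => // j hj; rewrite /eu /ev /el nth_mkseq.
have [I [eI hI]] := certified_instance hE.
by exists I; split=> //; rewrite eI [in LHS](layout_numbers hl hx).
Qed.

Theorem theorem1 : NP_complete (D_MAX_01_TMT 2).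
Proof. exact: conj D_MAX_in_NP D_MAX_NP_hard. Qed.
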